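(* Let $n\geq 6$ be an integer and let $$\overline{P}(z)=z^{n}+az^{n-1}+bz^{n-2},$$ where $a,b\in\mathbb{C}$, $ab\neq 0$ and $a^{2}=\lambda b$ with $\lambda=4\left(1-\frac{1}{(n-1)^{2}}\right)$. Then $\overline{P}(z)$ is a strong uniqueness polynomial for meromorphic functions.
   Context: A polynomial $P$ is a strong uniqueness polynomial for meromorphic functions if for any two non-constant meromorphic functions $f,g$ on $\mathbb{C}$ and any non-zero constant $A\in\mathbb{C}$, $P(f)\equiv AP(g)$ implies $f\equiv g$. *)

(* Defs.v *)
From HB Require Import structures.
From mathcomp Require Import all_boot all_order all_algebra complex.
From mathcomp Require Import all_classical all_reals all_analysis.
Set Implicit Arguments.
Unset Strict Implicit.
Unset Printing Implicit Defensive.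
Import Order.TTheory GRing.Theory Num.Theory.
Import numFieldNormedType.Exports.

Local Open Scope ring_scope.
Local Open Scope classical_set_scope.

(* Packing R[i] as a structure lets the generic topology and norm of a
   numFieldType apply to it; over this field, [derivable f z 1] is complex
   differentiability. *)
Definition Cplx (R : realType) : numClosedFieldType := R[i]%C.

(* The Riemann sphere; [None] is the point at infinity. *)
Definition sphere (R : realType) : Type := option (Cplx R).

Definition finite_part (R : realType) (f : Cplx R -> sphere R) (z : Cplx R) :
  Cplx R := odflt 0 (f z).

(* The first clause says that every point is a regular point or an isolated
   singularity; the second, that [f z] is finite exactly at the regular points
   and that every singularity is a pole, i.e. |f| tends to infinity there. *)
Definition meromorphic (R : realType) (f : Cplx R -> sphere R) : Prop :=
  forall z : Cplx R,
    (\forall w \near z^', f w <> None /\ derivable (finite_part f) w 1) /\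
    match f z with
    | Some _ => derivable (finite_part f) z 1
    | None => forall M : Cplx R, 0 < M ->
                \forall w \near z^', M < `|finite_part f w|
    end.

Definition nonconstant (R : realType) (f : Cplx R -> sphere R) : Prop :=
  ~ exists c : sphere R, forall z, f z = c.

(* A polynomial as a map of the sphere: infinity is fixed unless the
   polynomial is constant. *)
Definition sphere_horner (R : realType) (P : {poly Cplx R}) (w : sphere R) :
  sphere R :=
  match w with
  | Some u => Some P.[u]
  | None => if (size P <= 1)%N then Some P`_0 else None
  end.

Definition strong_uniqueness_poly (R : realType) (P : {poly Cplx R}) : Prop :=
  forall (f g : Cplx R -> sphere R) (A : Cplx R),
    meromorphic f -> meromorphic g -> nonconstant f -> nonconstant g ->
    A != 0 ->
    (forall z, sphere_horner P (f z) =
               omap (fun u => A * u) (sphere_horner P (g z))) ->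
    forall z, f z = g z.

(* Main.v *)
(** Put [h = f / g] and [N = n - 1]. If [h] is constant, then so is [g] unless [A = h = 1].
    Otherwise dividing [P(f) = A P(g)] by [g^(n-2)] gives a quadratic equation for [g] with
    coefficients in [h], so its discriminant [Q(h)] is the square of a meromorphic function.
    The hypothesis on [a^2 / b] makes every root of [Q] other than [1] simple, and [1] has
    multiplicity at most 4; as [Q] has degree [2N >= 10], this leaves six simple roots
    [al_0, ..., al_5], each of which [h] takes with even multiplicity only.

    The metric [prod_j (1 + |w - al_j|)^(1/3) / |w - al_j| |dw|^2] has curvature bounded above
    by a negative constant. Its pull-back by [h] stays bounded at the points where [h = al_j]
    and at the poles of [h], so by the Ahlfors-Schwarz lemma on discs of radius tending to
    infinity it vanishes: [h] is constant. Of complex analysis this uses Goursat's and Cauchy's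
    theorems, removable singularities and the maximum principle, obtained here from
    differentiability alone. *)

Require Import Defs.
From mathcomp Require Import all_boot all_order all_algebra complex.
From mathcomp Require Import all_classical all_reals all_analysis.
From mathcomp Require Import ring lra zify.
Set Implicit Arguments.
Unset Strict Implicit.
Unset Printing Implicit Defensive.
Import Order.TTheory GRing.Theory Num.Theory.
Import numFieldNormedType.Exports.
Local Open Scope ring_scope.
Local Open Scope classical_set_scope.

(** Six is the number that fits the metric. At [al_j] it has a cone of angle pi, which even
    multiplicity unfolds; at infinity the product decays like [|w|^(6 (1/3 - 1)) = |w|^(-4)],
    exactly what makes it regular in the coordinate [1 / w]. The curvature is negative because
    [log (1 + |w|)] is strictly subharmonic, while [log |w|] and [log |h'|] are harmonic where they
    are finite.

    The obstacle is that at the exceptional points (poles of [f] or [g], zeros of [g], points where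
    [h = al_j]) the pulled-back density is only known to be bounded, so its supremum might be
    approached there without being attained. A high power of it is therefore multiplied by [|P|^2],
    where [P] vanishes at the finitely many exceptional points of the disc: the product extends
    continuously by zero, and [log |P|], being harmonic, drops out of the inequality at a maximum.
    As the power grows, the effect of [P] on the size of the maximum disappears.

    The cube of the density is used throughout, so that no fractional power has to be
    differentiated. *)

(** * A real-valued modulus on the complex numbers *)

Section Modulus.
Context {R : realType}.
Local Notation C := (Cplx R).
Implicit Types (z w : C) (t : R).

(** The norm of [C] takes its values in [C] itself; a modulus in [R] makes ordered-field arithmetic
    over [R] available. *)
Definition cabs z : R := Num.sqrt (complex.Re z ^+ 2 + complex.Im z ^+ 2).
Definition rc t : C := real_complex R t.

Lemma normE z : `|z| = rc (cabs z).
Proof. exact: normc_def. Qed.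
Lemma rc_inj : injective rc. Proof. exact: complexI. Qed.
Lemma rcD s t : rc (s + t) = rc s + rc t. Proof. exact: rmorphD. Qed.
Lemma rcB s t : rc (s - t) = rc s - rc t. Proof. exact: rmorphB. Qed.
Lemma rcM s t : rc (s * t) = rc s * rc t. Proof. exact: rmorphM. Qed.
Lemma rcV t : rc t^-1 = (rc t)^-1. Proof. exact: fmorphV. Qed.
Lemma rc0 : rc 0 = 0. Proof. by []. Qed.
Lemma rc1 : rc 1 = 1. Proof. by []. Qed.
Lemma ltrc s t : (rc s < rc t) = (s < t). Proof. exact: ltcR. Qed.
Lemma cabs_ge0 z : 0 <= cabs z. Proof. exact: sqrtr_ge0. Qed.
Lemma cabsM z w : cabs (z * w) = cabs z * cabs w.
Proof. by apply: rc_inj; rewrite rcM -!normE normrM. Qed.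
Lemma cabs0 : cabs 0 = 0. Proof. by apply: rc_inj; rewrite -normE normr0. Qed.
Lemma cabs1 : cabs 1 = 1. Proof. by apply: rc_inj; rewrite -normE normr1. Qed.
Lemma cabsN z : cabs (- z) = cabs z.
Proof. by apply: rc_inj; rewrite -!normE normrN. Qed.
Lemma cabsB z w : cabs (z - w) = cabs (w - z).
Proof. by rewrite -cabsN opprB. Qed.
Lemma cabsV z : cabs z^-1 = (cabs z)^-1.
Proof. by apply: rc_inj; rewrite rcV -!normE normfV. Qed.
Lemma cabsX z n : cabs (z ^+ n) = cabs z ^+ n.
Proof. by elim: n => [|n IH]; rewrite ?expr0 ?cabs1// !exprS cabsM IH. Qed.
Lemma cabsD z w : cabs (z + w) <= cabs z + cabs w.
Proof. by rewrite -lecR; have := ler_normD z w; rewrite !normE -rcD. Qed.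
Lemma cabs_eq0 z : (cabs z == 0) = (z == 0).
Proof. by rewrite -(inj_eq rc_inj) -normE normr_eq0. Qed.
Lemma cabs_gt0 z : (0 < cabs z) = (z != 0).
Proof. by rewrite lt_def cabs_eq0 cabs_ge0 andbT. Qed.
Lemma cabs_rc t : cabs (rc t) = `|t|.
Proof. by rewrite /cabs /rc /= expr0n addr0 sqrtr_sqr. Qed.
Lemma rc2 : rc 2 = 2. Proof. exact: (rmorphMn (real_complex R) 2 1). Qed.
Lemma cabs2 : cabs 2 = 2. Proof. by rewrite -rc2 cabs_rc ger0_norm. Qed.
Lemma cabs_sqr z : cabs z ^+ 2 = complex.Re z ^+ 2 + complex.Im z ^+ 2.
Proof. by rewrite sqr_sqrtr// addr_ge0// sqr_ge0. Qed.
Lemma Re_le_cabs z : `|complex.Re z| <= cabs z.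
Proof. by rewrite -sqrtr_sqr ler_wsqrtr// lerDl sqr_ge0. Qed.
Lemma Im_le_cabs z : `|complex.Im z| <= cabs z.
Proof. by rewrite -sqrtr_sqr ler_wsqrtr// lerDr sqr_ge0. Qed.
Lemma cabs_le_ReIm z : cabs z <= `|complex.Re z| + `|complex.Im z|.
Proof.
rewrite -(@ler_pXn2r _ 2)// ?nnegrE ?cabs_ge0 ?addr_ge0//.
rewrite cabs_sqr -[complex.Re z ^+ 2]real_normK ?num_real//.
rewrite -[complex.Im z ^+ 2]real_normK ?num_real//.
have := normr_ge0 (complex.Re z); have := normr_ge0 (complex.Im z); nra.
Qed.
Lemma cabs_sum_le (I : eqType) (s : seq I) (F : I -> C) (M : R) :
  (forall i, i \in s -> cabs (F i) <= M) -> cabs (\sum_(i <- s) F i) <= (size s)%:R * M.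
Proof.
elim: s => [|i s IH] h; first by rewrite big_nil cabs0 mul0r.
have h1 := h i (mem_head _ _).
have h2 : cabs (\sum_(j <- s) F j) <= (size s)%:R * M.
  by apply: IH => j js; apply: h; rewrite inE js orbT.
rewrite big_cons /= -natr1 mulrDl mul1r; apply: le_trans (cabsD _ _) _; lra.
Qed.
Lemma ler_cabsB z w : cabs z - cabs w <= cabs (z - w).
Proof. by rewrite lerBlDr (le_trans _ (cabsD _ _))// subrK. Qed.
Lemma cabs_dist z w v : cabs (z - v) <= cabs (z - w) + cabs (w - v).
Proof. by rewrite (le_trans _ (cabsD _ _))// addrA subrK. Qed.
Lemma cabs_small z : (forall e, 0 < e -> cabs z <= e) -> z = 0.
Proof.
move=> h; apply/eqP; rewrite -cabs_eq0 eq_le cabs_ge0 andbT leNgt.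
apply/negP => z0; have := h (cabs z / 2) ltac:(lra); lra.
Qed.
Lemma cReD z w : complex.Re (z + w) = complex.Re z + complex.Re w.
Proof. by case: z w => [a b] [c d]. Qed.
Lemma cImD z w : complex.Im (z + w) = complex.Im z + complex.Im w.
Proof. by case: z w => [a b] [c d]. Qed.
Lemma cReN z : complex.Re (- z) = - complex.Re z.
Proof. by case: z => [a b]. Qed.
Lemma cImN z : complex.Im (- z) = - complex.Im z.
Proof. by case: z => [a b]. Qed.
Lemma cReM z w : complex.Re (z * w) =
  complex.Re z * complex.Re w - complex.Im z * complex.Im w.
Proof. by case: z w => [a b] [c d]. Qed.
Lemma cImM z w : complex.Im (z * w) =
  complex.Re z * complex.Im w + complex.Im z * complex.Re w.
Proof. by case: z w => [a b] [c d]. Qed.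
Lemma cplx_eq z w :
  complex.Re z = complex.Re w -> complex.Im z = complex.Im w -> z = w.
Proof. by case: z w => [a b] [c d] /= -> ->. Qed.

Lemma near_cabs z (P : C -> Prop) :
  (\forall w \near z, P w) <-> exists2 e : R, 0 < e & forall w, cabs (w - z) < e -> P w.
Proof.
split.
  move=> /nbhs_ballP[e /= e0 he].
  (* Balls in [C] have radii in [C]; being positive forces the radius to be real. *)
  have ee : rc (complex.Re e) = e by apply: RRe_real; exact: gtr0_real.
  exists (complex.Re e); first by rewrite -ltrc ee.
  by move=> w wz; apply: he; rewrite -ball_normE /= distrC normE -ee ltrc.
move=> [e e0 he]; apply/nbhs_ballP; exists (rc e) => /=; first by rewrite -rc0 ltrc.
by move=> w; rewrite -ball_normE /= distrC normE ltrc => /he.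
Qed.

Lemma dnear_cabs z (P : C -> Prop) :
  (\forall w \near z^', P w) <->
  exists2 e : R, 0 < e & forall w, w != z -> cabs (w - z) < e -> P w.
Proof.
split.
  move=> H; have /near_cabs[e e0 he] : \forall w \near z, w != z -> P w by exact: H.
  by exists e => // w wz we; exact: he.
move=> [e e0 he]; suff : \forall w \near z, w != z -> P w by [].
by apply/near_cabs; exists e => // w we wz; exact: he.
Qed.

End Modulus.

(** * Complex derivatives *)

Section Derivative.
Context {R : realType}.
Local Notation C := (Cplx R).
Implicit Types (z w l : C) (f g : C -> C).

Lemma near_all z (P : C -> Prop) : (forall w, P w) -> \forall w \near z, P w.
Proof. by move=> h; apply/near_cabs; exists 1. Qed.

Lemma ccontP f z : {for z, continuous f} <->
  forall e : R, 0 < e -> exists2 d : R, 0 < d &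
    forall w, cabs (w - z) < d -> cabs (f w - f z) < e.
Proof.
split.
  move=> cf e e0; apply/near_cabs.
  have : \forall v \near f z, cabs (v - f z) < e by apply/near_cabs; exists e.
  exact: cf.
move=> H P /near_cabs[e e0 he]; have [d d0 hd] := H e e0.
suff : \forall w \near z, P (f w) by [].
by apply/near_cabs; exists d => // w /hd /he.
Qed.

Lemma rcontP (f : C -> R) z : {for z, continuous f} <->
  forall e : R, 0 < e -> exists2 d : R, 0 < d &
    forall w, cabs (w - z) < d -> `|f w - f z| < e.
Proof.
split.
  move=> cf e e0; apply/near_cabs.
  have : \forall v \near f z, `|v - f z| < e.
    by apply/nbhs_ballP; exists e => // v; rewrite -ball_normE /= distrC.
  exact: cf.
move=> H P /nbhs_ballP[e /= e0 he]; have [d d0 hd] := H e e0.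
suff : \forall w \near z, P (f w) by [].
apply/near_cabs; exists d => // w /hd hw; apply: he.
by rewrite -ball_normE /= distrC.
Qed.

Lemma cont_cabs z : {for z, continuous (@cabs R)}.
Proof.
apply/rcontP => e e0; exists e => // w hw.
rewrite ltr_norml; have := ler_cabsB w z; have := ler_cabsB z w.
by rewrite (cabsB z w); lra.
Qed.

(* Caratheodory's form of the derivative. *)
Definition cder f z l := exists phi : C -> C,
  [/\ {for z, continuous phi}, phi z = l &
      \forall w \near z, f w - f z = phi w * (w - z)].

Definition cdiff f z := exists l, cder f z l.
Definition holo f z := \forall w \near z, cdiff f w.

Lemma contM f g z : {for z, continuous f} -> {for z, continuous g} ->
  {for z, continuous (fun w => f w * g w)}.
Proof. move=> cf cg; exact: (@cvgM C C (nbhs z) _ f g _ _ cf cg). Qed.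
Lemma contD f g z : {for z, continuous f} -> {for z, continuous g} ->
  {for z, continuous (fun w => f w + g w)}.
Proof. move=> cf cg; exact: (@cvgD C C C (nbhs z) _ f g _ _ cf cg). Qed.
Lemma contN f z : {for z, continuous f} -> {for z, continuous (fun w => - f w)}.
Proof. move=> cf; exact: (@cvgN C C C (nbhs z) _ f _ cf). Qed.
Lemma contV f z : f z != 0 -> {for z, continuous f} ->
  {for z, continuous (fun w => (f w)^-1)}.
Proof. move=> fz cf; exact: (@cvgV C C (nbhs z) _ f _ fz cf). Qed.
Lemma cont_cst (c : C) z : {for z, continuous (fun _ => c)}.
Proof. exact: (@cst_continuous C C c z). Qed.
Lemma cont_id z : {for z, continuous (fun w : C => w)}.
Proof. exact: (@cvg_id _ (nbhs z)). Qed.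
Arguments cont_id z : clear implicits.
Arguments cont_cst c z : clear implicits.
Lemma cont_subr (c : C) z : {for z, continuous (fun w => w - c)}.
Proof. exact (contD (cont_id z) (cont_cst (- c) z)). Qed.
Arguments cont_subr c z : clear implicits.
Lemma cont_ext f g z : (\forall w \near z, f w = g w) ->
  {for z, continuous f} -> {for z, continuous g}.
Proof.
move=> fg /ccontP H; have fgz := nbhs_singleton fg; move: fg => /near_cabs[d1 d10 h1].
apply/ccontP => e /H[d d0 hd]; exists (Order.min d d1); first by rewrite lt_min d0.
by move=> w; rewrite lt_min => /andP[wd wd1]; rewrite -fgz -h1// hd.
Qed.

Lemma cder_cont f z l : cder f z l -> {for z, continuous f}.
Proof.
move=> [phi [cphi pz fE]].
apply: (@cont_ext (fun w => f z + phi w * (w - z))).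
  by apply: filterS fE => w <-; rewrite addrC subrK.
exact (contD (cont_cst (f z) z) (contM cphi (cont_subr z z))).
Qed.

Lemma cderP f z l : cder f z l <-> forall e : R, 0 < e -> exists2 d : R, 0 < d &
  forall w, cabs (w - z) < d -> cabs (f w - f z - l * (w - z)) <= e * cabs (w - z).
Proof.
split.
  move=> [phi [/ccontP cphi pz /near_cabs[d1 d10 fE]]] e e0.
  have [d d0 hd] := cphi e e0.
  exists (Order.min d d1) => [|w]; first by rewrite lt_min d0.
  rewrite lt_min => /andP[wd wd1]; rewrite fE// -pz -mulrBl cabsM.
  by rewrite ler_wpM2r ?cabs_ge0// ltW// hd.
move=> H; exists (fun w => if w == z then l else (f w - f z) / (w - z)).
split; [|by rewrite eqxx|]; last first.
  apply: near_all => w; case: eqP => [->|/eqP wz]; first by rewrite !subrr mulr0.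
  by rewrite divfK// subr_eq0.
apply/ccontP => e e0; have e20 : 0 < e / 2 by lra.
have [d d0 hd] := H _ e20; exists d => // w wd; rewrite eqxx.
case: eqP => [_|/eqP wz]; first by rewrite subrr cabs0.
have wz0 : w - z != 0 by rewrite subr_eq0.
have -> : (f w - f z) / (w - z) - l = (f w - f z - l * (w - z)) / (w - z) by field.
rewrite cabsM cabsV ltr_pdivrMr ?cabs_gt0//.
apply: le_lt_trans (hd _ wd) _; rewrite ltr_pM2r ?cabs_gt0//; lra.
Qed.

Lemma cder_uniq f z l1 l2 : cder f z l1 -> cder f z l2 -> l1 = l2.
Proof.
move=> /cderP h1 /cderP h2; apply/eqP; rewrite -subr_eq0; apply/eqP.
apply: cabs_small => e e0; have e20 : 0 < e / 2 by lra.
have [d1 d10 hd1] := h1 _ e20; have [d2 d20 hd2] := h2 _ e20.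
pose d := Order.min d1 d2; have d0 : 0 < d by rewrite lt_min d10.
have wz : cabs (z + rc (d / 2) - z) = d / 2.
  by rewrite addrC addrA addNr add0r cabs_rc ger0_norm//; lra.
have hd : d <= d1 /\ d <= d2 by rewrite !ge_min !lexx orbT.
have := hd1 (z + rc (d / 2)); have := hd2 (z + rc (d / 2)); rewrite wz.
move=> /(_ ltac:(lra)) a2 /(_ ltac:(lra)) a1.
set x := f _ - f z in a1 a2; set y := z + _ - z in a1 a2 wz.
have : cabs ((l1 - l2) * y) <= e * (d / 2).
  have -> : (l1 - l2) * y = (x - l2 * y) - (x - l1 * y) by ring.
  apply: le_trans (cabsD _ _) _; rewrite cabsN; lra.
by rewrite cabsM wz ler_pM2r//; lra.
Qed.

Lemma cder_ext f g z l : (\forall w \near z, f w = g w) -> cder f z l -> cder g z l.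
Proof.
move=> fg [phi [cphi pz fE]]; exists phi; split => //.
have fgz := nbhs_singleton fg.
near=> w; rewrite -fgz -(near fg w)//; by near: w.
Unshelve. all: by end_near.
Qed.

Lemma cder_cst (c : C) z : cder (fun _ => c) z 0.
Proof.
exists (fun _ => 0); split; [exact: (cont_cst 0)|by []|].
by apply: near_all => w; rewrite subrr mul0r.
Qed.
Lemma cder_id z : cder (fun w => w) z 1.
Proof.
exists (fun _ => 1); split; [exact: (cont_cst 1)|by []|].
by apply: near_all => w; rewrite mul1r.
Qed.
Lemma cderD f g z l m : cder f z l -> cder g z m ->
  cder (fun w => f w + g w) z (l + m).
Proof.
move=> [p [cp pz fE]] [q [cq qz gE]]; exists (fun w => p w + q w).
split; [exact: contD|by rewrite pz qz|].
near=> w; rewrite mulrDl -(near fE w)// -?(near gE w)//; [ring|by near: w..].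
Unshelve. all: by end_near.
Qed.
Lemma cderM f g z l m : cder f z l -> cder g z m ->
  cder (fun w => f w * g w) z (l * g z + f z * m).
Proof.
move=> df dg; have cg := cder_cont dg.
case: df dg => [p [cp pz fE]] [q [cq qz gE]].
exists (fun w => p w * g w + f z * q w).
split; [|by rewrite pz qz|].
  exact (contD (contM cp cg) (contM (cont_cst (f z) z) cq)).
near=> w; rewrite mulrDl mulrAC -(near fE w)// -?mulrA -?(near gE w)//; [ring|by near: w..].
Unshelve. all: by end_near.
Qed.
Lemma cderZ f z l (c : C) : cder f z l -> cder (fun w => c * f w) z (c * l).
Proof.
by move=> /(cderM (cder_cst c z)); rewrite mul0r add0r.
Qed.
Lemma cderN f z l : cder f z l -> cder (fun w => - f w) z (- l).
Proof.
move=> /(cderZ (-1)); rewrite mulN1r; apply: cder_ext.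
by apply: near_all => w; rewrite mulN1r.
Qed.
Lemma cderB f g z l m : cder f z l -> cder g z m ->
  cder (fun w => f w - g w) z (l - m).
Proof. by move=> df /cderN; exact: cderD. Qed.

Lemma cont_neq0 f z : f z != 0 -> {for z, continuous f} ->
  \forall w \near z, f w != 0.
Proof.
rewrite -cabs_gt0 => fz /ccontP /(_ _ fz)[d d0 hd]; apply/near_cabs.
exists d => // w /hd; rewrite -cabs_gt0.
have := ler_cabsB (f z) (f w); rewrite cabsB; lra.
Qed.

Lemma cderV f z l : f z != 0 -> cder f z l ->
  cder (fun w => (f w)^-1) z (- l / f z ^+ 2).
Proof.
move=> fz df; have cf := cder_cont df; have f0 := cont_neq0 fz cf.
case: df => [p [cp pz fE]].
exists (fun w => - p w * ((f w)^-1 * (f z)^-1)).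
split; [|by rewrite pz expr2 invfM|].
  exact (contM (contN cp) (contM (contV fz cf) (cont_cst (f z)^-1 z))).
near=> w; have fw0 : f w != 0 by near: w.
have e : f w - f z = p w * (w - z) by near: w.
transitivity (- (f w - f z) * ((f w)^-1 * (f z)^-1)); last by rewrite e; ring.
by field; apply/andP; split.
Unshelve. all: by end_near.
Qed.

Lemma cder_comp f g z l m : cder g z m -> cder f (g z) l ->
  cder (fun w => f (g w)) z (l * m).
Proof.
move=> dg; have cg := cder_cont dg.
case: dg => [q [cq qz gE]] [p [cp pz fE]].
exists (fun w => p (g w) * q w); split; [|by rewrite pz qz|].
  have cpg : {for z, continuous (fun w => p (g w))} by exact (continuous_comp cg cp).
  exact (contM cpg cq).
have fE' : \forall w \near z, f (g w) - f (g z) = p (g w) * (g w - g z) by exact: (cg _ fE).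
by near=> w; rewrite -mulrA -(near gE w)//; near: w.
Unshelve. all: by end_near.
Qed.

Lemma cderX f z l n : cder f z l -> cder (fun w => f w ^+ n) z (n%:R * f z ^+ n.-1 * l).
Proof.
move=> df; elim: n => [|n IH].
  rewrite !mul0r; apply: cder_ext (cder_cst 1 z); exact: near_all.
have := cderM df IH; set a := (X in cder _ _ X -> _); set b := (X in _ -> cder _ _ X).
have -> : a = b.
  rewrite /a /b; case: n {IH a b} => [|n] /=; first by rewrite !expr0; ring.
  by rewrite -[n.+2]addn1 natrD exprS; ring.
by apply: cder_ext; apply: near_all => w; rewrite exprS.
Qed.

Lemma cder_horner (P : {poly C}) z : cder (horner P) z P^`().[z].
Proof.
elim/poly_ind: P => [|P c IH].
  by rewrite deriv0 horner0; apply: cder_ext (cder_cst 0 z); apply: near_all => w;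
    rewrite horner0.
have := cderD (cderM IH (cder_id z)) (cder_cst c z).
rewrite derivD derivM derivX derivC addr0 !hornerE /= ?mulr1 ?addr0; apply: cder_ext.
by apply: near_all => w; rewrite !hornerE.
Qed.

(** The bridge from the differentiability in the definition of [meromorphic] to [cder]. *)
Lemma derivable_cdiff f z : derivable f z 1 -> cdiff f z.
Proof.
move=> /cvg_ex[l hl]; exists l; apply/cderP => e e0.
have : \forall v \near l, cabs (v - l) < e by apply/near_cabs; exists e.
move=> /hl H; have {H} /dnear_cabs[d d0 hd] : \forall h \near 0^',
  cabs (h^-1 *: (f (h *: 1 + z) - f z) - l) < e by exact: H.
exists d => // w wd; have [->|wz] := eqVneq w z.
  by rewrite !subrr mulr0 subr0 cabs0 mulr0.
have wz0 : w - z != 0 by rewrite subr_eq0.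
have := hd (w - z) wz0; rewrite subr0 => /(_ wd) /ltW.
have -> : (w - z) *: 1 + z = w by rewrite -[_ *: _]/(_ * _) mulr1 subrK.
rewrite -[_ *: _]/(_ * _) => h.
have -> : f w - f z - l * (w - z) = ((w - z)^-1 * (f w - f z) - l) * (w - z) by field.
by rewrite cabsM ler_wpM2r ?cabs_ge0.
Qed.

(* The derivative, and [0] where [f] is not differentiable. *)
Definition cD f z : C := xget 0 [set l | cder f z l].

Lemma cDP f z : cdiff f z -> cder f z (cD f z).
Proof. by move=> [l h]; rewrite /cD; case: xgetP => [y -> //|/(_ l)]. Qed.

Lemma cDE f z l : cder f z l -> cD f z = l.
Proof. by move=> h; apply: (cder_uniq _ h); apply: cDP; exists l. Qed.

End Derivative.
Arguments cont_id {R} z.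
Arguments cont_cst {R} c z.
Arguments cont_subr {R} c z.

(** * Integrals along segments *)

Section SegmentIntegral.
Context {R : realType}.
Local Notation C := (Cplx R).
Implicit Types (z w l a b c : C) (f g : C -> C) (s t : R) (Phi : R -> C).

Lemma is_derive_eps (f : R -> R) t (l : R) :
  (forall e, 0 < e -> exists2 d, 0 < d &
    forall s, `|s - t| < d -> `|f s - f t - l * (s - t)| <= e * `|s - t|) ->
  is_derive t 1 f l.
Proof.
move=> H.
have cv : h^-1 *: (f (h *: 1 + t) - f t) @[h --> 0^'] --> l.
  apply/cvgrPdist_le => e e0; have [d d0 hd] := H e e0.
  apply/nbhs_ballP; exists d => // h /=; rewrite /ball /= sub0r normrN => hd' h0.
  rewrite /GRing.scale /= mulr1.
  have := hd (h + t); rewrite addrK => /(_ hd') h1.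
  have -> : l - h^-1 * (f (h + t) - f t) = - ((f (h + t) - f t - l * h) / h) by field.
  by rewrite normrN normrM normfV ler_pdivrMr ?normr_gt0.
by apply: DeriveDef; [apply/cvg_ex; exists l|exact: cvg_lim cv].
Qed.

Lemma is_derive_epsE (f : R -> R) t (l : R) : is_derive t 1 f l ->
  (forall e, 0 < e -> exists2 d, 0 < d &
    forall s, `|s - t| < d -> `|f s - f t - l * (s - t)| <= e * `|s - t|).
Proof.
move=> [/cvg_ex[l' hl'] D] e e0.
have ll : l' = l by rewrite -D; apply/esym; exact: cvg_lim hl'.
move: hl'; rewrite ll => /cvgrPdist_le /(_ e e0) /nbhs_ballP[d /= d0 hd].
exists d => // s st; have [->|nst] := eqVneq s t.
  by rewrite !subrr mulr0 subr0 normr0 mulr0.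
have st0 : s - t != 0 by rewrite subr_eq0.
have := hd (s - t); rewrite /ball /= sub0r normrN => /(_ st st0).
rewrite /GRing.scale /= mulr1 subrK => h1.
have -> : f s - f t - l * (s - t) = - (l - (s - t)^-1 * (f s - f t)) * (s - t) by field.
by rewrite normrM normrN ler_wpM2r.
Qed.

(** The interval of integration overshoots [[0, 1]] on both sides, so that the derivative is
    two-sided at [0] and [1] as well. *)
Lemma continuous_primitive (phi : R -> R) : continuous phi ->
  exists Phi : R -> R, forall t, -1 < t < 2 -> is_derive t 1 Phi (phi t).
Proof.
move=> cphi.
exists (fun x => \int[lebesgue_measure]_(t in `[(-1)%R, x]) (phi t))%R => t /andP[t1 t2].
have int : lebesgue_measure.-integrable `[(-1 : R), 2] (EFin \o phi).
  apply: continuous_compact_integrable; first exact: segment_compact.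
  exact: continuous_subspaceT.
have [d] := @continuous_FTC1_closed R phi (-1) t 2 t2 int t1 (cphi t).
by rewrite derive1E; exact: DeriveDef.
Qed.

Definition curve_der Phi t l := forall e : R, 0 < e -> exists2 d, 0 < d &
  forall s, `|s - t| < d -> cabs (Phi s - Phi t - l * rc (s - t)) <= e * `|s - t|.

Lemma Re_rc t l : complex.Re (l * rc t) = complex.Re l * t.
Proof. by rewrite cReM /rc /= mulr0 subr0. Qed.
Lemma Im_rc t l : complex.Im (l * rc t) = complex.Im l * t.
Proof. by rewrite cImM /rc /= mulr0 add0r. Qed.

Lemma curve_der_Re Phi t l : curve_der Phi t l ->
  is_derive t 1 (fun s => complex.Re (Phi s)) (complex.Re l).
Proof.
move=> H; apply: is_derive_eps => e /H[d d0 hd]; exists d => // s /hd.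
by apply: le_trans; rewrite -Re_rc -!cReN -!cReD; exact: Re_le_cabs.
Qed.
Lemma curve_der_Im Phi t l : curve_der Phi t l ->
  is_derive t 1 (fun s => complex.Im (Phi s)) (complex.Im l).
Proof.
move=> H; apply: is_derive_eps => e /H[d d0 hd]; exists d => // s /hd.
by apply: le_trans; rewrite -Im_rc -!cImN -!cImD; exact: Im_le_cabs.
Qed.
Lemma curve_der_ReIm (p q : R -> R) t (l m : R) : is_derive t 1 p l -> is_derive t 1 q m ->
  curve_der (fun s => Complex (p s) (q s) : C) t (Complex l m).
Proof.
move=> /is_derive_epsE hp /is_derive_epsE hq e e0; have e20 : 0 < e / 2 by lra.
have [d1 d10 h1] := hp _ e20; have [d2 d20 h2] := hq _ e20.
exists (Order.min d1 d2) => [|s]; first by rewrite lt_min d10.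
rewrite lt_min => /andP[/h1 {}h1 /h2 {}h2].
apply: le_trans (cabs_le_ReIm _) _.
rewrite !cReD !cImD !cReN !cImN Re_rc Im_rc /=; lra.
Qed.

Lemma curve_der_lin Phi Psi t l m c : curve_der Phi t l -> curve_der Psi t m ->
  curve_der (fun s => c * Phi s + Psi s) t (c * l + m).
Proof.
move=> hp hq e e0; have c1 : 0 < cabs c + 1 by have := cabs_ge0 c; lra.
have e10 : 0 < e / 2 / (cabs c + 1) by rewrite divr_gt0//; lra.
have e20 : 0 < e / 2 by lra.
have [d1 d10 h1] := hp _ e10; have [d2 d20 h2] := hq _ e20.
exists (Order.min d1 d2) => [|s]; first by rewrite lt_min d10.
rewrite lt_min => /andP[/h1 {}h1 /h2 {}h2].
set A := Phi s - Phi t - _ in h1; set B := Psi s - _ - _ in h2.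
have -> : c * Phi s + Psi s - (c * Phi t + Psi t) - (c * l + m) * rc (s - t) = c * A + B.
  by rewrite /A /B; ring.
apply: le_trans (cabsD _ _) _; rewrite cabsM.
have : cabs c * cabs A <= (cabs c + 1) * (e / 2 / (cabs c + 1) * `|s - t|).
  by apply: ler_pM => //; rewrite ?cabs_ge0//; lra.
have -> : (cabs c + 1) * (e / 2 / (cabs c + 1) * `|s - t|) = e / 2 * `|s - t|.
  by field; rewrite gt_eqF.
lra.
Qed.

Lemma curve_der_affine Phi (x y t : R) l : curve_der Phi (x + t * y) l ->
  curve_der (fun s => Phi (x + s * y)) t (l * rc y).
Proof.
move=> h e e0; have y1 : 0 < `|y| + 1 by have := normr_ge0 y; lra.
have e10 : 0 < e / (`|y| + 1) by rewrite divr_gt0.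
have [d d0 hd] := h _ e10.
exists (d / (`|y| + 1)) => [|s st]; first by rewrite divr_gt0.
have E : x + s * y - (x + t * y) = (s - t) * y by ring.
have yle : `|y| <= `|y| + 1 by rewrite lerDl.
have := hd (x + s * y); rewrite E normrM.
have : `|s - t| * `|y| < d.
  move: st; rewrite ltr_pdivlMr// => st; apply: le_lt_trans st.
  by apply: ler_wpM2l.
move=> /[swap] /[apply]; rewrite rcM mulrA mulrAC => /le_trans; apply.
rewrite -mulrA [`|s - t| * _]mulrC !mulrA ler_wpM2r// mulrAC.
by rewrite ler_pdivrMr// ler_wpM2l// ltW.
Qed.

Lemma curve_der_comp (F : C -> C) a l m t : cder F (a + rc t * m) l ->
  curve_der (fun s => F (a + rc s * m)) t (l * m).
Proof.
move=> /cderP h e e0; have y1 : 0 < cabs m + 1 by have := cabs_ge0 m; lra.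
have e10 : 0 < e / (cabs m + 1) by rewrite divr_gt0.
have [d d0 hd] := h _ e10.
exists (d / (cabs m + 1)) => [|s st]; first by rewrite divr_gt0.
have E : a + rc s * m - (a + rc t * m) = m * rc (s - t) by rewrite rcB; ring.
have yle : cabs m <= cabs m + 1 by rewrite lerDl.
have := hd (a + rc s * m); rewrite E cabsM cabs_rc.
have : cabs m * `|s - t| < d.
  move: st; rewrite ltr_pdivlMr// mulrC => st; apply: le_lt_trans st.
  by apply: ler_wpM2r.
move=> /[swap] /[apply]; rewrite mulrA => /le_trans; apply.
rewrite mulrA ler_wpM2r// mulrAC.
by rewrite ler_pdivrMr// ler_wpM2l// ltW.
Qed.

Lemma real_MVT_bound (f df : R -> R) (M : R) :
  (forall t, 0 <= t <= 1 -> is_derive t 1 f (df t)) ->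
  (forall t, 0 <= t <= 1 -> `|df t| <= M) -> `|f 1 - f 0| <= M.
Proof.
move=> hd hM.
have cf : {within `[0, 1], continuous f}.
  apply: derivable_within_continuous => x; rewrite in_itv /= => x01.
  by have [] := hd x x01.
have [x|c] := @MVT_segment R f df 0 1 ler01 _ cf.
  by rewrite in_itv /= => /andP[x0 x1]; apply: hd; rewrite !ltW.
by rewrite in_itv /= => c01 ->; rewrite subr0 mulr1 hM.
Qed.

(** The mean value theorem fails for complex values; applying it to real and imaginary parts
    separately costs the factor 2. *)
Lemma curve_bound Phi (phi : R -> C) (M : R) :
  (forall t, 0 <= t <= 1 -> curve_der Phi t (phi t)) ->
  (forall t, 0 <= t <= 1 -> cabs (phi t) <= M) -> cabs (Phi 1 - Phi 0) <= 2 * M.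
Proof.
move=> hd hM.
have h1 : `|complex.Re (Phi 1) - complex.Re (Phi 0)| <= M.
  apply: (@real_MVT_bound (fun s => complex.Re (Phi s)) (fun s => complex.Re (phi s))).
    by move=> t /hd /curve_der_Re.
  by move=> t /hM; apply: le_trans; exact: Re_le_cabs.
have h2 : `|complex.Im (Phi 1) - complex.Im (Phi 0)| <= M.
  apply: (@real_MVT_bound (fun s => complex.Im (Phi s)) (fun s => complex.Im (phi s))).
    by move=> t /hd /curve_der_Im.
  by move=> t /hM; apply: le_trans; exact: Im_le_cabs.
apply: le_trans (cabs_le_ReIm _) _; rewrite cReD cImD cReN cImN; lra.
Qed.

(* Integrals along a segment are increments of a primitive, so that linearity, subdivision
   and reversal are immediate. *)
Definition seg a b t : C := a + rc t * (b - a).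
Definition isI f a b v := exists2 Phi : R -> C,
  (forall t, 0 <= t <= 1 -> curve_der Phi t (f (seg a b t) * (b - a))) & v = Phi 1 - Phi 0.

Lemma isI_bound f a b v (M : R) : isI f a b v ->
  (forall t, 0 <= t <= 1 -> cabs (f (seg a b t)) <= M) -> cabs v <= 2 * (M * cabs (b - a)).
Proof.
move=> [Phi hP ->] hM; apply: curve_bound hP _ => t t01.
by rewrite cabsM ler_wpM2r ?cabs_ge0// hM.
Qed.

Lemma isI_lin f g a b v w c : isI f a b v -> isI g a b w ->
  isI (fun z => c * f z + g z) a b (c * v + w).
Proof.
move=> [Phi hP ->] [Psi hQ ->]; exists (fun s => c * Phi s + Psi s); last by ring.
move=> t t01; rewrite mulrDl -mulrA; apply: curve_der_lin; [exact: hP|exact: hQ].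
Qed.

Lemma isI_ext f g a b v : (forall t, 0 <= t <= 1 -> f (seg a b t) = g (seg a b t)) ->
  isI f a b v -> isI g a b v.
Proof. by move=> fg [Phi hP ->]; exists Phi => // t t01; rewrite -fg//; exact: hP. Qed.

Lemma isI_uniq f a b v w : isI f a b v -> isI f a b w -> v = w.
Proof.
move=> hv hw; have := isI_lin (-1) hw hv => /(@isI_bound _ _ _ _ 0) h.
apply/eqP; rewrite -subr_eq0 -cabs_eq0 eq_le cabs_ge0 andbT addrC -mulN1r.
apply: le_trans (h _) _; last by rewrite mul0r mulr0.
by move=> t _; rewrite mulN1r addNr cabs0.
Qed.

Lemma isI_prim F f a b : (forall t, 0 <= t <= 1 -> cder F (seg a b t) (f (seg a b t))) ->
  isI f a b (F b - F a).
Proof.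
move=> h; exists (fun s => F (a + rc s * (b - a))).
  by move=> t t01; apply: curve_der_comp; exact: h.
by rewrite rc1 rc0 mul1r mul0r addr0 [a + _]addrC subrK.
Qed.

(** The same primitive serves after an affine change of parameter; [s > t] is allowed, which gives
    reversal along with subdivision. *)
Lemma isI_sub f a b Phi :
  (forall t, 0 <= t <= 1 -> curve_der Phi t (f (seg a b t) * (b - a))) ->
  forall s t, 0 <= s <= 1 -> 0 <= t <= 1 -> isI f (seg a b s) (seg a b t) (Phi t - Phi s).
Proof.
move=> hP s t s01 t01; exists (fun u => Phi (s + u * (t - s))); last first.
  by rewrite mul0r mul1r addr0 [s + _]addrC subrK.
move=> u u01; have E : seg (seg a b s) (seg a b t) u = seg a b (s + u * (t - s)).
  by rewrite /seg rcD rcM rcB; ring.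
have -> : f (seg (seg a b s) (seg a b t) u) * (seg a b t - seg a b s) =
  f (seg a b (s + u * (t - s))) * (b - a) * rc (t - s).
  by rewrite E /seg rcB; ring.
apply: curve_der_affine; apply: hP.
move: s01 t01 u01 => /andP[s0 s1] /andP[t0 t1] /andP[u0 u1]; apply/andP; split; nra.
Qed.

(** The retraction of [R] onto [[0, 1]]: it extends an integrand given on a segment to a continuous
    function on the whole line, as [continuous_primitive] requires. *)
Definition clip t : R := Order.max 0 (Order.min t 1).
Lemma clip01 t : 0 <= clip t <= 1.
Proof. by rewrite /clip le_max lexx /= ge_max ler01 ge_min lexx orbT. Qed.
Lemma clip_id t : 0 <= t <= 1 -> clip t = t.
Proof. by move=> /andP[t0 t1]; rewrite /clip min_l// max_r. Qed.
Lemma clip_lip s t : `|clip s - clip t| <= `|s - t|.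
Proof.
rewrite /clip !minEle !maxEle.
have e : 0 <= (1 : R) by []; rewrite ler_norml; case: (ger0P (s - t)) => ?;
case: (leP s 1) => ?; case: (leP t 1) => ?; rewrite ?e;
case: (leP 0 s) => ?; case: (leP 0 t) => ?; apply/andP; split; lra.
Qed.

Definition cont_seg f a b := forall t, 0 <= t <= 1 -> {for seg a b t, continuous f}.

Lemma isI_ex f a b : cont_seg f a b -> exists v, isI f a b v.
Proof.
move=> cf; pose phi s := f (seg a b (clip s)) * (b - a).
have cphi s : forall e : R, 0 < e -> exists2 d, 0 < d &
    forall u, `|u - s| < d -> cabs (phi u - phi s) < e.
  move=> e e0; have y1 : 0 < cabs (b - a) + 1 by have := cabs_ge0 (b - a); lra.
  have e10 : 0 < e / (cabs (b - a) + 1) by rewrite divr_gt0.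
  have /ccontP /(_ _ e10)[d d0 hd] := cf _ (clip01 s).
  exists (d / (cabs (b - a) + 1)) => [|u us]; first by rewrite divr_gt0.
  have h1 : cabs (seg a b (clip u) - seg a b (clip s)) < d.
    have -> : seg a b (clip u) - seg a b (clip s) = rc (clip u - clip s) * (b - a).
      by rewrite /seg rcB; ring.
    rewrite cabsM cabs_rc; move: us; rewrite ltr_pdivlMr// => us.
    apply: le_lt_trans us; apply: ler_pM => //; [exact: cabs_ge0|exact: clip_lip|lra].
  rewrite /phi -mulrBl cabsM; have := hd _ h1; rewrite ltr_pdivlMr//.
  by apply: le_lt_trans; apply: ler_wpM2l; [exact: cabs_ge0|lra].
have cRe : continuous (fun s => complex.Re (phi s)).
  move=> s; apply/cvgrPdist_lt => e e0; have [d d0 hd] := cphi s e e0.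
  apply/nbhs_ballP; exists d => // u; rewrite /ball /= distrC => /hd.
  by rewrite distrC; apply: le_lt_trans; rewrite -cReN -cReD; exact: Re_le_cabs.
have cIm : continuous (fun s => complex.Im (phi s)).
  move=> s; apply/cvgrPdist_lt => e e0; have [d d0 hd] := cphi s e e0.
  apply/nbhs_ballP; exists d => // u; rewrite /ball /= distrC => /hd.
  by rewrite distrC; apply: le_lt_trans; rewrite -cImN -cImD; exact: Im_le_cabs.
have [P hP] := continuous_primitive cRe; have [Q hQ] := continuous_primitive cIm.
exists ((Complex (P 1) (Q 1) : C) - Complex (P 0) (Q 0)).
exists (fun s => Complex (P s) (Q s) : C) => // t t01.
have t12 : -1 < t < 2 by move: t01 => /andP[? ?]; apply/andP; split; lra.
have := curve_der_ReIm (hP t t12) (hQ t t12).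
by rewrite /phi clip_id//; case: (_ * _).
Qed.

(* Only meaningful when [f] is continuous on the segment; [0] by default. *)
Definition segI f a b : C := xget 0 [set v | isI f a b v].

Lemma segIP f a b : cont_seg f a b -> isI f a b (segI f a b).
Proof. by move=> /isI_ex[v h]; rewrite /segI; case: xgetP => [y -> //|/(_ v)]. Qed.
Lemma segIE f a b v : isI f a b v -> segI f a b = v.
Proof.
by move=> h; apply: (isI_uniq _ h); rewrite /segI; case: xgetP => [y -> //|/(_ v)].
Qed.
End SegmentIntegral.

(** * Compactness of closed discs *)

Section Compactness.
Context {R : realType}.
Local Notation C := (Cplx R).
Implicit Types (z w x : C) (r : R).

(** Heine-Borel in the form used below: a radius is prescribed at every point of the plane, and
    finitely many of these discs suffice. The disc is placed in a compact square. *)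
Lemma disc_cover r (delta : C -> R) : (forall z, 0 < delta z) ->
  exists s : seq C, forall z, cabs z <= r -> exists2 x, x \in s & cabs (z - x) < delta x.
Proof.
move=> d0.
have := compact_setX (@segment_compact R (- r) r) (@segment_compact R (- r) r).
(* A set belongs to [F] when it contains every sufficiently large finite sequence; near-covering
   compactness then gives one sequence good for all points at once. *)
pose F : set_system (seq C) := fun S => exists s0 : seq C, forall s : seq C, {subset s0 <=
  s} -> S s.
have FF : Filter F.
  split; first by exists [::].
    move=> P Q [s1 h1] [s2 h2]; exists (s1 ++ s2) => s hs.
    by split; [apply: h1|apply: h2] => x xs; apply: hs; rewrite mem_cat xs ?orbT.
  by move=> P Q PQ [s0 h0]; exists s0 => s /h0 /PQ.
pose P (s : seq C) (q : R * R) := exists2 x, x \in s &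
  cabs ((Complex q.1 q.2 : C) - x) < delta x.
move=> /compact_near_coveringP /(_ _ F P FF) [].
  move=> [p q] _; set x : C := Complex p q.
  exists (ball ((p, q) : R * R) (delta x / 2), [set s : seq C | x \in s]).
    split; first by apply: nbhsx_ballx; have := d0 x; lra.
    by exists [:: x] => s; apply; rewrite inE.
  move=> [[p' q'] s] /= [hb xs]; exists x => //=.
  move: hb; rewrite /ball /= /prod_ball /ball /= => -[h1 h2].
  apply: le_lt_trans (cabs_le_ReIm _) _; rewrite cReD cReN cImD cImN /=.
  by move: h1 h2; rewrite [`|p - _|]distrC [`|q - _|]distrC; lra.
move=> s /(_ s (fun _ h => h)) hs; exists s => z zr.
have : P s (complex.Re z, complex.Im z).
  apply: hs; have := Re_le_cabs z; have := Im_le_cabs z; rewrite !ler_norml =>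
    /andP[a1 a2] /andP[a3 a4].
  by split; rewrite /= in_itv /=; apply/andP; split; lra.
by move=> [x xs hx]; exists x => //; move: hx; rewrite /=; case: z {zr}.
Qed.

(** Otherwise every point has a disc that the sequence leaves for good; finitely many of them cover,
    and the largest of their indices gives a contradiction. *)
Lemma bounded_accumulation (u : nat -> C) r : (forall k, cabs (u k) <= r) ->
  exists z, forall e : R, 0 < e -> forall K : nat, exists2 k, (K <= k)%N & cabs (u k - z) < e.
Proof.
move=> ur; apply: contrapT => /forallNP H.
have {H} : forall z, exists ek : R * nat, 0 < ek.1 /\
    forall k, (ek.2 <= k)%N -> ek.1 <= cabs (u k - z).
  move=> z; have /existsNP[e /not_implyP[e0 /existsNP[K hK]]] := H z.
  exists (e, K); split => // k /= Kk; rewrite leNgt; apply/negP => hk.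
  by apply: hK; exists k.
move=> /choice[F hF]; have [s hs] := disc_cover r (fun z => (hF z).1).
pose K := \max_(x <- s) (F x).2.
have [x xs] := hs (u K) (ur K); have := (hF x).2 K.
by rewrite {1}/K (big_rem x)//= leq_maxl => /(_ isT); lra.
Qed.

Lemma seq_argmax (T : eqType) (F : T -> R) (s : seq T) (x0 : T) : x0 \in s ->
  exists2 x : T, x \in s & forall y, y \in s -> F y <= F x.
Proof.
elim: s x0 => // a [|b s] IH x0 _.
  by exists a => [|y]; rewrite ?mem_head// inE => /eqP ->.
have [x xs hx] := IH b (mem_head _ _).
have [h|h] := leP (F a) (F x).
  exists x; first by rewrite inE xs orbT.
  by move=> y; rewrite inE => /orP[/eqP -> //|/hx].
exists a; first by rewrite mem_head.
move=> y; rewrite inE => /orP[/eqP -> //|/hx] hy; lra.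
Qed.

(** Without a maximum, each point [z] of the disc has a neighbourhood on which [V] stays below its
    value at some other point of the disc. The best of these points over a finite cover is itself
    covered, hence beaten. Points outside get a neighbourhood that misses the disc. *)
Lemma disc_EVT (V : C -> R) r : 0 <= r ->
  (forall z, cabs z <= r -> {for z, continuous V}) ->
  exists2 z0, cabs z0 <= r & forall z, cabs z <= r -> V z <= V z0.
Proof.
move=> r0 cV; apply: contrapT => H.
have {H} : forall z, exists md : C * R, 0 < md.2 /\
    if cabs z <= r then cabs md.1 <= r /\ forall w, cabs (w - z) < md.2 -> V w < V md.1
    else forall w, cabs (w - z) < md.2 -> r < cabs w.
  move=> z; case: leP => zr; last first.
    exists (0, cabs z - r); split; rewrite /= ?subr_gt0// => w.
    by have := ler_cabsB z w; rewrite cabsB; lra.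
  have [z' z'r zz'] : exists2 z', cabs z' <= r & V z < V z'.
    apply: contrapT => h; apply: H; exists z => // w wr; rewrite leNgt; apply/negP => hw.
    by apply: h; exists w.
  have e0 : 0 < V z' - V z by rewrite subr_gt0.
  have /rcontP /(_ _ e0)[d dd hd] := cV z zr.
  exists (z', d); split => //; split => //= w /hd; rewrite ltr_norml; lra.
move=> /choice[F hF]; have [s hs] := disc_cover r (fun z => (hF z).1).
have s_disc z : cabs z <= r -> exists2 x, x \in [seq x <- s | cabs x <= r] &
  cabs (z - x) < (F x).2.
  move=> zr; have [x xs zx] := hs z zr; exists x => //; rewrite mem_filter xs andbT.
  by have [_] := hF x; case: leP => // _ /(_ _ zx); lra.
have [|x1 x1s _] := s_disc 0; first by rewrite cabs0.
have [x xs hx] := seq_argmax (fun x => V (F x).1) x1s.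
have xr : cabs x <= r by move: xs; rewrite mem_filter => /andP[].
have [_] := hF x; rewrite xr => -[mr _].
have [y ys hy] := s_disc _ mr.
have yr : cabs y <= r by move: ys; rewrite mem_filter => /andP[].
have [_] := hF y; rewrite yr => -[_ /(_ _ hy)]; have := hx y ys; lra.
Qed.

End Compactness.

(** * Goursat's theorem for triangles *)

Section Goursat.
Context {R : realType}.
Local Notation C := (Cplx R).
Implicit Types (z w l a b c p : C) (f g F : C -> C) (K : C -> Prop) (s t : R).

Definition convexC K := forall a b t, K a -> K b -> 0 <= t <= 1 -> K (seg a b t).
Definition closedC K := forall z, (forall e : R, 0 < e -> exists2 w, K w & cabs (w - z) < e) ->
  K z.
Definition tri f a b c := segI f a b + segI f b c + segI f c a.

Lemma half01 : 0 <= (2^-1 : R) <= 1. Proof. by apply/andP; split; lra. Qed.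
Lemma zero01 : 0 <= (0 : R) <= 1. Proof. by rewrite lexx ler01. Qed.
Lemma one01 : 0 <= (1 : R) <= 1. Proof. by rewrite lexx ler01. Qed.
Lemma seg0 a b : seg a b 0 = a. Proof. by rewrite /seg rc0 mul0r addr0. Qed.
Lemma seg1 a b : seg a b 1 = b. Proof. by rewrite /seg rc1 mul1r addrC subrK. Qed.

Lemma segI_sub f a b s t : cont_seg f a b -> 0 <= s <= 1 -> 0 <= t <= 1 ->
  segI f (seg a b s) (seg a b t) = segI f a (seg a b t) - segI f a (seg a b s).
Proof.
move=> /segIP[Phi hP _] s01 t01; have h := isI_sub hP.
have := segIE (h _ _ zero01 s01); have := segIE (h _ _ zero01 t01); rewrite seg0 => -> ->.
by rewrite (segIE (h _ _ s01 t01)); ring.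
Qed.

Lemma segI_rev f a b : cont_seg f a b -> segI f b a = - segI f a b.
Proof.
move=> cf; have := segI_sub cf one01 zero01; rewrite seg0 seg1 => ->.
have -> : segI f a a = 0 by have := segI_sub cf zero01 zero01; rewrite seg0 subrr.
by rewrite sub0r.
Qed.

Lemma cont_seg_conv K f a b : convexC K -> (forall z, K z -> {for z, continuous f}) ->
  K a -> K b -> cont_seg f a b.
Proof. by move=> cK cf Ka Kb t t01; apply: cf; exact: cK. Qed.

Lemma segI_mid f a b : cont_seg f a b ->
  segI f a b = segI f a (seg a b 2^-1) + segI f (seg a b 2^-1) b.
Proof.
move=> cf; have := segI_sub cf half01 one01; rewrite seg1 => ->; ring.
Qed.

Lemma seg_half a b : seg a b 2^-1 = (a + b) / 2.
Proof. by rewrite /seg rcV rc2; field. Qed.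

(** The medial triangle is oriented so that each of its sides cancels a side of a corner
    triangle. *)
Definition tri4 (T : C * C * C) : seq (C * C * C) :=
  let: (a, b, c) := T in
  let m := seg a b 2^-1 in let n := seg b c 2^-1 in let p := seg c a 2^-1 in
  [:: (a, m, p); (m, b, n); (p, n, c); (m, n, p)].

Lemma tri_split K f a b c : convexC K -> (forall z, K z -> {for z, continuous f}) ->
  K a -> K b -> K c ->
  tri f a b c = \sum_(T <- tri4 (a, b, c)) tri f T.1.1 T.1.2 T.2.
Proof.
move=> cK cf Ka Kb Kc; have cs := cont_seg_conv cK cf.
rewrite /tri4; set m := seg a b _; set n := seg b c _; set p := seg c a _.
have Km : K m by exact: cK half01. have Kn : K n by exact: cK half01.
have Kp : K p by exact: cK half01.
rewrite !big_cons big_nil /tri /=.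
rewrite (segI_mid (cs _ _ Ka Kb)) (segI_mid (cs _ _ Kb Kc)) (segI_mid (cs _ _ Kc Ka)).
rewrite -/m -/n -/p (segI_rev (cs n p Kn Kp)) (segI_rev (cs m n Km Kn)) (segI_rev (cs p m Kp
  Km)).
ring.
Qed.

Lemma triE f F a b c :
  (forall z, cder F z (f z)) -> tri f a b c = 0.
Proof.
move=> h; rewrite /tri.
have e u v : segI f u v = F v - F u by apply: segIE; apply: isI_prim => t _; exact: h.
by rewrite !e; ring.
Qed.

Definition sides (T : C * C * C) (L : R) :=
  [/\ cabs (T.1.2 - T.1.1) <= L, cabs (T.2 - T.1.2) <= L & cabs (T.1.1 - T.2) <= L].
Definition inK K (T : C * C * C) := [/\ K T.1.1, K T.1.2 & K T.2].

Lemma tri4_good K T T' L : convexC K -> inK K T -> sides T L -> T' \in tri4 T ->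
  [/\ inK K T', sides T' (L / 2) & cabs (T'.1.1 - T.1.1) <= L / 2].
Proof.
case: T => [[a b] c] cK [/= Ka Kb Kc] [/= h1 h2 h3].
have c2 : cabs (2^-1 : C) = 2^-1 by rewrite cabsV cabs2.
have half (u v w : C) : w = (u - v) / 2 -> cabs (u - v) <= L -> cabs w <= L / 2.
  by move=> -> h; rewrite cabsM c2; lra.
have L0 : 0 <= L by apply: le_trans h1; exact: cabs_ge0.
have Km : K (seg a b 2^-1) by exact: cK half01.
have Kn : K (seg b c 2^-1) by exact: cK half01.
have Kp : K (seg c a 2^-1) by exact: cK half01.
rewrite /tri4 !inE => /or4P[] /eqP ->; (split; [by split| |]) => /=.
- by split; rewrite /= !seg_half; [apply: half h1|apply: half h2|apply: half h3]; field.
- by rewrite subrr cabs0; lra.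
- by split; rewrite /= !seg_half; [apply: half h1|apply: half h2|apply: half h3]; field.
- by rewrite seg_half; apply: half h1; field.
- by split; rewrite /= !seg_half; [apply: half h1|apply: half h2|apply: half h3]; field.
- by rewrite seg_half cabsB; apply: half h3; field.
- by split; rewrite /= !seg_half cabsB; [apply: half h3|apply: half h1|apply: half h2]; field.
- by rewrite seg_half; apply: half h1; field.
Qed.

Lemma cont_seg_affine (u v a b x : C) : cont_seg (fun w => u + v * (w - x)) a b.
Proof. by move=> t _; exact (contD (cont_cst u _) (contM (cont_cst v _) (cont_subr x _))). Qed.

Lemma tri_affine (u v a b c x : C) : tri (fun w => u + v * (w - x)) a b c = 0.
Proof.
apply: (@triE _ (fun w => u * w + (v / 2) * (w - x) ^+ 2)) => z.
have h := cderD (cderZ u (cder_id z)) (cderZ (v / 2) (cderX 2 (cderB (cder_id z) (cder_cst x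
  z)))).
by move: h; set y := (X in cder _ _ X -> _); rewrite (_ : y = u + v * (z - x))// /y; field.
Qed.

Lemma seg_near a b t (L : R) : 0 <= t <= 1 -> cabs (b - a) <= L -> cabs (seg a b t - a) <= L.
Proof.
move=> /andP[t0 t1] h; rewrite /seg addrC addrA addNr add0r cabsM cabs_rc ger0_norm//.
have := cabs_ge0 (b - a); nra.
Qed.

Lemma segI_approx f a b (u v x : C) (e M : R) : cont_seg f a b ->
  (forall t, 0 <= t <= 1 -> cabs (f (seg a b t) - (u + v * (seg a b t - x))) <= e) ->
  cabs (b - a) <= M -> 
  cabs (segI f a b - segI (fun w => u + v * (w - x)) a b) <= 2 * (e * M).
Proof.
move=> cf h hM; have e0 : 0 <= e by apply: le_trans (h 0 zero01); exact: cabs_ge0.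
have := isI_lin (-1) (segIP (@cont_seg_affine u v a b x)) (segIP cf).
move=> /(@isI_bound _ _ _ _ _ e); rewrite mulN1r addrC => H.
apply: le_trans (H _) _; last by apply: ler_wpM2l => //; apply: ler_wpM2l.
by move=> t t01; rewrite mulN1r addrC h.
Qed.

(** Quartering: keep the quarter with the largest integral, so that lengths halve while the integral
    loses at most a factor 4. The triangles shrink to a point, which lies in [K] because [K] is
    closed; there [f] is affine up to a small multiple of the distance, and affine functions
    integrate to zero. *)
Lemma goursat K f : convexC K -> closedC K -> (forall z, K z -> cdiff f z) ->
  forall a b c, K a -> K b -> K c -> tri f a b c = 0.
Proof.
move=> cK clK df a b c Ka Kb Kc.
have cf z : K z -> {for z, continuous f} by move=> /df[l]; exact: cder_cont.
(* The condition sits under the existential so that choice yields a total map [N], which can be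
   iterated. *)
have step (T : C * C * C) : exists T', inK K T ->
    T' \in tri4 T /\ cabs (tri f T.1.1 T.1.2 T.2) / 4 <= cabs (tri f T'.1.1 T'.1.2 T'.2).
  case: T => [[x y] z].
  have [[/= Kx Ky Kz]|h] := pselect (inK K (x, y, z)); last by exists (x, y, z).
  pose F (T : C * C * C) := cabs (tri f T.1.1 T.1.2 T.2).
  have [T' T'in hT'] := seq_argmax F (mem_head _ _ : _ \in tri4 (x, y, z)).
  exists T' => _; split => //=; rewrite (tri_split cK cf Kx Ky Kz) ler_pdivrMr// mulrC.
  exact: cabs_sum_le.
move: step => /choice[N hN].
pose L : R := cabs (b - a) + cabs (c - b) + cabs (a - c).
pose T k := iter k N (a, b, c).
pose A k := (T k).1.1.
have L0 : 0 <= L by rewrite !addr_ge0 ?cabs_ge0.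
have invT k : inK K (T k) /\ sides (T k) (L / 2 ^+ k).
  elim: k => [|k [IK IS]].
    split; first by split.
    by split; rewrite /= /L expr0 divr1; have := cabs_ge0 (b - a); have := cabs_ge0 (c - b);
      have := cabs_ge0 (a - c); lra.
  have [m4 _] := hN _ IK; have [? ? _] := tri4_good cK IK IS m4; split => //.
  by rewrite exprSr invfM mulrA.
have dA k : cabs (A k.+1 - A k) <= L / 2 ^+ k / 2.
  by have [IK IS] := invT k; have [m4 _] := hN _ IK; have [] := tri4_good cK IK IS m4.
have trk k : cabs (tri f a b c) / 4 ^+ k <= cabs (tri f (T k).1.1 (T k).1.2 (T k).2).
  elim: k => [|k IH]; first by rewrite expr0 divr1.
  have [IK IS] := invT k; have [_ h] := hN _ IK.
  apply: le_trans h; rewrite exprSr invfM mulrA; lra.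
have p2 k : 0 < (2 ^+ k : R) by rewrite exprn_gt0.
have AA k m : cabs (A (k + m)%N - A k) <= L / 2 ^+ k * (1 - (2 ^+ m)^-1).
  elim: m => [|m IH]; first by rewrite addn0 subrr cabs0 expr0 invr1 subrr mulr0.
  rewrite addnS; apply: le_trans (cabs_dist _ (A (k + m)%N) _) _.
  have := dA (k + m)%N; rewrite exprD exprSr !invfM.
  have := IH; set x := (2 ^+ k)^-1; set y := (2 ^+ m)^-1; nra.
have AL k m : (k <= m)%N -> cabs (A m - A k) <= L / 2 ^+ k.
  move=> km; have := AA k (m - k)%N; rewrite subnKC// => /le_trans; apply.
  apply: ler_piMr; first by rewrite divr_ge0// ltW.
  by rewrite gerBl invr_ge0 ltW.
have [z0 hz0] : exists z, forall e : R, 0 < e -> forall K : nat, exists2 k, (K <= k)%N &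
  cabs (A k - z) < e.
  apply: (@bounded_accumulation _ _ (cabs a + L)) => k.
  have := AL 0%N k isT; rewrite expr0 divr1 /A /= => h.
  by have := ler_cabsB (A k) a; rewrite /A; lra.
have Kz0 : K z0.
  apply: clK => e e0; have [k _ hk] := hz0 e e0 0%N; exists (A k) => //.
  by have [[]] := invT k.
have zA k : cabs (A k - z0) <= L / 2 ^+ k.
  apply/ler_addgt0Pr => e e0; have [m km hm] := hz0 e e0 k.
  apply: le_trans (cabs_dist _ (A m) _) _; rewrite cabsB; have := AL k m km; lra.
have [l /cderP dl] := df z0 Kz0.
have eta : cabs (tri f a b c) <= 0.
  apply/ler_addgt0Pr => e e0; rewrite add0r.
  (* Each of the three sides contributes at most [2 * (e' * 3 Lk) * Lk], which makes 18 in total. *)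
  pose e' := e / (18 * (L ^+ 2 + 1)).
  have L1 : 0 < L ^+ 2 + 1 by have := sqr_ge0 L; lra.
  have e'0 : 0 < e' by rewrite divr_gt0// mulr_gt0.
  have [d d0 hd] := dl _ e'0.
  have [k hk] : exists k, 3 * L / 2 ^+ k < d.
    have [k hk] : exists k : nat, 3 * L / d < 2 ^+ k.
      exists (Num.truncn (3 * L / d)).+1; apply: lt_trans (_ : (Num.truncn (3 * L / d)).+1%:R <
        _).
        by rewrite truncnS_gt.
      by rewrite -natrX ltr_nat ltn_expl.
    by exists k; move: hk; rewrite ltr_pdivrMr// => hk; rewrite ltr_pdivrMr// [d * _]mulrC.
  have [[K1 K2 K3] [s1 s2 s3]] := invT k.
  set Lk := L / 2 ^+ k in s1 s2 s3.
  have Lk0 : 0 <= Lk by rewrite divr_ge0// ltW.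
  have hk' : 3 * Lk < d by rewrite /Lk mulrA.
  (* The distance to [z0] is at most [Lk] along the side, [Lk] from its start to [A k], and [Lk]
     from [A k] to [z0]. *)
  have near_z0 (u v : C) t : (u == A k) || (u == (T k).1.2) || (u == (T k).2) ->
      cabs (v - u) <= Lk -> 0 <= t <= 1 -> 
      cabs (f (seg u v t) - (f z0 + l * (seg u v t - z0))) <= e' * (3 * Lk).
    move=> hu hv t01; have h1 := seg_near t01 hv.
    have h2 : cabs (u - A k) <= Lk.
      move: hu => /orP[/orP[]|] /eqP ->; first by rewrite subrr cabs0.
        exact: s1.
      by rewrite cabsB; exact: s3.
    have h3 : cabs (seg u v t - z0) <= 3 * Lk.
      apply: le_trans (cabs_dist _ u _) _; have := cabs_dist u (A k) z0.
      have := zA k; rewrite -/Lk; lra.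
    rewrite opprD addrA; apply: le_trans (hd _ (le_lt_trans h3 hk')) _.
    by apply: ler_wpM2l => //; exact: ltW.
  have cs := cont_seg_conv cK cf.
  have u1 : (A k == A k) || (A k == (T k).1.2) || (A k == (T k).2) by rewrite eqxx.
  have i1 := segI_approx (cs _ _ K1 K2) (fun t => @near_z0 _ _ t u1 s1) s1.
  have u2 : ((T k).1.2 == A k) || ((T k).1.2 == (T k).1.2) || ((T k).1.2 == (T k).2) by rewrite
    eqxx orbT.
  have i2 := segI_approx (cs _ _ K2 K3) (fun t => @near_z0 _ _ t u2 s2) s2.
  have u3 : ((T k).2 == A k) || ((T k).2 == (T k).1.2) || ((T k).2 == (T k).2) by rewrite eqxx
    orbT.
  have i3 := segI_approx (cs _ _ K3 K1) (fun t => @near_z0 _ _ t u3 s3) s3.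
  have tk : cabs (tri f (T k).1.1 (T k).1.2 (T k).2) <= 18 * e' * Lk ^+ 2.
    have := tri_affine (f z0) l (T k).1.1 (T k).1.2 (T k).2 z0.
    rewrite /tri; move: i1 i2 i3.
    set x1 := segI f _ _; set x2 := segI f _ _; set x3 := segI f _ _.
    set y1 := segI _ _ _; set y2 := segI _ _ _; set y3 := segI _ _ _ => i1 i2 i3 y0.
    have -> : x1 + x2 + x3 = (x1 - y1) + (x2 - y2) + (x3 - y3).
      by rewrite -[LHS]subr0 -y0; ring.
    apply: le_trans (cabsD _ _) _; have := cabsD (x1 - y1) (x2 - y2); lra.
  have := le_trans (trk k) tk.
  have -> : 18 * e' * Lk ^+ 2 = 18 * e' * L ^+ 2 / 4 ^+ k.
    have -> : (4 : R) = 2 ^+ 2 by ring.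
    by rewrite /Lk -exprM mulnC exprM expr_div_n mulrA.
  rewrite ler_pM2r ?invr_gt0 ?exprn_gt0// => /le_trans; apply.
  have -> : e = 18 * e' * (L ^+ 2 + 1) by rewrite /e'; field; rewrite gt_eqF.
  apply: ler_wpM2l; first by rewrite mulr_ge0// ltW.
  lra.
by apply/eqP; rewrite -cabs_eq0 eq_le cabs_ge0 eta.
Qed.

End Goursat.

(** * Primitives on discs, allowing one exceptional point *)

Section Primitive.
Context {R : realType}.
Local Notation C := (Cplx R).
Implicit Types (z w l a b c p u v x : C) (f g F : C -> C) (K : C -> Prop) (s t r : R).

Definition cball x r z := cabs (z - x) <= r.

Lemma cball_convex x r : convexC (cball x r).
Proof.
move=> a b t; rewrite /cball /seg => ha hb /andP[t0 t1].
have -> : a + rc t * (b - a) - x = rc (1 - t) * (a - x) + rc t * (b - x).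
  by rewrite rcB rc1; ring.
apply: le_trans (cabsD _ _) _; rewrite !cabsM !cabs_rc !ger0_norm ?subr_ge0//.
nra.
Qed.

Lemma cball_closed x r : closedC (cball x r).
Proof.
move=> z h; apply/ler_addgt0Pr => e e0; have [w hw wz] := h e e0.
apply: le_trans (cabs_dist _ w _) _; rewrite cabsB; move: hw; rewrite /cball; lra.
Qed.

Definition halfpl u p (m : R) z := m <= complex.Re (u * (z - p)).

Lemma halfpl_convex u p m : convexC (halfpl u p m).
Proof.
move=> a b t; rewrite /halfpl /seg => ha hb /andP[t0 t1].
have -> : u * (a + rc t * (b - a) - p) = u * (a - p) * rc (1 - t) + u * (b - p) * rc t.
  by rewrite rcB rc1; ring.
rewrite cReD !Re_rc; nra.
Qed.

Lemma halfpl_closed u p m : closedC (halfpl u p m).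
Proof.
move=> z h; rewrite /halfpl; have u1 : 0 < cabs u + 1 by have := cabs_ge0 u; lra.
apply/ler_addgt0Pr => e e0.
have e1 : 0 < e / (cabs u + 1) by rewrite divr_gt0.
have [w hw] := h _ e1; rewrite ltr_pdivlMr// => wz.
move: hw; rewrite /halfpl => hw.
have : complex.Re (u * (w - p)) - complex.Re (u * (z - p)) <= e.
  rewrite -cReN -cReD (_ : _ - _ = u * (w - z)); last by ring.
  apply: le_trans (ler_norm _) _; apply: le_trans (Re_le_cabs _) _.
  rewrite cabsM; have := cabs_ge0 (w - z); nra.
lra.
Qed.

(** For a triangle with apex [p]: either it is degenerate and its side integrals cancel, or a
    half-plane separates [p] from the opposite side, so that the corner at [p] can be cut off. *)
Lemma separate_or_between p b c : (exists2 t, 0 <= t <= 1 & p = seg c b t) \/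
  exists u, 0 < complex.Re (u * (b - p)) /\ 0 < complex.Re (u * (c - p)).
Proof.
set v := b - p; set w := c - p.
have [v0|v0] := eqVneq v 0.
  left; exists 1; rewrite ?one01// seg1; apply/eqP.
  by rewrite eq_sym -subr_eq0 -/v v0.
have [w0|w0] := eqVneq w 0.
  left; exists 0; rewrite ?zero01// seg0; apply/eqP.
  by rewrite eq_sym -subr_eq0 -/w w0.
have va : 0 < cabs v by rewrite cabs_gt0. have wa : 0 < cabs w by rewrite cabs_gt0.
have vs := cabs_sqr v; have ws := cabs_sqr w.
pose q := complex.Re v * complex.Re w + complex.Im v * complex.Im w.
have [h|h] := ltP 0 (q + cabs v * cabs w).
  (* The conjugate of [|v| w + |w| v], the bisector at [p]: its products with [v] and [w] have real
     parts [|v|] and [|w|] times [q + |v| |w|]. *)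
  right; exists (Complex (cabs v * complex.Re w + cabs w * complex.Re v)
     (- (cabs v * complex.Im w + cabs w * complex.Im v)) : C).
  rewrite !cReM /=; split.
    have -> : (cabs v * complex.Re w + cabs w * complex.Re v) * complex.Re v -
      (- (cabs v * complex.Im w + cabs w * complex.Im v)) * complex.Im v =
      cabs v * (q + cabs v * cabs w).
      by transitivity (cabs v * q + cabs w * (complex.Re v ^+ 2 + complex.Im v ^+ 2));
        [rewrite /q; ring|rewrite -vs; ring].
    by rewrite mulr_gt0.
  have -> : (cabs v * complex.Re w + cabs w * complex.Re v) * complex.Re w -
      (- (cabs v * complex.Im w + cabs w * complex.Im v)) * complex.Im w =
      cabs w * (q + cabs v * cabs w).
    by transitivity (cabs w * q + cabs v * (complex.Re w ^+ 2 + complex.Im w ^+ 2));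
      [rewrite /q; ring|rewrite -ws; ring].
  by rewrite mulr_gt0.
left; exists (cabs w / (cabs v + cabs w)).
  apply/andP; split; first by rewrite divr_ge0// ltW// addr_gt0.
  by rewrite ler_pdivrMr ?addr_gt0// mul1r lerDr ltW.
(* equality in Cauchy-Schwarz *)
have zero : (cabs w * complex.Re v + cabs v * complex.Re w) ^+ 2 +
            (cabs w * complex.Im v + cabs v * complex.Im w) ^+ 2 <= 0.
  have -> : (cabs w * complex.Re v + cabs v * complex.Re w) ^+ 2 +
            (cabs w * complex.Im v + cabs v * complex.Im w) ^+ 2 =
    cabs w ^+ 2 * (complex.Re v ^+ 2 + complex.Im v ^+ 2) +
    cabs v ^+ 2 * (complex.Re w ^+ 2 + complex.Im w ^+ 2) + 2 * (cabs v * cabs w) * q.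
    by rewrite /q; ring.
  rewrite -vs -ws; have vw : 0 < cabs v * cabs w by rewrite mulr_gt0.
  have -> : cabs w ^+ 2 * cabs v ^+ 2 + cabs v ^+ 2 * cabs w ^+ 2 + 2 * (cabs v * cabs w) * q =
     2 * (cabs v * cabs w) * (q + cabs v * cabs w) by ring.
  by rewrite mulr_ge0_le0// mulr_ge0// ltW.
have zr : cabs w * complex.Re v + cabs v * complex.Re w = 0.
  apply/eqP; rewrite -sqrf_eq0 eq_le sqr_ge0 andbT.
  by have := sqr_ge0 (cabs w * complex.Im v + cabs v * complex.Im w); lra.
have zi : cabs w * complex.Im v + cabs v * complex.Im w = 0.
  apply/eqP; rewrite -sqrf_eq0 eq_le sqr_ge0 andbT.
  by have := sqr_ge0 (cabs w * complex.Re v + cabs v * complex.Re w); lra.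
have wv : rc (cabs w) * v + rc (cabs v) * w = 0.
  apply: cplx_eq; rewrite ?cReD ?cImD ![rc _ * _]mulrC ?Re_rc ?Im_rc;
    [rewrite -[RHS]zr|rewrite -[RHS]zi]; ring.
have s0 : rc (cabs v) + rc (cabs w) != 0.
  by rewrite -rcD -rc0 (inj_eq rc_inj) gt_eqF// addr_gt0.
rewrite /seg rcM rcV rcD.
have -> : b - c = v - w by rewrite /v /w; ring.
have -> : c = p + w by rewrite /w; ring.
apply/eqP; rewrite -subr_eq0; apply/eqP.
transitivity (- (rc (cabs w) * v + rc (cabs v) * w) / (rc (cabs v) + rc (cabs w))).
  by field.
by rewrite wv oppr0 mul0r.
Qed.

Lemma segI_bound f a b (M : R) : cont_seg f a b ->
  (forall t, 0 <= t <= 1 -> cabs (f (seg a b t)) <= M) -> cabs (segI f a b) <=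
    2 * (M * cabs (b - a)).
Proof. by move=> /segIP; exact: isI_bound. Qed.

(* One exceptional point is harmless: cut off a small triangle at it. *)
Lemma goursat_vertex x r f p b c :
  (forall z, cball x r z -> {for z, continuous f}) ->
  (forall z, cball x r z -> z != p -> cdiff f z) ->
  cball x r p -> cball x r b -> cball x r c -> tri f p b c = 0.
Proof.
move=> cf df Kp Kb Kc; have cK := @cball_convex x r; have cs := cont_seg_conv cK cf.
have [[t t01 pE]|[u [ub uc]]] := separate_or_between p b c.
  rewrite /tri pE.
  have := segI_sub (cs _ _ Kc Kb) t01 one01; have := segI_sub (cs _ _ Kc Kb) zero01 t01.
  have := segI_sub (cs _ _ Kc Kb) one01 zero01; have := segI_sub (cs _ _ Kc Kb) zero01 zero01.
  rewrite seg1 seg0 => -> -> -> ->; ring.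
pose m := Order.min (complex.Re (u * (b - p))) (complex.Re (u * (c - p))).
have m0 : 0 < m by rewrite lt_min ub uc.
have mb : m <= complex.Re (u * (b - p)) by rewrite ge_min lexx.
have mc : m <= complex.Re (u * (c - p)) by rewrite ge_min lexx orbT.
(* What remains after cutting off the corner at [p] lies where [Re (u (z - p)) >= t m > 0], so it
   misses [p], and Goursat's theorem applies to the two triangles that form it. *)
have red t : 0 < t <= 1 -> tri f p b c = tri f p (seg p b t) (seg p c t).
  move=> /andP[t0 t1]; have t01 : 0 <= t <= 1 by rewrite t1 ltW.
  set bt := seg p b t; set ct := seg p c t.
  pose K z := cball x r z /\ halfpl u p (t * m) z.
  have KK : convexC K.
    by move=> a d s [? ?] [? ?] ?; split; [exact: cK|exact: halfpl_convex].
  have KC : closedC K.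
    move=> z h; split; [apply: cball_closed|apply: halfpl_closed] => e /h[w [? ?] ?];
      by exists w.
  have dK z : K z -> cdiff f z.
    move=> [zx zh]; apply: df => //; apply/eqP => zp; move: zh.
    rewrite zp /halfpl subrr mulr0 /= leNgt => /negP; apply; exact: mulr_gt0.
  have tm : t * m <= m by rewrite ler_piMl// ltW.
  have K1 : K b by split => //; rewrite /halfpl; lra.
  have K2 : K c by split => //; rewrite /halfpl; lra.
  have K3 : K bt.
    split; first exact: cK.
    rewrite /halfpl /bt /seg (_ : u * _ = u * (b - p) * rc t); last by ring.
    by rewrite Re_rc mulrC ler_pM2r.
  have K4 : K ct.
    split; first exact: cK.
    rewrite /halfpl /ct /seg (_ : u * _ = u * (c - p) * rc t); last by ring.
    by rewrite Re_rc mulrC ler_pM2r.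
  have g1 := goursat KK KC dK K3 K1 K2; have g2 := goursat KK KC dK K3 K2 K4.
  have Kbt : cball x r bt by case: K3. have Kct : cball x r ct by case: K4.
  have e1 : segI f bt b = segI f p b - segI f p bt.
    by have := segI_sub (cs _ _ Kp Kb) t01 one01; rewrite seg1.
  have e2 : segI f c ct = segI f p ct - segI f p c.
    by have := segI_sub (cs _ _ Kp Kc) one01 t01; rewrite seg1.
  move: g1 g2; rewrite /tri (segI_rev (cs _ _ Kbt Kct)) (segI_rev (cs _ _ Kbt Kc)).
  rewrite (segI_rev (cs _ _ Kp Kc)) (segI_rev (cs _ _ Kp Kct)) e1 e2 => g1 g2.
  apply/eqP; rewrite -subr_eq0; apply/eqP.
  by rewrite -[RHS]add0r -{1}g1 -g2; ring.
have /ccontP /(_ 1 ltr01)[d d0 hd] := cf p Kp.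
apply: cabs_small => e e0.
pose L := cabs (b - p) + cabs (c - p).
pose M := cabs (f p) + 1.
have L0 : 0 <= L by rewrite addr_ge0 ?cabs_ge0.
have M0 : 0 < M by have := cabs_ge0 (f p); rewrite /M; lra.
(* The second entry keeps the small triangle where [|f| <= M]; the third makes its integral, at most
   [4 M t L], smaller than [e]. *)
pose t := Order.min 1 (Order.min (d / (2 * (L + 1))) (e / (6 * M * (L + 1)))).
have L1 : 0 < L + 1 by lra.
have t0 : 0 < t by rewrite !lt_min ltr01 !divr_gt0 ?mulr_gt0.
have t1 : t <= 1 by rewrite ge_min lexx.
have td : t * L < d.
  have : t <= d / (2 * (L + 1)) by rewrite !ge_min lexx orbT.
  rewrite ler_pdivlMr ?mulr_gt0//; nra.
have te : t * (6 * M * L) <= e.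
  have : t <= e / (6 * M * (L + 1)) by rewrite !ge_min lexx !orbT.
  rewrite ler_pdivlMr ?mulr_gt0//.
  have : 0 <= t * M by rewrite mulr_ge0// ltW.
  nra.
rewrite (red t); last by rewrite t0.
have bt : cabs (seg p b t - p) = t * cabs (b - p).
  by rewrite /seg addrC addrA addNr add0r cabsM cabs_rc ger0_norm// ltW.
have ct : cabs (seg p c t - p) = t * cabs (c - p).
  by rewrite /seg addrC addrA addNr add0r cabsM cabs_rc ger0_norm// ltW.
have t01 : 0 <= t <= 1 by rewrite t1 ltW.
have Kbt : cball x r (seg p b t) by exact: cK.
have Kct : cball x r (seg p c t) by exact: cK.
have tL : t * L = t * cabs (b - p) + t * cabs (c - p) by rewrite /L mulrDr.
have tb0 : 0 <= t * cabs (b - p) by rewrite mulr_ge0 ?cabs_ge0 ?ltW.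
have tc0 : 0 <= t * cabs (c - p) by rewrite mulr_ge0 ?cabs_ge0 ?ltW.
have inb a : cball p (t * L) a -> cabs (f a) <= M.
  rewrite /cball => ha; have := hd a (le_lt_trans ha td).
  by have := ler_cabsB (f a) (f p); rewrite /M; lra.
have cp : cball p (t * L) p by rewrite /cball subrr cabs0 mulr_ge0// ltW.
have cb : cball p (t * L) (seg p b t) by rewrite /cball bt; lra.
have cc : cball p (t * L) (seg p c t) by rewrite /cball ct; lra.
have B y y' : cball x r y -> cball x r y' -> cball p (t * L) y -> cball p (t * L) y' ->
  cabs (segI f y y') <= 2 * (M * cabs (y' - y)).
  move=> hy hy' cy cy'; apply: segI_bound; first exact: cs.
  by move=> s s01; apply: inb; exact: cball_convex.
have b1 := B _ _ Kp Kbt cp cb. have b2 := B _ _ Kbt Kct cb cc. have b3 := B _ _ Kct Kp cc cp.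
have d2 := cabs_dist (seg p c t) p (seg p b t).
rewrite /tri; apply: le_trans (cabsD _ _) _.
have := cabsD (segI f p (seg p b t)) (segI f (seg p b t) (seg p c t)).
rewrite [cabs (p - seg p b t)]cabsB bt ct in d2.
rewrite [cabs (p - _)]cabsB bt ct in b1 b3.
nra.
Qed.

(** The triangle is the signed sum of three triangles with apex [p], wherever [p] lies in the disc.
    If [p] is outside, a smaller closed disc avoids it and contains the triangle. *)
Lemma goursat_exceptional x r f p a b c :
  (forall z, cabs (z - x) < r -> {for z, continuous f}) ->
  (forall z, cabs (z - x) < r -> z != p -> cdiff f z) ->
  cabs (a - x) < r -> cabs (b - x) < r -> cabs (c - x) < r -> tri f a b c = 0.
Proof.
move=> cf df Ka Kb Kc.
have [Kp|Kp] := ltP (cabs (p - x)) r; last first.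
  pose s := Order.max (cabs (a - x)) (Order.max (cabs (b - x)) (cabs (c - x))).
  have sr : s < r by rewrite !gt_max Ka Kb Kc.
  apply: (@goursat _ (cball x s)) => //; rewrite ?/cball ?le_max ?lexx ?orbT//.
  - exact: cball_convex.
  - exact: cball_closed.
  - move=> z zs; apply: df; first by move: zs; rewrite /cball; lra.
    by apply/eqP => zp; move: zs; rewrite /cball zp; lra.
pose s := Order.max (Order.max (cabs (p - x)) (cabs (a - x))) (Order.max (cabs (b - x)) (cabs
  (c - x))).
have sr : s < r by rewrite !gt_max Ka Kb Kc Kp.
have cf' z : cball x s z -> {for z, continuous f} by move=> zs; apply: cf; move: zs;
  rewrite /cball; lra.
have df' z : cball x s z -> z != p -> cdiff f z by move=> zs; apply: df; move: zs;
  rewrite /cball; lra.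
have sp : cball x s p by rewrite /cball !le_max lexx ?orbT.
have sa : cball x s a by rewrite /cball !le_max lexx ?orbT.
have sb : cball x s b by rewrite /cball !le_max lexx ?orbT.
have sc : cball x s c by rewrite /cball !le_max lexx ?orbT.
have cs := cont_seg_conv (@cball_convex x s) cf'.
have := goursat_vertex cf' df' sp sa sb; have := goursat_vertex cf' df' sp sb sc.
have := goursat_vertex cf' df' sp sc sa; rewrite /tri.
rewrite (segI_rev (cs _ _ sp sa)) (segI_rev (cs _ _ sp sb)) (segI_rev (cs _ _ sp sc)) =>
  h1 h2 h3.
rewrite -[RHS]addr0 -[RHS]addr0 -{1}h1 -{1}h2 -h3; ring.
Qed.

Lemma ball_primitive x r f p : 0 < r ->
  (forall z, cabs (z - x) < r -> {for z, continuous f}) ->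
  (forall z, cabs (z - x) < r -> z != p -> cdiff f z) ->
  exists F, forall z, cabs (z - x) < r -> cder F z (f z).
Proof.
move=> r0 cf df; exists (fun z => segI f x z) => z zr.
apply/cderP => e e0; have e2 : 0 < e / 2 by lra.
have /ccontP /(_ _ e2)[d d0 hd] := cf z zr.
exists (Order.min d (r - cabs (z - x))) => [|w]; first by rewrite lt_min d0 subr_gt0.
rewrite lt_min => /andP[wd wr].
have wx : cabs (w - x) < r by have := cabs_dist w z x; lra.
have xx : cabs (x - x) < r by rewrite subrr cabs0.
have cs a b : cabs (a - x) < r -> cabs (b - x) < r -> cont_seg f a b.
  move=> ha hb t t01; apply: cf.
  have h : cball x (Order.max (cabs (a - x)) (cabs (b - x))) (seg a b t).
    by apply: cball_convex => //; rewrite /cball le_max lexx ?orbT.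
  by apply: le_lt_trans h _; rewrite gt_max ha.
have := goursat_exceptional cf df xx zr wx; rewrite /tri (segI_rev (cs _ _ xx wx)) => h.
have -> : segI f x w - segI f x z = segI f z w by rewrite -[RHS]subr0 -h; ring.
have : cabs (segI f z w - segI (fun y => f z + 0 * (y - z)) z w) <= 2 * (e / 2 * cabs (w - z)).
  apply: segI_approx => //; first exact: cs.
  move=> t t01; rewrite mul0r addr0 ltW// hd//; apply: le_lt_trans wd.
  exact: seg_near.
have -> : segI (fun y => f z + 0 * (y - z)) z w = f z * (w - z).
  rewrite (segIE (@isI_prim _ (fun y => f z * y) _ _ _ _)).
    by ring.
  by move=> t _; rewrite mul0r addr0 -{2}[f z]mulr1; exact: cderZ (cder_id _).
lra.
Qed.

End Primitive.

(** * Differentiating Cauchy integrals in their parameter *)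

Section Cauchy.
Context {R : realType}.
Local Notation C := (Cplx R).
Implicit Types (z w l a b c p u v x : C) (f g F : C -> C) (s t r : R).

(** Differentiation under the integral sign: a quadratic remainder, uniform along the segment,
    survives integration. *)
Lemma segI_kernel_der (N : C -> C -> C) (N' : C -> C) a b z (B r : R) : 0 < r ->
  (forall w, cabs (w - z) < r -> cont_seg (N w) a b) -> cont_seg N' a b ->
  (forall w t, cabs (w - z) < r -> 0 <= t <= 1 ->
    cabs (N w (seg a b t) - N z (seg a b t) - (w - z) * N' (seg a b t)) <=
      B * cabs (w - z) ^+ 2) ->
  cder (fun w => segI (N w) a b) z (segI N' a b).
Proof.
move=> r0 cN cN' h; apply/cderP => e e0.
have B0 : 0 <= B.
  have w0 : cabs (z + rc (r / 2) - z) = r / 2.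
    by rewrite addrC addrA addNr add0r cabs_rc ger0_norm//; lra.
  have := h (z + rc (r / 2)) 0; rewrite w0 => /(_ ltac:(lra) zero01).
  move=> /(le_trans (cabs_ge0 _)); rewrite pmulr_lge0// exprn_gt0//; lra.
pose D := 2 * (B * cabs (b - a)) + 1.
have D0 : 0 < D by rewrite /D; have := cabs_ge0 (b - a); nra.
exists (Order.min r (e / D)) => [|w]; first by rewrite lt_min r0 divr_gt0.
rewrite lt_min => /andP[wr wD].
have zr : cabs (z - z) < r by rewrite subrr cabs0.
have i1 := isI_lin (-1) (segIP (cN z zr)) (segIP (cN w wr)).
have := isI_lin (- (w - z)) (segIP cN') i1.
move=> /(@isI_bound _ _ _ _ _ (B * cabs (w - z) ^+ 2)) H.
have -> : segI (N w) a b - segI (N z) a b - segI N' a b * (w - z) =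
  - (w - z) * segI N' a b + (-1 * segI (N z) a b + segI (N w) a b) by ring.
apply: le_trans (H _) _.
  move=> t t01; apply: le_trans (h w t wr t01).
  by rewrite le_eqVlt; apply/orP; left; apply/eqP; congr (cabs _); ring.
have : cabs (w - z) * D <= e by rewrite -ler_pdivlMr// ltW.
have := cabs_ge0 (w - z); rewrite /D; set y := cabs (w - z); set k := cabs (b - a) => y0 yD.
have -> : 2 * (B * y ^+ 2 * k) = y * (2 * (B * k)) * y by ring.
apply: ler_wpM2r => //; lra.
Qed.

Lemma contX f z n : {for z, continuous f} -> {for z, continuous (fun w => f w ^+ n)}.
Proof.
move=> cf; elim: n => [|n IH]; first exact: (cont_cst 1).
apply: cont_ext (contM cf IH); apply: near_all => w; by rewrite exprS.
Qed.

Lemma cont_cauchy_kernel g a b z n (d : R) : 0 < d -> cont_seg g a b ->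
  (forall t, 0 <= t <= 1 -> d <= cabs (seg a b t - z)) ->
  cont_seg (fun y => g y / (y - z) ^+ n) a b.
Proof.
move=> d0 cg hd t t01.
have n0 : (seg a b t - z) ^+ n != 0.
  by rewrite expf_neq0// -cabs_gt0 (lt_le_trans d0)// hd.
have c1 : {for seg a b t, continuous (fun y => (y - z) ^+ n)}.
  exact (@contX (fun y => y - z) (seg a b t) n (cont_subr z (seg a b t))).
have c2 := @contV R (fun y => (y - z) ^+ n) (seg a b t) n0 c1.
exact (contM (cg t t01) c2).
Qed.

(** The remainder of the kernel is [(w - z)^2 / ((y - w) (y - z)^2)]. Writing the exponent [1] makes
    both kernels instances of [cont_cauchy_kernel]. *)
Lemma cauchy_der1 g a b z (d M : R) : 0 < d -> cont_seg g a b ->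
  (forall t, 0 <= t <= 1 -> cabs (g (seg a b t)) <= M) ->
  (forall t, 0 <= t <= 1 -> d <= cabs (seg a b t - z)) ->
  cder (fun w => segI (fun y => g y / (y - w) ^+ 1) a b) z (segI (fun y =>
    g y / (y - z) ^+ 2) a b).
Proof.
move=> d0 cg hM hd.
have hw w : cabs (w - z) < d / 2 -> forall t, 0 <= t <= 1 -> d / 2 <= cabs (seg a b t - w).
  move=> wz t t01; have := hd t t01; have := cabs_dist (seg a b t) w z; lra.
have d20 : 0 < d / 2 by lra.
apply: (@segI_kernel_der (fun w y => g y / (y - w) ^+ 1) (fun y =>
  g y / (y - z) ^+ 2) a b z (M / (d / 2) / d ^+ 2) (d / 2) d20).
- by move=> w wz; apply: (cont_cauchy_kernel d20 cg); exact: hw.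
- exact: (cont_cauchy_kernel d0 cg).
- move=> w t wz t01; set y := seg a b t.
  have y1 := hd t t01; have y2 := hw w wz t t01; rewrite -/y in y1 y2.
  have y10 : y - z != 0 by rewrite -cabs_gt0; lra.
  have y20 : y - w != 0 by rewrite -cabs_gt0; lra.
  have -> : g y / (y - w) ^+ 1 - g y / (y - z) ^+ 1 - (w - z) * (g y / (y - z) ^+ 2) =
     g y / (y - w) / (y - z) ^+ 2 * (w - z) ^+ 2 by field; rewrite y10.
  rewrite !(cabsX, cabsV, cabsM); apply: ler_wpM2r; first by rewrite sqr_ge0.
  have g0 := cabs_ge0 (g y).
  apply: ler_pM; rewrite ?invr_ge0 ?exprn_ge0 ?mulr_ge0 ?invr_ge0 ?cabs_ge0//.
    by apply: ler_pM; rewrite ?invr_ge0 ?cabs_ge0 ?hM// lef_pV2// posrE; lra.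
  rewrite lef_pV2 ?posrE ?exprn_gt0//; first by rewrite ler_pXn2r// nnegrE; lra.
  lra.
Qed.

Lemma cauchy_der2 g a b z (d M : R) : 0 < d -> cont_seg g a b ->
  (forall t, 0 <= t <= 1 -> cabs (g (seg a b t)) <= M) ->
  (forall t, 0 <= t <= 1 -> d <= cabs (seg a b t - z)) ->
  cdiff (fun w => segI (fun y => g y / (y - w) ^+ 2) a b) z.
Proof.
move=> d0 cg hM hd.
have M0 : 0 <= M by apply: le_trans (hM 0 zero01); exact: cabs_ge0.
have hw w : cabs (w - z) < d / 2 -> forall t, 0 <= t <= 1 -> d / 2 <= cabs (seg a b t - w).
  move=> wz t t01; have := hd t t01; have := cabs_dist (seg a b t) w z; lra.
have d20 : 0 < d / 2 by lra.
exists (segI (fun y => 2 * g y / (y - z) ^+ 3) a b).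
have c2 : cont_seg (fun y => 2 * g y) a b by move=> t t01;
  exact (contM (cont_cst 2 _) (cg t t01)).
apply: (@segI_kernel_der (fun w y => g y / (y - w) ^+ 2) (fun y =>
  2 * g y / (y - z) ^+ 3) a b z (M * ((d / 2)^-1 ^+ 2 * d^-1 ^+ 2 + 2 * ((d / 2)^-1 * d^-1 ^+
  3))) (d / 2) d20).
- by move=> w wz; apply: (cont_cauchy_kernel d20 cg); exact: hw.
- exact: (cont_cauchy_kernel d0 c2).
- move=> w t wz t01; set y := seg a b t.
  have y1 := hd t t01; have y2 := hw w wz t t01; rewrite -/y in y1 y2.
  have y10 : y - z != 0 by rewrite -cabs_gt0; lra.
  have y20 : y - w != 0 by rewrite -cabs_gt0; lra.
  (* [B + 2A] over [A^2 B^3], split, with [A = y - w] and [B = y - z] *)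
  have -> : g y / (y - w) ^+ 2 - g y / (y - z) ^+ 2 - (w - z) * (2 * g y / (y - z) ^+ 3) =
     g y * ((y - w)^-1 ^+ 2 * (y - z)^-1 ^+ 2 + 2 * ((y - w)^-1 * (y - z)^-1 ^+ 3)) * (w - z)
       ^+ 2.
    by field; rewrite y10.
  rewrite cabsM cabsX cabsM; apply: ler_wpM2r; first by rewrite sqr_ge0.
  apply: ler_pM; rewrite ?cabs_ge0 ?hM//.
  apply: le_trans (cabsD _ _) _; rewrite !(cabsX, cabsV, cabsM).
  rewrite cabs2.
  have A0 : 0 <= (cabs (y - w))^-1 by rewrite invr_ge0 cabs_ge0.
  have B0 : 0 <= (cabs (y - z))^-1 by rewrite invr_ge0 cabs_ge0.
  have A1 : (cabs (y - w))^-1 <= (d / 2)^-1 by rewrite lef_pV2// posrE; lra.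
  have B1 : (cabs (y - z))^-1 <= d^-1 by rewrite lef_pV2// posrE; lra.
  have e0 : 0 <= (d / 2)^-1 by lra. have e1 : 0 <= d^-1 by lra.
  set A := (cabs (y - w))^-1; set B := (cabs (y - z))^-1.
  have X n (u v : R) : 0 <= u -> u <= v -> u ^+ n <= v ^+ n.
    by move=> u0 uv; apply: lerXn2r => //; rewrite nnegrE; lra.
  have p1 : A ^+ 2 * B ^+ 2 <= (d / 2)^-1 ^+ 2 * d^-1 ^+ 2.
    by apply: ler_pM; rewrite ?exprn_ge0// X.
  have p2 : A * B ^+ 3 <= (d / 2)^-1 * d^-1 ^+ 3.
    by apply: ler_pM; rewrite ?exprn_ge0// X.
  have p3 : 0 <= (d / 2)^-1 ^+ 2 * d^-1 ^+ 2 by rewrite mulr_ge0 ?exprn_ge0.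
  have p4 : 0 <= (d / 2)^-1 * d^-1 ^+ 3 by rewrite mulr_ge0 ?exprn_ge0.
  lra.
Qed.
End Cauchy.

(** * Cauchy's formula, holomorphy of the derivative, removable singularities *)

Section CauchyFormula.
Context {R : realType}.
Local Notation C := (Cplx R).
Implicit Types (z w l a b c p u v x y : C) (f g F : C -> C) (s t r : R).

Lemma cdiffD f g z : cdiff f z -> cdiff g z -> cdiff (fun w => f w + g w) z.
Proof. by move=> [l hl] [m hm]; exists (l + m); exact: cderD. Qed.
Lemma cdiffN f z : cdiff f z -> cdiff (fun w => - f w) z.
Proof. by move=> [l hl]; exists (- l); exact: cderN. Qed.
Lemma cdiffB f g z : cdiff f z -> cdiff g z -> cdiff (fun w => f w - g w) z.
Proof. by move=> hf hg; exact: cdiffD hf (cdiffN hg). Qed.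
Lemma cdiffM f g z : cdiff f z -> cdiff g z -> cdiff (fun w => f w * g w) z.
Proof. by move=> [l hl] [m hm]; exists (l * g z + f z * m); exact: cderM. Qed.
Lemma cdiffV f z : f z != 0 -> cdiff f z -> cdiff (fun w => (f w)^-1) z.
Proof. by move=> fz [l hl]; exists (- l / f z ^+ 2); exact: cderV. Qed.
Lemma cdiffX f z n : cdiff f z -> cdiff (fun w => f w ^+ n) z.
Proof. by move=> [l hl]; eexists; exact: cderX hl. Qed.
Lemma cdiff_cst c z : cdiff (fun _ => c) z.
Proof. by exists 0; exact: cder_cst. Qed.
Lemma cdiff_id z : cdiff (fun w => w) z.
Proof. by exists 1; exact: cder_id. Qed.
Lemma cdiff_subr c z : cdiff (fun w => w - c) z.
Proof. exact: cdiffB (cdiff_id z) (cdiff_cst c z). Qed.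
Lemma cdiff_ext f g z : (\forall w \near z, f w = g w) -> cdiff f z -> cdiff g z.
Proof. by move=> fg [l hl]; exists l; exact: cder_ext hl. Qed.
Lemma cdiff_cont f z : cdiff f z -> {for z, continuous f}.
Proof. by move=> [l]; exact: cder_cont. Qed.

Lemma near_neq y z : y != z -> \forall w \near y, w != z.
Proof.
rewrite -subr_eq0 -cabs_gt0 => h; apply/near_cabs; exists (cabs (y - z)) => // w.
by apply: contraTneq => ->; rewrite cabsB ltxx.
Qed.

Lemma cder_sum (I : eqType) (s : seq I) (f : I -> C -> C) (l : I -> C) z :
  (forall i, i \in s -> cder (f i) z (l i)) ->
  cder (fun w => \sum_(i <- s) f i w) z (\sum_(i <- s) l i).
Proof.
elim: s => [|i s IH] h.
  rewrite big_nil; apply: cder_ext (cder_cst 0 z); apply: near_all => w; by rewrite big_nil.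
rewrite big_cons; have h1 := h i (mem_head _ _).
have h2 : cder (fun w => \sum_(j <- s) f j w) z (\sum_(j <- s) l j).
  by apply: IH => j js; apply: h; rewrite inE js orbT.
by apply: cder_ext (cderD h1 h2); apply: near_all => w; rewrite big_cons.
Qed.

Lemma cdiff_sum (I : eqType) (s : seq I) (f : I -> C -> C) z :
  (forall i, i \in s -> cdiff (f i) z) -> cdiff (fun w => \sum_(i <- s) f i w) z.
Proof.
by move=> h; exists (\sum_(i <- s) cD (f i) z); apply: cder_sum => i /h /cDP.
Qed.

Definition ii : C := Complex 0 1.
Lemma ii2 : ii * ii = -1.
Proof. by apply: cplx_eq; rewrite ?cReM ?cImM /= ?oppr0; ring. Qed.

Definition units4 : seq C := [:: 1; ii; -1; - ii].
(** The contour is a square with vertices [x + s o]. Its edges are quarter turns of one another, and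
    segment integrals are enough. *)
Definition edge x s (o : C) : C * C := (x + rc s * o, x + rc s * o * ii).
Definition contour g x s := \sum_(o <- units4) segI g (edge x s o).1 (edge x s o).2.

Lemma cabs_units4 o : o \in units4 -> cabs o = 1.
Proof.
have ci : cabs ii = 1 by rewrite /cabs /= expr0n expr1n add0r sqrtr1.
by rewrite !inE => /or4P[] /eqP ->; rewrite ?cabsN ?cabs1 ?ci.
Qed.

Lemma edge_pt x s o t : seg (edge x s o).1 (edge x s o).2 t - x = rc s * o * Complex (1 - t) t.
Proof.
have -> : (Complex (1 - t) t : C) = 1 - rc t + rc t * ii.
  by apply: cplx_eq; rewrite ?cReD ?cImD ?cReN ?cImN ?cReM ?cImM /=; ring.
rewrite /seg /edge /=; ring.
Qed.

(** The true minimum is [s / sqrt 2]; the weaker [s / 2] keeps the constants rational. *)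
Lemma edge_dist x s o t : 0 < s -> o \in units4 -> 0 <= t <= 1 ->
  s / 2 <= cabs (seg (edge x s o).1 (edge x s o).2 t - x) <= s.
Proof.
move=> s0 /cabs_units4 o1 /andP[t0 t1]; rewrite edge_pt !cabsM o1 cabs_rc (gtr0_norm s0) mulr1.
have h := cabs_sqr (Complex (1 - t) t : C); rewrite /= in h.
have h0 := cabs_ge0 (Complex (1 - t) t : C); set q := cabs _ in h h0 *.
have q1 : q <= 1 by rewrite -(@ler_pXn2r _ 2)// ?nnegrE// h expr1n; nra.
have q2 : 2^-1 <= q.
  rewrite -(@ler_pXn2r _ 2)// ?nnegrE ?invr_ge0// h.
  by have := sqr_ge0 (t - 2^-1); nra.
apply/andP; split; nra.
Qed.

Lemma contour_primitive F g x s : 0 < s ->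
  (forall y, cabs (y - x) <= s -> cder F y (g y)) -> contour g x s = 0.
Proof.
move=> s0 h; rewrite /contour.
have e o : o \in units4 -> segI g (edge x s o).1 (edge x s o).2 =
  F (edge x s o).2 - F (edge x s o).1.
  move=> o4; apply: segIE; apply: isI_prim => t t01; apply: h.
  by have /andP[] := edge_dist x s0 o4 t01.
rewrite big_seq; under eq_bigr => o o4 do rewrite e//; rewrite -big_seq.
rewrite !big_cons big_nil /edge /=.
have -> : rc s * ii * ii = rc s * -1 by rewrite -mulrA ii2.
have -> : rc s * - ii * ii = rc s * 1 by rewrite -mulrA mulNr ii2 opprK.
have -> : rc s * 1 * ii = rc s * ii by rewrite mulr1.
have -> : rc s * -1 * ii = rc s * - ii by rewrite -mulrA mulN1r.
ring.
Qed.

Definition winding x s z := contour (fun y => 1 / (y - z) ^+ 1) x s.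

(** By rotation the four edges contribute equally, and along an edge the integrand has imaginary
    part [1 / ((1 - t)^2 + t^2) > 0]. Being non-zero is all that is used, so the value [2 pi i] is
    never computed. *)
Lemma winding_neq0 x s : 0 < s -> winding x s x != 0.
Proof.
move=> s0; rewrite /winding /contour.
pose phi t : C := (ii - 1) / Complex (1 - t) t.
have c0 t : (Complex (1 - t) t : C) != 0.
  rewrite -cabs_gt0 lt_def cabs_ge0 andbT -sqrf_eq0 cabs_sqr /= gt_eqF//.
  by have := sqr_ge0 (t - 2^-1); nra.
have rs0 : rc s != 0 by rewrite -rc0 (inj_eq rc_inj) gt_eqF.
have E o t : o \in units4 -> 1 / (seg (edge x s o).1 (edge x s o).2 t - x) ^+ 1 *
    ((edge x s o).2 - (edge x s o).1) = phi t.
  move=> o4; rewrite edge_pt /edge /phi /= expr1.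
  have o0 : o != 0 by rewrite -cabs_gt0 cabs_units4.
  by field; rewrite c0 o0 rs0.
have d4 : 0 < s / 2 by lra.
have ex o : o \in units4 -> isI (fun y => 1 / (y - x) ^+ 1) (edge x s o).1 (edge x s o).2
    (segI (fun y => 1 / (y - x) ^+ 1) (edge x s o).1 (edge x s o).2).
  move=> o4; apply: segIP; apply: (cont_cauchy_kernel (d := s / 2)) => //.
    by move=> t _; exact: (cont_cst 1).
  by move=> t t01; have /andP[] := edge_dist x s0 o4 t01.
have u1 : 1 \in units4 by exact: mem_head.
have [Phi hP vE] := ex 1 u1.
have same o : o \in units4 -> segI (fun y => 1 / (y - x) ^+ 1) (edge x s o).1 (edge x s o).2 =
  Phi 1 - Phi 0.
  move=> o4; apply: segIE; exists Phi => // t t01; by rewrite E// -(E 1 t u1); exact: hP.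
rewrite big_seq; under eq_bigr => o o4 do rewrite same//; rewrite -big_seq.
rewrite !big_cons big_nil addr0.
have dI t : 0 <= t <= 1 -> is_derive t 1 (fun s => complex.Im (Phi s)) (complex.Im (phi t)).
  by move=> t01; have := hP t t01; rewrite (E 1 t u1) => /curve_der_Im.
have cI : {within `[0, 1], continuous (fun s => complex.Im (Phi s))}.
  apply: derivable_within_continuous => t; rewrite in_itv /= => t01.
  by have [] := dI t t01.
have [t|t] := @MVT_segment R (fun s => complex.Im (Phi s)) (fun t =>
  complex.Im (phi t)) 0 1 ler01 _ cI.
  by rewrite in_itv /= => /andP[t0 t1]; apply: dI; rewrite !ltW.
move=> _; rewrite subr0 mulr1 => Ht.
have phit : 0 < complex.Im (phi t).
  have q0 : 0 < (1 - t) ^+ 2 + t ^+ 2 by have := sqr_ge0 (t - 2^-1); nra.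
  have q1 : (1 - t) ^+ 2 + t ^+ 2 != 0 by rewrite gt_eqF.
  have -> : complex.Im (phi t) = 1 / ((1 - t) ^+ 2 + t ^+ 2).
    rewrite /phi cImM cReD cImD cReN cImN /=; field; exact: q1.
  by rewrite divr_gt0.
apply/eqP => H; have := congr1 (fun v : C => complex.Im v) H.
move: phit; rewrite -Ht !cImD !cImN (_ : complex.Im (0 : C) = 0)//; lra.
Qed.

(** The difference quotient [k], completed by the derivative at [z], is continuous there and
    differentiable elsewhere. It therefore has a primitive on the disc, and its contour integral
    vanishes. *)
Lemma cauchy_formula f x r z : 0 < r -> (forall y, cabs (y - x) < r -> cdiff f y) ->
  cabs (z - x) < r / 8 ->
  contour (fun y => f y / (y - z) ^+ 1) x (r / 2) = f z * winding x (r / 2) z.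
Proof.
move=> r0 df zx; set s := r / 2.
have s0 : 0 < s by rewrite /s; lra.
have sr : s < r by rewrite /s; lra.
have zr : cabs (z - x) < r by lra.
have dz := cDP (df z zr).
pose k y := if y == z then cD f z else (f y - f z) / (y - z).
have dk y : cabs (y - x) < r -> y != z -> cdiff k y.
  move=> yr yz; have yz0 : y - z != 0 by rewrite subr_eq0.
  have h : cdiff (fun w => (f w - f z) / (w - z)) y.
    apply: cdiffM; first exact: cdiffB (df y yr) (cdiff_cst _ _).
    exact: (@cdiffV (fun w => w - z) y yz0 (cdiff_subr z y)).
  apply: cdiff_ext h; have /near_cabs[d d0 hd] := near_neq yz.
  by apply/near_cabs; exists d => // w /hd; rewrite /k => /negbTE ->.
have ck y : cabs (y - x) < r -> {for y, continuous k}.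
  move=> yr; have [->|yz] := eqVneq y z; last exact: cdiff_cont (dk y yr yz).
  have [phi [cphi pz /near_cabs[d d0 hd]]] := dz.
  apply: cont_ext cphi; apply/near_cabs; exists d => // w wd; rewrite /k.
  case: eqP => [->//|/eqP wz]; rewrite hd// mulfK//.
  by rewrite subr_eq0.
have [F hF] := ball_primitive r0 ck dk.
have k0 : contour k x s = 0 by apply: (contour_primitive s0) => y ys; apply: hF; lra.
(* The edges keep distance [s / 2] from [x], and [z] is within [r / 8 = s / 4] of [x]. *)
have far o t : o \in units4 -> 0 <= t <= 1 -> s / 4 <=
  cabs (seg (edge x s o).1 (edge x s o).2 t - z).
  move=> o4 t01; have /andP[h1 _] := edge_dist x s0 o4 t01.
  have := cabs_dist (seg (edge x s o).1 (edge x s o).2 t) z x; rewrite /s in h1 *; lra.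
have s4 : 0 < s / 4 by lra.
have cf o : o \in units4 -> cont_seg f (edge x s o).1 (edge x s o).2.
  move=> o4 t t01; apply: cdiff_cont; apply: df.
  by have /andP[_ h] := edge_dist x s0 o4 t01; lra.
apply/eqP; rewrite -subr_eq0 -k0; apply/eqP; rewrite /winding /contour mulr_sumr -sumrB.
rewrite big_seq [RHS]big_seq; apply: eq_bigr => o o4; apply/esym; apply: segIE.
have i1 := segIP (cont_cauchy_kernel (n := 1) s4 (cf o o4) (fun t => @far o t o4)).
have i2 := segIP (cont_cauchy_kernel (n := 1) s4 (fun t _ =>
  cont_cst 1 (seg (edge x s o).1 (edge x s o).2 t)) (fun t => @far o t o4)).
have := isI_lin (- f z) i2 i1; rewrite mulNr addrC; apply: isI_ext => t t01.
have h := @far o t o4 t01; set y := seg _ _ t in h *.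
have yz : y - z != 0 by rewrite -cabs_gt0; lra.
rewrite /k -subr_eq0 (negbTE yz) expr1; by field.
Qed.

Lemma contour_der g x r z : 0 < r -> (forall y, cabs (y - x) < r -> {for y, continuous g}) ->
  cabs (z - x) < r / 8 ->
  cder (fun w => contour (fun y => g y / (y - w) ^+ 1) x (r / 2)) z
    (contour (fun y => g y / (y - z) ^+ 2) x (r / 2)) /\
  cdiff (fun w => contour (fun y => g y / (y - w) ^+ 2) x (r / 2)) z.
Proof.
move=> r0 cg zx; set s := r / 2.
have s0 : 0 < s by rewrite /s; lra.
have sr : s < r by rewrite /s; lra.
have far o t : o \in units4 -> 0 <= t <= 1 -> s / 4 <=
  cabs (seg (edge x s o).1 (edge x s o).2 t - z).
  move=> o4 t01; have /andP[h1 _] := edge_dist x s0 o4 t01.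
  have := cabs_dist (seg (edge x s o).1 (edge x s o).2 t) z x; rewrite /s in h1 *; lra.
have s4 : 0 < s / 4 by lra.
have cg' o : o \in units4 -> cont_seg g (edge x s o).1 (edge x s o).2.
  move=> o4 t t01; apply: cg.
  by have /andP[_ h] := edge_dist x s0 o4 t01; lra.
have [M hM] : exists M : R, forall y, cabs (y - x) <= s -> cabs (g y) <= M.
  have [|w _ hw] := @disc_EVT R (fun w => cabs (g (x + w))) s (ltW s0).
    move=> w ws; have cgw : {for x + w, continuous g} by apply: cg; rewrite addrC addKr; lra.
    have c1 : {for w, continuous (fun w => x + w)} by exact (contD (cont_cst x w) (cont_id w)).
    have c2 : {for w, continuous (fun w => g (x + w))}.
      exact (@continuous_comp _ _ _ (fun w => x + w) g w c1 cgw).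
    exact (@continuous_comp _ _ _ (fun w => g (x + w)) (@cabs R) w c2 (@cont_cabs R _)).
  exists (cabs (g (x + w))) => y ys; have := hw (y - x) ys.
  by rewrite [x + (y - x)]addrC subrK.
have hM' o t : o \in units4 -> 0 <= t <= 1 -> cabs (g (seg (edge x s o).1 (edge x s o).2 t)) <=
  M.
  by move=> o4 t01; apply: hM; have /andP[] := edge_dist x s0 o4 t01.
split.
  apply: (@cder_sum _ units4 (fun o w => segI (fun y =>
    g y / (y - w) ^+ 1) (edge x s o).1 (edge x s o).2)) => o o4.
  exact: (cauchy_der1 s4 (cg' o o4) (fun t => @hM' o t o4) (fun t => @far o t o4)).
apply: (@cdiff_sum _ units4 (fun o w => segI (fun y =>
  g y / (y - w) ^+ 2) (edge x s o).1 (edge x s o).2)) => o o4.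
exact: (cauchy_der2 s4 (cg' o o4) (fun t => @hM' o t o4) (fun t => @far o t o4)).
Qed.

(** Near [x] the function is the quotient [J1 / W1] of two contour integrals, each differentiable
    twice. The winding integral is differentiated too, instead of being shown constant. *)
Lemma holo_cdiff_cD f x : holo f x -> cdiff (cD f) x.
Proof.
move=> /near_cabs[r r0 df].
have cf y : cabs (y - x) < r -> {for y, continuous f} by move=> /df /cdiff_cont.
have c1 y : cabs (y - x) < r -> {for y, continuous (fun _ : C => 1 : C)} by move=> _;
  exact: (cont_cst 1).
pose J1 w := contour (fun y => f y / (y - w) ^+ 1) x (r / 2).
pose J2 w := contour (fun y => f y / (y - w) ^+ 2) x (r / 2).
pose W1 w := winding x (r / 2) w.
pose W2 w := contour (fun y => 1 / (y - w) ^+ 2) x (r / 2).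
have r8 : 0 < r / 8 by lra.
have r2 : 0 < r / 2 by lra.
have dJ z : cabs (z - x) < r / 8 -> cder J1 z (J2 z) /\ cdiff J2 z by exact: contour_der.
have dW z : cabs (z - x) < r / 8 -> cder W1 z (W2 z) /\ cdiff W2 z by exact: (@contour_der (fun
  _ => 1)).
have W0 : W1 x != 0 by exact: winding_neq0.
have xx : cabs (x - x) < r / 8 by rewrite subrr cabs0.
have cW : {for x, continuous W1} by apply: cder_cont (dW x xx).1.
have /near_cabs[d d0 hd] := cont_neq0 W0 cW.
pose e := Order.min d (r / 8); have e0 : 0 < e by rewrite lt_min d0.
have fE z : cabs (z - x) < e -> f z = J1 z / W1 z.
  rewrite lt_min => /andP[zd z8]; rewrite /J1 (cauchy_formula r0 df z8) mulfK//; exact: hd.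
have DE z : cabs (z - x) < e -> cD f z = J2 z / W1 z + J1 z * (- W2 z / W1 z ^+ 2).
  move=> ze; move: (ze); rewrite lt_min => /andP[zd z8].
  have h := cderM (dJ z z8).1 (cderV (hd z zd) (dW z z8).1).
  apply: cDE; apply: cder_ext h; apply/near_cabs; exists (e - cabs (z - x));
    first by rewrite subr_gt0.
  by move=> w wz; rewrite -fE//; have := cabs_dist w z x; lra.
have h1 : cdiff W1 x by exists (W2 x); exact: (dW x xx).1.
have h2 : cdiff J1 x by exists (J2 x); exact: (dJ x xx).1.
have h3 := (dJ x xx).2. have h4 := (dW x xx).2.
have h : cdiff (fun z => J2 z / W1 z + J1 z * (- W2 z / W1 z ^+ 2)) x.
  have hv := cdiffV W0 h1.
  have w2 : W1 x ^+ 2 != 0 by rewrite expf_neq0.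
  have hv2 := @cdiffV (fun z => W1 z ^+ 2) x w2 (cdiffX 2 h1).
  exact: cdiffD (cdiffM h3 hv) (cdiffM h2 (cdiffM (cdiffN h4) hv2)).
by apply: cdiff_ext h; apply/near_cabs; exists e => // w we; rewrite DE.
Qed.

Lemma holo_near f x : holo f x -> \forall z \near x, holo f z.
Proof.
move=> /near_cabs[r r0 df]; apply/near_cabs; exists r => // z zr.
apply/near_cabs; exists (r - cabs (z - x)); first by rewrite subr_gt0.
by move=> w wz; apply: df; have := cabs_dist w z x; lra.
Qed.

Lemma holo_cD f x : holo f x -> holo (cD f) x.
Proof. by move=> /holo_near; apply: filterS => z; exact: holo_cdiff_cD. Qed.

(** The exceptional point does not prevent a primitive, and [f] is the derivative of that
    holomorphic primitive. *)
Lemma removable_continuous f p : {for p, continuous f} ->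
  (\forall z \near p^', cdiff f z) -> holo f p.
Proof.
move=> cf /dnear_cabs[r r0 df].
have cf' z : cabs (z - p) < r -> {for z, continuous f}.
  by move=> zr; have [->//|zp] := eqVneq z p; exact: cdiff_cont (df z zp zr).
have [F hF] := ball_primitive (p := p) r0 cf' (fun z zr zp => df z zp zr).
have hoF : holo F p by apply/near_cabs; exists r => // z zr; exists (f z); exact: hF.
have h : cdiff f p.
  apply: cdiff_ext (holo_cdiff_cD hoF); apply/near_cabs; exists r => // z zr.
  exact: cDE (hF z zr).
apply/near_cabs; exists r => // z zr; have [->//|zp] := eqVneq z p; exact: df.
Qed.

(** Riemann's argument: [(z - p) f z] is continuous at [p] with value [0], hence holomorphic, and
    its difference quotient at [p] extends [f]. *)
Lemma removable_bounded f p (M : R) : (\forall z \near p^', cdiff f z) ->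
  (\forall z \near p^', cabs (f z) <= M) ->
  exists2 F, holo F p & \forall z \near p^', F z = f z.
Proof.
move=> /dnear_cabs[r r0 df] /dnear_cabs[r' r'0 hM].
pose g z := if z == p then 0 else (z - p) * f z.
have dg z : z != p -> cabs (z - p) < r -> cdiff g z.
  move=> zp zr.
  apply: cdiff_ext (cdiffM (cdiff_subr p z) (df z zp zr)).
  have /near_cabs[d d0 hd] := near_neq zp.
  by apply/near_cabs; exists d => // w /hd; rewrite /g => /negbTE ->.
have cg : {for p, continuous g}.
  apply/ccontP => e e0; pose M1 := `|M| + 1.
  have M10 : 0 < M1 by rewrite /M1; have := normr_ge0 M; lra.
  exists (Order.min r' (e / M1)); first by rewrite lt_min r'0 divr_gt0.
  move=> w; rewrite lt_min => /andP[wr wM]; rewrite /g eqxx subr0.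
  case: eqP => [_|/eqP wp]; first by rewrite cabs0.
  rewrite cabsM; move: wM; rewrite ltr_pdivlMr//; apply: le_lt_trans.
  apply: ler_wpM2l; first exact: cabs_ge0.
  apply: le_trans (hM w wp wr) _; rewrite /M1; have := ler_norm M; lra.
have hg : holo g p by apply: removable_continuous => //; apply/dnear_cabs; exists r.
have [l [phi [cphi pl /near_cabs[d d0 hphi]]]] : cdiff g p.
  by have /near_cabs[d d0] := hg; apply; rewrite subrr cabs0.
exists (fun z => if z == p then l else f z); last first.
  by apply/dnear_cabs; exists 1 => // w /negbTE ->.
apply: removable_continuous.
  apply: cont_ext cphi; apply/near_cabs; exists d => // w wd.
  case: eqP => [->//|/eqP wp]; have := hphi w wd; rewrite /g eqxx subr0 (negbTE wp) mulrC.
  by move/mulIf => -> //; rewrite subr_eq0.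
apply/dnear_cabs; exists r => // w wp wr; apply: cdiff_ext (df w wp wr).
have /near_cabs[d' d'0 hd] := near_neq wp.
by apply/near_cabs; exists d' => // v /hd => /negbTE ->.
Qed.

End CauchyFormula.

(** * Real derivatives and the second-derivative test *)

Section RealDerivatives.
Context {R : realType}.
Implicit Types (f g phi psi : R -> R) (s t x : R).

Lemma rder_cst (c t : R) : is_derive t 1 (fun _ => c) 0.
Proof. exact: is_derive_cst. Qed.
Lemma rder_id t : is_derive t 1 (fun s => s) 1.
Proof. exact: is_derive_id. Qed.
Lemma rderD f g t (l m : R) : is_derive t 1 f l -> is_derive t 1 g m ->
  is_derive t 1 (fun s => f s + g s) (l + m).
Proof. exact: is_deriveD. Qed.
Lemma rderN f t (l : R) : is_derive t 1 f l -> is_derive t 1 (fun s => - f s) (- l).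
Proof. exact: is_deriveN. Qed.
Lemma rderM f g t (l m : R) : is_derive t 1 f l -> is_derive t 1 g m ->
  is_derive t 1 (fun s => f s * g s) (l * g t + f t * m).
Proof.
move=> hf hg.
have h : is_derive t 1 (fun s => f s * g s) (f t *: m + g t *: l) := is_deriveM hf hg.
by apply: is_derive_eq h _; rewrite /GRing.scale /=; ring.
Qed.
Lemma rderV f t (l : R) : f t != 0 -> is_derive t 1 f l ->
  is_derive t 1 (fun s => (f s)^-1) (- l / f t ^+ 2).
Proof.
move=> f0 hf; have h := is_deriveV f0 hf; apply: is_derive_eq h _.
by rewrite /GRing.scale /=; ring.
Qed.
Lemma rder_comp f g t (l m : R) : is_derive t 1 g m -> is_derive (g t) 1 f l ->
  is_derive t 1 (fun s => f (g s)) (l * m).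
Proof. by move=> hg hf; exact: is_derive1_comp. Qed.
Lemma rderZ f t (c l : R) : is_derive t 1 f l -> is_derive t 1 (fun s => c * f s) (c * l).
Proof. by move=> /(rderM (rder_cst c t)); rewrite mul0r add0r. Qed.
Definition D2 f (l : R) := exists f1 : R -> R,
  (exists2 d : R, 0 < d & forall t, `|t| < d -> is_derive t 1 f (f1 t)) /\ is_derive (0 : R) 1
    f1 l.

Lemma D2_cst (c : R) : D2 (fun _ => c) 0.
Proof.
by exists (fun _ => 0); split; [exists 1 => // t _; exact: rder_cst|exact: rder_cst].
Qed.

Lemma D2D f g l m : D2 f l -> D2 g m -> D2 (fun t => f t + g t) (l + m).
Proof.
move=> [f1 [[d d0 hf] hf1]] [g1 [[d' d'0 hg] hg1]].
exists (fun t => f1 t + g1 t); split; last exact: rderD.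
exists (Order.min d d') => [|t]; first by rewrite lt_min d0.
by rewrite lt_min => /andP[td td']; apply: rderD; [exact: hf|exact: hg].
Qed.

Lemma D2_sum (I : Type) (s : seq I) (f : I -> R -> R) (l : I -> R) :
  (forall i, D2 (f i) (l i)) ->
  D2 (fun t => \sum_(i <- s) f i t) (\sum_(i <- s) l i).
Proof.
move=> h; elim: s => [|i s IH].
  rewrite big_nil; have := D2_cst 0; congr D2; apply: funext => t; by rewrite big_nil.
rewrite big_cons; have := D2D (h i) IH; congr D2; apply: funext => t; by rewrite big_cons.
Qed.

(** If [l > 0], then [f' 0 = 0] makes [f'] positive just to the right of [0], and the mean value
    theorem produces a larger value of [f]. *)
Lemma D2_max f (l d : R) : 0 < d -> (forall t, `|t| < d -> f t <= f 0) -> D2 f l -> l <= 0.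
Proof.
move=> d0 hmax [f1 [[d' d'0 hf] hf1]]; rewrite leNgt; apply/negP => l0.
pose r := Order.min d d'; have r0 : 0 < r by rewrite lt_min d0.
have inr t : t \in `](- r), r[%R -> `|t| < d /\ `|t| < d'.
  rewrite in_itv /= => /andP[t1 t2].
  have : `|t| < r by rewrite ltr_norml t1.
  by rewrite lt_min => /andP[].
have f10 : f1 0 = 0.
  have h : is_derive (0 : R) 1 f 0.
    apply: (@derive1_at_max R f (- r) r 0); first by lra.
    - by move=> t /inr[_ /hf[]].
    - by rewrite in_itv /=; apply/andP; split; lra.
    - by move=> t /inr[/hmax].
  have [_ <-] := hf 0 ltac:(by rewrite normr0).
  by case: h.
have l2 : 0 < l / 2 by lra.
have [d2 d20 hd2] := is_derive_epsE hf1 l2.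
pose b := Order.min r d2 / 2.
have m0 : 0 < Order.min r d2 by rewrite lt_min r0.
have br : b < r /\ b < d2.
  by split; (apply: lt_le_trans (_ : Order.min r d2 <= _); [rewrite /b;
    lra|rewrite ge_min lexx ?orbT//]).
have b0 : 0 < b by rewrite /b; lra.
have dv t : 0 <= t <= b -> is_derive t 1 f (f1 t).
  move=> /andP[t0 tb]; apply: hf; have : t \in `](- r), r[%R by rewrite in_itv /=; apply/andP;
    split; lra.
  by move=> /inr[].
have cf : {within `[0, b], continuous f}.
  by apply: derivable_within_continuous => t; rewrite in_itv /= => /dv[].
have [t|t] := @MVT R f f1 0 b b0 _ cf.
  by rewrite in_itv /= => /andP[t0 tb]; apply: dv; rewrite !ltW.
rewrite in_itv /= => /andP[t0 tb]; rewrite subr0 => E.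
have ft : 0 < f1 t.
  have := hd2 t; rewrite subr0 f10 subr0 (gtr0_norm t0) => /(_ ltac:(lra)).
  rewrite ler_norml => /andP[h _]; nra.
have := hmax b; rewrite (gtr0_norm b0) => h.
have : f b <= f 0 by apply: h; apply: lt_le_trans br.1 _; rewrite ge_min lexx.
have : 0 < f1 t * b by exact: mulr_gt0.
lra.
Qed.
End RealDerivatives.

(** * Laplacians at a maximum point *)

Section Laplacian.
Context {R : realType}.
Local Notation C := (Cplx R).
Implicit Types (z w v : C) (k : C -> C) (phi psi : R -> R) (s t : R).

Definition sqm z : R := complex.Re z ^+ 2 + complex.Im z ^+ 2.
Definition rdot z w : R := complex.Re z * complex.Re w + complex.Im z * complex.Im w.

Definition C2at phi s (d1 d2 : R) := exists psi : R -> R,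
  [/\ psi s = d1, exists2 d : R, 0 < d & forall t, `|t - s| < d -> is_derive t 1 phi (psi t)
    & is_derive s 1 psi d2].

Lemma line_der k z v t : cdiff k (z + rc t * v) ->
  is_derive t 1 (fun s => complex.Re (k (z + rc s * v))) (complex.Re (cD k (z + rc t * v) * v))
    /\
  is_derive t 1 (fun s => complex.Im (k (z + rc s * v))) (complex.Im (cD k (z + rc t * v) * v)).
Proof.
move=> /cDP /curve_der_comp h.
by split; [have := curve_der_Re h|have := curve_der_Im h].
Qed.

(** The chain rule to second order, along the line through [z] with direction [v]. *)
Lemma D2_line k z v phi (d1 d2 : R) : holo k z -> C2at phi (sqm (k z)) d1 d2 ->
  D2 (fun t => phi (sqm (k (z + rc t * v))))
    (d2 * (2 * rdot (k z) (cD k z * v)) ^+ 2 +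
     d1 * (2 * (sqm (cD k z * v) + rdot (k z) (cD (cD k) z * v * v)))).
Proof.
move=> hk [psi [pd1 [e e0 hphi] hpsi]].
have h2 := holo_cdiff_cD hk.
have /near_cabs[r r0 dk] := hk.
pose K t := k (z + rc t * v).
pose K1 t := cD k (z + rc t * v) * v.
have K0 : K 0 = k z by rewrite /K rc0 mul0r addr0.
have K10 : K1 0 = cD k z * v by rewrite /K1 rc0 mul0r addr0.
have v1 : 0 < cabs v + 1 by have := cabs_ge0 v; lra.
have inr t : `|t| < r / (cabs v + 1) -> cdiff k (z + rc t * v).
  rewrite ltr_pdivlMr// => tr; apply: dk; rewrite addrC addKr cabsM cabs_rc.
  by have := normr_ge0 t; nra.
have dH t : `|t| < r / (cabs v + 1) ->
    is_derive t 1 (fun s => sqm (K s)) (2 * rdot (K t) (K1 t)).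
  move=> /inr /line_der[dR dI]; have h := rderD (rderM dR dR) (rderM dI dI).
  by apply: is_derive_eq h _; rewrite /rdot /K /K1; ring.
have rv : 0 < r / (cabs v + 1) by rewrite divr_gt0.
have H0 : sqm (K 0) = sqm (k z) by rewrite K0.
exists (fun t => psi (sqm (K t)) * (2 * rdot (K t) (K1 t))); split.
  have cH : is_derive (0 : R) 1 (fun s => sqm (K s)) (2 * rdot (K 0) (K1 0)) by apply: dH;
    rewrite normr0.
  have [d' d'0 hd'] : exists2 d', 0 < d' & forall t, `|t| < d' -> `|sqm (K t) - sqm (k z)| < e.
    have := is_derive_epsE cH ltr01; move=> [d d0 hd]; set L := 2 * rdot _ _ in hd.
    have L1 : 0 < `|L| + 1 by have := normr_ge0 L; lra.
    exists (Order.min d (e / (`|L| + 1))) => [|t]; first by rewrite lt_min d0 divr_gt0.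
    rewrite lt_min => /andP[td te]; have := hd t; rewrite subr0 mul1r => /(_ td).
    rewrite H0 => h; apply: le_lt_trans (_ : `|t| * (`|L| + 1) < e);
      last by rewrite -ltr_pdivlMr.
    have := ler_normD (sqm (K t) - sqm (k z) - L * t) (L * t); rewrite subrK normrM => h'.
    apply: le_trans h' _; lra.
  exists (Order.min d' (r / (cabs v + 1))) => [|t]; first by rewrite lt_min d'0.
  rewrite lt_min => /andP[td' tr].
  exact: (rder_comp (dH t tr) (hphi _ (hd' t td'))).
have r00 : `|0 : R| < r / (cabs v + 1) by rewrite normr0.
have dK1 : is_derive (0 : R) 1 (fun s => complex.Re (K1 s)) (complex.Re (cD (cD k) z * v * v))
  /\
    is_derive (0 : R) 1 (fun s => complex.Im (K1 s)) (complex.Im (cD (cD k) z * v * v)).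
  have dk1 : cdiff (cD k) (z + rc 0 * v) by rewrite rc0 mul0r addr0.
  have /curve_der_comp h : cder (fun y => cD k y * v) (z + rc 0 * v) (cD (cD k) z * v).
    have := cderM (cDP dk1) (cder_cst v _); rewrite mulr0 addr0 rc0 mul0r addr0; exact.
  by split; [have := curve_der_Re h|have := curve_der_Im h].
have [dR dI] := line_der (inr 0 r00); move: dK1 => [dR1 dI1].
rewrite -H0 in hpsi.
have hp := rder_comp (dH 0 r00) hpsi.
have hq := rderZ 2 (rderD (rderM dR dR1) (rderM dI dI1)).
have h := rderM hp hq; apply: is_derive_eq h _.
rewrite -/(K 0) -/(K1 0) H0 pd1 K0 K10 /rdot /sqm; ring.
Qed.

(* The Laplacian of [phi (|k|^2)] is [4 |k'|^2 (phi' + |k|^2 phi'')]. *)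
Lemma max_laplacian (I : Type) (s : seq I) (k : I -> C -> C) (phi : I -> R -> R)
    (d1 d2 : I -> R) z : (forall i, holo (k i) z) ->
  (forall i, C2at (phi i) (sqm (k i z)) (d1 i) (d2 i)) ->
  (\forall w \near z, \sum_(i <- s) phi i (sqm (k i w)) <= \sum_(i <- s) phi i (sqm (k i z))) ->
  \sum_(i <- s) sqm (cD (k i) z) * (d1 i + sqm (k i z) * d2 i) <= 0.
Proof.
move=> hk hphi /near_cabs[e e0 hmax].
have dir v : cabs v = 1 -> \sum_(i <- s) (d2 i * (2 * rdot (k i z) (cD (k i) z * v)) ^+ 2 +
     d1 i * (2 * (sqm (cD (k i) z * v) + rdot (k i z) (cD (cD (k i)) z * v * v)))) <= 0.
  move=> v1; apply: (@D2_max R (fun t => \sum_(i <- s) phi i (sqm (k i (z + rc t * v)))) _ e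
    e0).
    move=> t te; rewrite rc0 mul0r addr0; apply: hmax.
    by rewrite addrC addKr cabsM v1 mulr1 cabs_rc.
  by apply: D2_sum => i; exact: D2_line.
have ci : cabs (ii : C) = 1 by rewrite /cabs /= expr0n expr1n add0r sqrtr1.
(* The second derivatives along [1] and [i] add up to the Laplacian; the terms in [k''] cancel
   because [v^2] is [1] and then [-1]. *)
have := dir 1 (@cabs1 R); have := dir ii ci.
set S1 := \sum_(i <- s) _; set S2 := \sum_(i <- s) _; set S := \sum_(i <- s) _.
have -> : S = (S1 + S2) / 4.
  rewrite /S /S1 /S2 -big_split /= mulr_suml; apply: eq_bigr => i _.
  by rewrite /sqm /rdot !(cReM, cImM) /=; field.
lra.
Qed.
End Laplacian.

(** * The maximum principle and orders of zeros *)

Section ZerosOfHolomorphicFunctions.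
Context {R : realType}.
Local Notation C := (Cplx R).
Implicit Types (z w x : C) (f g : C -> C) (r s : R).

Lemma sqmE z : sqm z = cabs z ^+ 2. Proof. by rewrite cabs_sqr. Qed.

Lemma disc_EVT_at (V : C -> R) x r : 0 <= r ->
  (forall z, cabs (z - x) <= r -> {for z, continuous V}) ->
  exists2 z0, cabs (z0 - x) <= r & forall z, cabs (z - x) <= r -> V z <= V z0.
Proof.
move=> r0 cV; have [w wr|w wr hw] := @disc_EVT R (fun w => V (x + w)) r r0.
  have c1 : {for w, continuous (fun w => x + w)} by exact (contD (cont_cst x w) (cont_id w)).
  have c2 : {for x + w, continuous V} by apply: cV; rewrite addrC addKr.
  exact (@continuous_comp _ _ _ (fun w => x + w) V w c1 c2).
exists (x + w) => [|z zr]; first by rewrite addrC addKr.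
by have := hw (z - x) zr; rewrite [x + (z - x)]addrC subrK.
Qed.

Lemma rcontM (f g : C -> R) z : {for z, continuous f} -> {for z, continuous g} ->
  {for z, continuous (fun w => f w * g w)}.
Proof. by move=> cf cg; exact: (@cvgM R C (nbhs z) _ f g _ _ cf cg). Qed.
Lemma rcontD (f g : C -> R) z : {for z, continuous f} -> {for z, continuous g} ->
  {for z, continuous (fun w => f w + g w)}.
Proof. by move=> cf cg; exact: (@cvgD R R C (nbhs z) _ f g _ _ cf cg). Qed.
Lemma rcont_cst (c : R) z : {for z, continuous (fun _ : C => c)}.
Proof. exact: (@cst_continuous C R c z). Qed.
Arguments rcont_cst c z : clear implicits.
Lemma rcont_eq (f g : C -> R) z : f =1 g -> {for z, continuous f} -> {for z, continuous g}.
Proof. by move=> /funext ->. Qed.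
Lemma rcontV (f : C -> R) z : f z != 0 -> {for z, continuous f} ->
  {for z, continuous (fun w => (f w)^-1)}.
Proof. by move=> fz cf; exact: (@cvgV R C (nbhs z) _ f _ fz cf). Qed.
Lemma rcontX (f : C -> R) z n : {for z, continuous f} ->
  {for z, continuous (fun w => f w ^+ n)}.
Proof.
move=> cf; elim: n => [|n IH]; first exact (rcont_cst 1 z).
by apply: rcont_eq (rcontM cf IH) => w; rewrite exprS.
Qed.
Lemma cont_cabs_comp f z : {for z, continuous f} -> {for z, continuous (fun w => cabs (f w))}.
Proof. by move=> cf; exact (@continuous_comp _ _ _ f (@cabs R) z cf (@cont_cabs R _)). Qed.
Lemma cont_sqm f z : {for z, continuous f} -> {for z, continuous (fun w => sqm (f w))}.
Proof.
move=> /cont_cabs_comp h; apply: rcont_eq (@rcontX (fun w => cabs (f w)) z 2 h) => w.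
by rewrite sqmE.
Qed.

Lemma C2at_lin (c s : R) : C2at (fun t => c * t) s c 0.
Proof.
exists (fun _ => c); split; [by []| |exact: rder_cst].
by exists 1 => // t _; have := rderZ c (rder_id t); rewrite mulr1.
Qed.

(** Adding [e |z - x|^2] to [|f|^2] makes the Laplacian at least [4 e > 0], which excludes an
    interior maximum. *)
Lemma max_modulus f x s (M : R) : 0 < s -> (forall z, cabs (z - x) <= s -> holo f z) ->
  (forall z, cabs (z - x) = s -> cabs (f z) <= M) ->
  forall z, cabs (z - x) <= s -> cabs (f z) <= M.
Proof.
move=> s0 hf hM z1 z1s; rewrite leNgt; apply/negP => h.
have M0 : 0 <= M.
  apply: le_trans (hM (x + rc s) _); first exact: cabs_ge0.
  by rewrite addrC addKr cabs_rc gtr0_norm.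
have s2 : 0 < s ^+ 2 by rewrite exprn_gt0.
(* On the circle the perturbation equals half the gap [|f z1|^2 - M^2], so boundary values stay
   below the value at [z1]. *)
pose e := (cabs (f z1) ^+ 2 - M ^+ 2) / (2 * s ^+ 2).
have e0 : 0 < e by rewrite divr_gt0 ?mulr_gt0// subr_gt0 ltrXn2r// nnegrE// cabs_ge0.
have eE : e * s ^+ 2 = (cabs (f z1) ^+ 2 - M ^+ 2) / 2 by rewrite /e; field; rewrite gt_eqF.
have hfz z : cabs (z - x) <= s -> cdiff f z by move=> /hf /nbhs_singleton.
pose V z := 1 * sqm (f z) + e * sqm (z - x).
have [z zs|z0 z0s hz0] := @disc_EVT_at V x s (ltW s0).
  have c1 := cont_sqm (cdiff_cont (hfz z zs)).
  have c2 : {for z, continuous (fun w => sqm (w - x))} by exact (@cont_sqm (fun w =>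
    w - x) z (cont_subr x z)).
  exact (rcontD (rcontM (rcont_cst 1 z) c1) (rcontM (rcont_cst e z) c2)).
have V1 := hz0 z1 z1s; rewrite /V !sqmE in V1.
have z0lt : cabs (z0 - x) < s.
  rewrite lt_neqAle z0s andbT; apply/eqP => z0E.
  have := hM z0 z0E => /(fun h => lerXn2r 2 (cabs_ge0 _) M0 h) h2.
  rewrite z0E in V1; have := sqr_ge0 (cabs (z1 - x)).
  have : 0 <= e * cabs (z1 - x) ^+ 2 by rewrite mulr_ge0 ?sqr_ge0// ltW.
  have : M ^+ 2 < cabs (f z1) ^+ 2 by rewrite ltrXn2r// nnegrE// cabs_ge0.
  by move: V1; rewrite eE !mul1r; lra.
pose K (b : bool) := if b then f else fun w => w - x.
pose Phi (b : bool) := if b then (fun t : R => 1 * t) else (fun t => e * t).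
pose D1 (b : bool) := if b then 1 else e.
have hK b : holo (K b) z0.
  by case: b; [exact: hf|apply: near_all => w; exact: cdiff_subr].
have hPhi b : C2at (Phi b) (sqm (K b z0)) (D1 b) 0 by case: b; exact: C2at_lin.
have := @max_laplacian R bool [:: true; false] K Phi D1 (fun _ => 0) z0 hK hPhi.
have hmax : \forall w \near z0, \sum_(i <- [:: true; false]) Phi i (sqm (K i w)) <=
    \sum_(i <- [:: true; false]) Phi i (sqm (K i z0)).
  apply/near_cabs; exists (s - cabs (z0 - x)); first by rewrite subr_gt0.
  move=> w wz; rewrite !big_cons !big_nil !addr0; apply: hz0.
  by have := cabs_dist w z0 x; lra.
move=> /(_ hmax).
rewrite !big_cons big_nil /K /D1.
have -> : cD (fun w => w - x) z0 = 1 by apply: cDE; have := cderB (cder_id z0) (cder_cst x z0);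
  rewrite subr0.
rewrite !sqmE cabs1 !mulr0 !addr0 expr1n mulr1 mul1r => hle.
have := sqr_ge0 (cabs (cD f z0)); lra.
Qed.

Lemma bernoulli (d : R) k : 0 <= d -> 1 + k%:R * d <= (1 + d) ^+ k.
Proof.
move=> d0; elim: k => [|k IH]; first by rewrite mul0r addr0 expr0.
rewrite exprS -[k.+1]addn1 natrD; have : 0 <= (k%:R : R) by []; nra.
Qed.

Lemma pow_unbounded (c q M : R) : 0 < c -> 1 < q -> (forall k : nat, c * q ^+ k <= M) -> False.
Proof.
move=> c0 q1 h; pose k := (Num.truncn (M / c / (q - 1))).+1.
have q0 : 0 < q - 1 by lra.
have : M / c / (q - 1) < k%:R by rewrite truncnS_gt.
rewrite ltr_pdivrMr// ltr_pdivrMr// => h1.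
have := h k; have := @bernoulli (q - 1) k (ltW q0); rewrite [1 + (q - 1)]addrC subrK; nra.
Qed.

Lemma holo_on_ball f x r z : (forall z, cabs (z - x) < r -> cdiff f z) ->
  cabs (z - x) < r -> holo f z.
Proof.
move=> df zr; apply/near_cabs; exists (r - cabs (z - x)); first by rewrite subr_gt0.
by move=> w wz; apply: df; have := cabs_dist w z x; lra.
Qed.

Lemma divide_zero f x r : 0 < r -> (forall z, cabs (z - x) < r -> cdiff f z) -> f x = 0 ->
  exists2 g, (forall z, cabs (z - x) < r -> cdiff g z) & forall z, f z = (z - x) * g z.
Proof.
move=> r0 df fx; have xr : cabs (x - x) < r by rewrite subrr cabs0.
pose g z := if z == x then cD f x else f z / (z - x).
have dg z : z != x -> cabs (z - x) < r -> cdiff g z.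
  move=> zx zr; have zx0 : z - x != 0 by rewrite subr_eq0.
  have h : cdiff (fun w => f w / (w - x)) z.
    exact: cdiffM (df z zr) (@cdiffV _ (fun w => w - x) z zx0 (cdiff_subr x z)).
  apply: cdiff_ext h; have /near_cabs[d d0 hd] := near_neq zx.
  by apply/near_cabs; exists d => // w /hd; rewrite /g => /negbTE ->.
exists g; last first.
  move=> z; rewrite /g; case: eqP => [->|/eqP zx]; first by rewrite fx subrr mul0r.
  by rewrite mulrC divfK// subr_eq0.
have hg : holo g x.
  apply: removable_continuous; last by apply/dnear_cabs; exists r.
  have [phi [cphi pz /near_cabs[d d0 hd]]] := cDP (df x xr).
  apply: cont_ext cphi; apply/near_cabs; exists d => // w wd; rewrite /g.
  case: eqP => [->//|/eqP wx]; have := hd w wd; rewrite fx subr0 => ->.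
  by rewrite mulfK// subr_eq0.
by move=> z zr; have [->|zx] := eqVneq z x; [exact: nbhs_singleton hg|exact: dg].
Qed.

(** No power series is involved: if [f = (z - x)^k g] for every [k], the maximum principle on a
    circle of radius [s > |z - x|] gives [|f z| <= C (|z - x| / s)^k], hence [f z = 0]. *)
Lemma zero_order_ball f x r : 0 < r -> (forall z, cabs (z - x) < r -> cdiff f z) ->
  (forall z, cabs (z - x) < r -> f z = 0) \/
  exists k g, [/\ forall z, cabs (z - x) < r -> cdiff g z, g x != 0 &
                  forall z, f z = (z - x) ^+ k * g z].
Proof.
move=> r0 df; have [|no] := pselect (exists k g, [/\ forall z, cabs (z - x) < r ->
  cdiff g z, g x != 0 &
                  forall z, f z = (z - x) ^+ k * g z]); [by right|left].
have all k : exists2 g, (forall z, cabs (z - x) < r -> cdiff g z) & forall z, f z =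
  (z - x) ^+ k * g z.
  elim: k => [|k [g dg fE]]; first by exists f => // z; rewrite expr0 mul1r.
  have gx : g x = 0 by apply/eqP; apply: contrapT => /negP gx; apply: no; exists k, g.
  have [g' dg' gE] := divide_zero r0 dg gx; exists g' => // z.
  by rewrite fE gE exprSr mulrA.
move=> z zr; have [->|zx] := eqVneq z x.
  by have [g _ ->] := all 1%N; rewrite subrr mul0r.
have zx0 : 0 < cabs (z - x) by rewrite cabs_gt0 subr_eq0.
pose s := (cabs (z - x) + r) / 2.
have [zs sr] : cabs (z - x) < s /\ s < r by rewrite /s; split; lra.
have s0 : 0 < s by lra.
have [w ws|z1 z1s hz1] := @disc_EVT_at (fun w => cabs (f w)) x s (ltW s0).
  by apply: cont_cabs_comp; apply: cdiff_cont; apply: df; lra.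
apply/eqP; rewrite -cabs_eq0; apply: contrapT => /negP fz.
have fz0 : 0 < cabs (f z) by rewrite lt_def fz cabs_ge0.
apply: (@pow_unbounded (cabs (f z)) (s / cabs (z - x)) (cabs (f z1))) => //.
  by rewrite ltr_pdivlMr// mul1r.
move=> k; have [g dg fE] := all k.
have hg : cabs (g z) <= cabs (f z1) / s ^+ k.
  apply: (@max_modulus g x s) => //; last by lra.
  - by move=> w ws; apply: (holo_on_ball dg); lra.
  - move=> w ws; rewrite ler_pdivlMr ?exprn_gt0//.
    by have := hz1 w; rewrite ws => /(_ (lexx _)); rewrite fE cabsM cabsX ws mulrC.
rewrite fE cabsM cabsX expr_div_n.
have zk : 0 < cabs (z - x) ^+ k by rewrite exprn_gt0.
have -> : cabs (z - x) ^+ k * cabs (g z) * (s ^+ k / cabs (z - x) ^+ k) = cabs (g z) * s ^+ k.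
  by field; rewrite gt_eqF.
by rewrite -ler_pdivlMr ?exprn_gt0.
Qed.

Lemma zero_order f x : holo f x -> (\forall z \near x, f z = 0) \/
  exists k g, [/\ holo g x, g x != 0 & forall z, f z = (z - x) ^+ k * g z].
Proof.
move=> /near_cabs[r r0 df]; have [h|[k [g [dg gx fE]]]] := zero_order_ball r0 df.
  by left; apply/near_cabs; exists r.
by right; exists k, g; split => //; apply/near_cabs; exists r.
Qed.

Lemma isolated_zeros f x : holo f x ->
  (\forall z \near x, f z = 0) \/ (\forall z \near x^', f z != 0).
Proof.
move=> /zero_order[|[k [g [hg gx fE]]]]; [by left|right].
have cg : {for x, continuous g} by apply: cdiff_cont; exact: nbhs_singleton hg.
have /near_cabs[r r0 hr] := cont_neq0 gx cg.
apply/dnear_cabs; exists r => // z zx zr; rewrite fE mulf_neq0 ?hr//.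
by rewrite expf_neq0// subr_eq0.
Qed.

End ZerosOfHolomorphicFunctions.
Arguments rcont_cst {R} c z.

(** * The curvature inequality *)

Section CurvatureInequality.
Context {R : realType}.
Local Notation C := (Cplx R).
Implicit Types (z w x : C) (a : 'I_6 -> C).

Lemma separation a : injective a ->
  exists2 d : R, 0 < d <= 1 & forall i j, i != j -> 2 * d <= cabs (a i - a j).
Proof.
move=> ainj.
(* The diagonal counts as distance 2, which is harmless since [d] is capped at 1. *)
pose F (p : 'I_6 * 'I_6) := if p.1 == p.2 then -2 else - cabs (a p.1 - a p.2).
have [p _ hp] := @seq_argmax R _ F (enum [set: 'I_6 * 'I_6]) (ord0, ord0) ltac:(by rewrite
  mem_enum inE).
exists (Order.min 1 (- F p / 2)).
  rewrite lt_min ltr01 ge_min lexx andbT /=.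
  have : 0 < - F p; last by lra.
  rewrite /F; case: eqP => [_|/eqP ij]; first by lra.
  by rewrite opprK cabs_gt0 subr_eq0 (inj_eq ainj).
move=> i j ij; have := hp (i, j) ltac:(by rewrite mem_enum inE).
rewrite {1}/F /= (negbTE ij) => h.
have : Order.min 1 (- F p / 2) <= - F p / 2 by rewrite ge_min lexx orbT.
lra.
Qed.

(** Up to constants, the cubed density is compared with the cube of the Laplacian of its logarithm.
    Only the nearest point [a j0] matters: with [p = r j0] and [q = 1 + p], the other five factors
    are at most [1 / (k^3 q^2)] each, so the product is at most [k^(-15) p^(-3) q^(-9)], while one
    term of the sum already has cube [p^(-3) q^(-6)], and [q >= 1]. *)
Lemma curvature_bound a : injective a -> exists2 c : R, 0 < c &
  forall w, (forall j, w != a j) ->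
  c * \prod_j ((1 + cabs (w - a j)) / cabs (w - a j) ^+ 3) <=
  (\sum_j (cabs (w - a j) * (1 + cabs (w - a j)) ^+ 2)^-1) ^+ 3.
Proof.
move=> ainj; have [d /andP[d0 d1] sep] := separation ainj.
pose k := d / 2; have k0 : 0 < k by rewrite /k; lra.
exists (k ^+ 15) => [|w wa]; first by rewrite exprn_gt0.
pose r j := cabs (w - a j).
have r0 j : 0 < r j by rewrite cabs_gt0 subr_eq0.
have [j0 _ hj0] := @seq_argmax R _ (fun j => - r j) (enum 'I_6) ord0 ltac:(by rewrite mem_enum).
have {}hj0 j : r j0 <= r j by have := hj0 j; rewrite mem_enum lerN2 => /(_ isT).
(* The nearest point being [a j0], [2 d <= |a j - a j0| <= 2 r j]; then [d <= r j] and [d <= 1] give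
   the claim. *)
have rk j : j != j0 -> k * (1 + r j) <= r j.
  move=> jj; have := sep j j0 jj.
  have := cabs_dist (a j) w (a j0); rewrite [cabs (a j - w)]cabsB -/(r j) -/(r j0).
  have := hj0 j; rewrite /k => h1 h2 h3.
  have : d <= r j by lra.
  nra.
have i0 : 0 < (1 + r j0) by have := r0 j0; lra.
have t1 j : j != j0 -> (1 + r j) / r j ^+ 3 <= (k ^+ 3 * (1 + r j0) ^+ 2)^-1.
  move=> jj; have rj := r0 j; have h := rk j jj; have hm := hj0 j.
  rewrite ler_pdivrMr ?exprn_gt0// [X in _ <= X]mulrC ler_pdivlMr ?mulr_gt0 ?exprn_gt0//.
  have h3 : (k * (1 + r j)) ^+ 3 <= r j ^+ 3.
    by apply: lerXn2r => //; rewrite nnegrE; nra.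
  apply: le_trans h3; rewrite [X in _ <= X]exprMn.
  have -> : (1 + r j) * (k ^+ 3 * (1 + r j0) ^+ 2) =
    k ^+ 3 * ((1 + r j) * (1 + r j0) ^+ 2) by ring.
  rewrite ler_pM2l ?exprn_gt0// [X in _ <= X]exprS ler_pM2l//; last by lra.
  by apply: lerXn2r; rewrite ?nnegrE; lra.
have prodle : \prod_j ((1 + r j) / r j ^+ 3) <= (1 + r j0) / r j0 ^+ 3 * (k ^+ 3 * (1 + r j0)
  ^+ 2)^-1 ^+ 5.
  rewrite (bigD1 j0)//= ler_pM2l; last by rewrite divr_gt0 ?exprn_gt0.
  have -> : (k ^+ 3 * (1 + r j0) ^+ 2)^-1 ^+ 5 = \prod_(j | j != j0) (k ^+ 3 * (1 + r j0) ^+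
    2)^-1.
    by rewrite prodr_const; congr (_ ^+ _); rewrite cardC1 card_ord.
  apply: ler_prod => j jj; rewrite t1// andbT divr_ge0 ?exprn_ge0//; have := r0 j; lra.
have kE : k ^+ 15 = (k ^+ 3) ^+ 5 by rewrite -exprM.
apply: le_trans (ler_wpM2l (exprn_ge0 15 (ltW k0)) prodle) _.
apply: le_trans (_ : (r j0 * (1 + r j0) ^+ 2)^-1 ^+ 3 <= _); last first.
  apply: lerXn2r; rewrite ?nnegrE.
  - by rewrite invr_ge0 mulr_ge0 ?sqr_ge0// ltW.
  - by apply: sumr_ge0 => j _; rewrite invr_ge0 mulr_ge0 ?sqr_ge0// cabs_ge0.
  - rewrite (bigD1 j0)//= lerDl; apply: sumr_ge0 => j _.
    by rewrite invr_ge0 mulr_ge0 ?sqr_ge0// cabs_ge0.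
have rj := r0 j0; set q := 1 + r j0 in i0 *; set p := r j0 in rj *.
have q1 : 1 <= q by rewrite /q -/p; lra.
have -> : k ^+ 15 * (q / p ^+ 3 * (k ^+ 3 * q ^+ 2)^-1 ^+ 5) = (p ^+ 3)^-1 * (q ^+ 9)^-1.
  by rewrite kE; field; rewrite !gt_eqF.
have -> : (p * q ^+ 2)^-1 ^+ 3 = (p ^+ 3)^-1 * (q ^+ 6)^-1 by field; rewrite !gt_eqF.
rewrite ler_pM2l ?invr_gt0 ?exprn_gt0// lef_pV2 ?posrE ?exprn_gt0//.
by rewrite ler_weXn2l.
Qed.

(** For [s = |w|^2] the combination [d1 + s * d2] is [0]: [log |w|] is harmonic. *)
Lemma C2at_ln (m s : R) : 0 < s -> C2at (fun t => m * ln t) s (m / s) (- m / s ^+ 2).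
Proof.
move=> s0; exists (fun t => m * t^-1); split => //.
  exists s => // t ts; have t0 : 0 < t by move: ts; rewrite ltr_norml; lra.
  exact: rderZ (is_derive1_ln t0).
have h := rderZ m (rderV (lt0r_neq0 s0) (rder_id s)).
by apply: is_derive_eq h _; ring.
Qed.

(** Here [d1 + s * d2 = - m b / (b - s)^2], the contribution of the weight of the Poincare
    metric. *)
Lemma C2at_ln_sub (m b s : R) : s < b ->
  C2at (fun t => m * ln (b - t)) s (- m / (b - s)) (- m / (b - s) ^+ 2).
Proof.
move=> sb; have dsub (t : R) : is_derive t 1 (fun u => b - u) (-1 : R).
  by have h := rderD (rder_cst b t) (rderN (rder_id t)); apply: is_derive_eq h _; rewrite add0r.
have bs : b - s != 0 by rewrite subr_eq0 gt_eqF.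
exists (fun t => - m * (b - t)^-1); split => //.
  exists (b - s) => [|t ts]; first by rewrite subr_gt0.
  have t0 : 0 < b - t by move: ts; rewrite ltr_norml; lra.
  have h := rderZ m (rder_comp (dsub t) (is_derive1_ln t0)).
  by apply: is_derive_eq h _; ring.
have h := rderZ (- m) (@rderV R (fun t => b - t) s (-1) bs (dsub s)).
by apply: is_derive_eq h _; ring.
Qed.

(** With [q = sqrt s], [d1 + s * d2 = m / (4 q (1 + q)^2)], positive for [m > 0]: the source of the
    negative curvature. *)
Lemma C2at_ln_sqrt (m s : R) : 0 < s ->
  C2at (fun t => m * ln (1 + Num.sqrt t)) s (m / (2 * (Num.sqrt s * (1 + Num.sqrt s))))
    (- m * (1 + 2 * Num.sqrt s) / (4 * Num.sqrt s ^+ 3 * (1 + Num.sqrt s) ^+ 2)).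
Proof.
move=> s0.
have d1 (t : R) : 0 < t -> is_derive t 1 (fun u => 1 + Num.sqrt u) ((2 * Num.sqrt t)^-1 : R).
  by move=> t0; have h := rderD (rder_cst 1 t) (is_derive1_sqrt t0); apply: is_derive_eq h _;
    rewrite add0r.
have q0 (t : R) : 0 < t -> 0 < Num.sqrt t :> R by move=> t0; rewrite sqrtr_gt0.
exists (fun t => m * (2 * (Num.sqrt t * (1 + Num.sqrt t)))^-1); split => //.
  exists s => // t ts; have t0 : 0 < t by move: ts; rewrite ltr_norml; lra.
  have qt := q0 t t0; have q1 : 0 < 1 + Num.sqrt t by lra.
  have h := rderZ m (rder_comp (d1 t t0) (is_derive1_ln q1)).
  apply: is_derive_eq h _; set q := Num.sqrt t in qt q1 *.
  by field; rewrite !gt_eqF.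
have qs := q0 s s0; have q1 : 0 < 1 + Num.sqrt s by lra.
have n0 : 2 * (Num.sqrt s * (1 + Num.sqrt s)) != 0 by rewrite gt_eqF// !mulr_gt0.
have h := rderZ m (@rderV R (fun t => 2 * (Num.sqrt t * (1 + Num.sqrt t))) s _ n0
  (rderZ 2 (rderM (is_derive1_sqrt s0) (d1 s s0)))).
apply: is_derive_eq h _; set q := Num.sqrt s in qs q1 *.
by field; rewrite !gt_eqF.
Qed.
End CurvatureInequality.

(** * The pulled-back metric and the inequality at a maximum *)

Section Ahlfors.
Context {R : realType}.
Local Notation C := (Cplx R).
Implicit Types (z w x : C) (h : C -> C) (a : 'I_6 -> C) (B : C -> Prop).

(* The cube of the squared density of [prod_j (1 + |w - a_j|)^(1/3) / |w - a_j| |dw|^2],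
   a metric of negative curvature, pulled back by [h]. *)
Definition density a h z : R :=
  cabs (cD h z) ^+ 6 * \prod_j ((1 + cabs (h z - a j)) / cabs (h z - a j) ^+ 3).

Lemma density_ge0 a h z : 0 <= density a h z.
Proof.
rewrite mulr_ge0 ?exprn_ge0 ?cabs_ge0//; apply: prodr_ge0 => j _.
by rewrite divr_ge0 ?exprn_ge0 ?addr_ge0 ?cabs_ge0.
Qed.

Lemma density_gt0 a h z : (forall j, h z != a j) -> (0 < density a h z) = (cD h z != 0).
Proof.
move=> ha; have p : 0 < \prod_j ((1 + cabs (h z - a j)) / cabs (h z - a j) ^+ 3).
  apply: prodr_gt0 => j _; have r0 : 0 < cabs (h z - a j) by rewrite cabs_gt0 subr_eq0.
  by rewrite divr_gt0 ?exprn_gt0//; lra.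
by rewrite /density pmulr_lgt0// exprn_even_gt0//= cabs_eq0.
Qed.

Lemma rcont_prod (I : Type) (s : seq I) (F : I -> C -> R) z :
  (forall i, {for z, continuous (F i)}) -> {for z, continuous (fun w => \prod_(i <- s) F i w)}.
Proof.
move=> cF; elim: s => [|i s IH].
  by apply: rcont_eq (rcont_cst 1 z) => w; rewrite big_nil.
by apply: rcont_eq (rcontM (cF i) IH) => w; rewrite big_cons.
Qed.

Lemma density_cont a h z : holo h z -> (forall j, h z != a j) ->
  {for z, continuous (density a h)}.
Proof.
move=> hh ha; have ch := cdiff_cont (nbhs_singleton hh).
have c1 := cont_cabs_comp (cdiff_cont (holo_cdiff_cD hh)).
have cr j : {for z, continuous (fun w => cabs (h w - a j))}.
  exact (cont_cabs_comp (contD ch (cont_cst (- a j) z))).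
have cp j : {for z, continuous (fun w => (1 + cabs (h w - a j)) / cabs (h w - a j) ^+ 3)}.
  have n0 : cabs (h z - a j) ^+ 3 != 0 by rewrite expf_neq0// cabs_eq0 subr_eq0.
  have c3 := @rcontV R (fun w => cabs (h w - a j) ^+ 3) z n0 (rcontX (cr j)).
  exact (rcontM (rcontD (rcont_cst 1 z) (cr j)) c3).
exact (rcontM (rcontX c1) (@rcont_prod _ (index_enum 'I_6) _ z cp)).
Qed.

(** Each disc of a suitable cover meets [B] at most in its centre, so the centres that belong to [B]
    exhaust it. *)
Lemma finite_in_disc B (r : R) : (forall z, \forall w \near z^', ~ B w) ->
  exists2 s : seq C, (forall p, p \in s -> B p) & forall z, cabs z <= r -> B z -> z \in s.
Proof.
move=> hB.
have : forall z, exists d : R, 0 < d /\ forall w, w != z -> cabs (w - z) < d -> ~ B w.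
  by move=> z; have /dnear_cabs[d d0 hd] := hB z; exists d.
move=> /choice[d hd]; have [s hs] := disc_cover r (fun z => (hd z).1).
exists [seq x <- s | `[< B x >]].
  by move=> p; rewrite mem_filter => /andP[/asboolP].
move=> z zr Bz; have [x xs zx] := hs z zr.
have [e|nzx] := eqVneq z x; first by rewrite mem_filter asboolT// e.
by have := (hd x).2 z nzx zx.
Qed.

Lemma ln_prod (I : Type) (s : seq I) (F : I -> R) : (forall i, 0 < F i) ->
  ln (\prod_(i <- s) F i) = \sum_(i <- s) ln (F i).
Proof.
move=> F0; elim: s => [|i s IH]; first by rewrite !big_nil ln1.
by rewrite !big_cons lnM ?posrE ?IH//; apply: prodr_gt0 => j _.
Qed.

(** The logarithm of the maximised quantity has Laplacian at most zero. Its part [log |G|] is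
    harmonic, and everything else carries the factor [k]; so neither [P] nor [k] survives in the
    bound. What remains is [|h'|^2 Sg <= 24 r^2 / X^2], which the curvature inequality turns into a
    bound on the density. *)
Lemma ahlfors_max_point a h z (c r : R) (k : nat) (P : {poly C}) : (0 < k)%N ->
  (forall w, (forall j, w != a j) ->
    c * \prod_j ((1 + cabs (w - a j)) / cabs (w - a j) ^+ 3) <=
    (\sum_j (cabs (w - a j) * (1 + cabs (w - a j)) ^+ 2)^-1) ^+ 3) ->
  0 < r -> cabs z < r -> (\forall w \near z, cdiff h w) -> (forall j, h z != a j) ->
  cD h z != 0 -> P.[z] != 0 ->
  (\forall w \near z, (density a h w * (r ^+ 2 - cabs w ^+ 2) ^+ 6) ^+ k * cabs P.[w] ^+ 2 <=
    (density a h z * (r ^+ 2 - cabs z ^+ 2) ^+ 6) ^+ k * cabs P.[z] ^+ 2) ->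
  c * (density a h z * (r ^+ 2 - cabs z ^+ 2) ^+ 6) <= 24 ^+ 3 * r ^+ 6.
Proof.
move=> k0 curv r0 zr hh ha h'0 P0 hmax.
pose Q := \prod_j ('X - (a j)%:P).
have QE w : Q.[w] = \prod_j (w - a j).
  by rewrite horner_prod; apply: eq_bigr => j _; rewrite !hornerE.
(* The holomorphic part of the quantity; only the factors [1 + |h - a j|] and the weight in [r] are
   left out. *)
pose G w := ((cD h w) ^+ 6 / Q.[h w] ^+ 3) ^+ k * P.[w] ^+ 2.
have hD := holo_cD hh.
have ch := cdiff_cont (nbhs_singleton hh).
have near_a : \forall w \near z, forall j, h w != a j.
  have h1 j : \forall w \near z, h w != a j by exact: (ch _ (near_neq (ha j))).
  have /choice[d hd] : forall j, exists d : R, 0 < d /\ forall w, cabs (w - z) < d ->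
    h w != a j.
    by move=> j; have /near_cabs[d d0 hd] := h1 j; exists d.
  have [j0 _ hj0] := @seq_argmax R _ (fun j => - d j) (enum 'I_6) ord0 ltac:(by rewrite
    mem_enum).
  apply/near_cabs; exists (d j0); first by have [] := hd j0.
  move=> w wz j; apply: (hd j).2; apply: lt_le_trans wz _.
  by have := hj0 j; rewrite mem_enum lerN2; apply.
have Q0 w : (forall j, h w != a j) -> Q.[h w] != 0.
  by move=> hw; rewrite QE; apply/prodf_neq0 => j _; rewrite subr_eq0.
have hG : holo G z.
  suff : \forall w \near z, cdiff G w by [].
  near=> w; have dh : cdiff h w by near: w.
  have dD : cdiff (cD h) w by near: w.
  have hw : forall j, h w != a j by near: w.
  have dQ : cdiff (fun w => Q.[h w]) w.
    by have [l hl] := dh; eexists; exact: cder_comp hl (cder_horner Q _).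
  have dP : cdiff (horner P) w by eexists; exact: cder_horner.
  have n3 : Q.[h w] ^+ 3 != 0 by rewrite expf_neq0// Q0.
  have dV := @cdiffV R (fun w => Q.[h w] ^+ 3) w n3 (cdiffX 3 dQ).
  exact (cdiffM (cdiffX k (cdiffM (cdiffX 6 dD) dV)) (cdiffX 2 dP)).
have Vfac w : (forall j, h w != a j) -> (density a h w * (r ^+ 2 - cabs w ^+ 2) ^+ 6) ^+ k *
  cabs P.[w] ^+ 2 =
    cabs (G w) * ((r ^+ 2 - cabs w ^+ 2) ^+ 6) ^+ k * \prod_j (1 + cabs (h w - a j)) ^+ k.
  move=> hw; set U := cabs (cD h w) ^+ 6 / cabs Q.[h w] ^+ 3.
  have GE : cabs (G w) = U ^+ k * cabs P.[w] ^+ 2.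
    by rewrite /G cabsM 2!cabsX cabsM cabsV 2!cabsX.
  have dE : density a h w = U * \prod_j (1 + cabs (h w - a j)).
    rewrite /density /U big_split /= [X in _ * (_ * X) = _](_ : _ = (cabs Q.[h w] ^+ 3)^-1);
      first by ring.
    by rewrite prodfV prodrXl QE (big_morph (@cabs R) (@cabsM R) (@cabs1 R)).
  rewrite GE dE prodrXl; clear GE dE; clearbody U; move: (\prod_j _) => Pr.
  by rewrite !exprMn; ring.
have rw w : cabs w < r -> 0 < r ^+ 2 - cabs w ^+ 2.
  by move=> wr; rewrite subr_gt0 ltr_pXn2r ?nnegrE ?cabs_ge0 ?(ltW r0).
have G0 : G z != 0.
  by rewrite mulf_neq0// expf_neq0// mulf_neq0 ?expf_neq0// invr_neq0// expf_neq0// Q0.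
have near_r : \forall w \near z, cabs w < r.
  apply/near_cabs; exists (r - cabs z); first by rewrite subr_gt0.
  by move=> w wz; have := ler_cabsB w z; lra.
have near_G : \forall w \near z, G w != 0 by apply: cont_neq0 G0 (cdiff_cont (nbhs_singleton
  hG)).
have kR : 0 < (k%:R : R) by rewrite ltr0n.
(* logarithm of the maximised quantity, as a sum of functions of squared moduli *)
pose I := option (option 'I_6).
pose K (i : I) : C -> C := match i with
  | None => G | Some None => fun w => w | Some (Some j) => fun w => h w - a j end.
(* The arguments are squared moduli, hence the factor [1/2] for [log |G|] and the square root in the
   last case. *)
pose Phi (i : I) : R -> R := match i with
  | None => fun t => 2^-1 * ln t | Some None => fun t => (6 * k%:R) * ln (r ^+ 2 - t)
  | Some (Some j) => fun t => k%:R * ln (1 + Num.sqrt t) end.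
pose D1 (i : I) : R := match i with
  | None => 2^-1 / sqm (G z) | Some None => - (6 * k%:R) / (r ^+ 2 - sqm z)
  | Some (Some j) => k%:R / (2 * (cabs (h z - a j) * (1 + cabs (h z - a j)))) end.
pose D2' (i : I) : R := match i with
  | None => - 2^-1 / sqm (G z) ^+ 2 | Some None => - (6 * k%:R) / (r ^+ 2 - sqm z) ^+ 2
  | Some (Some j) => - k%:R * (1 + 2 * cabs (h z - a j)) /
      (4 * cabs (h z - a j) ^+ 3 * (1 + cabs (h z - a j)) ^+ 2) end.
pose s : seq I := [:: None, Some None & [seq Some (Some j) | j <- index_enum 'I_6]].
have sumE (F : I -> R) : \sum_(i <- s) F i = F None + (F (Some None) + \sum_j F (Some (Some
  j))).
  by rewrite !big_cons big_map.
have logV w : (forall j, h w != a j) -> cabs w < r -> G w != 0 ->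
    \sum_(i <- s) Phi i (sqm (K i w)) =
    ln ((density a h w * (r ^+ 2 - cabs w ^+ 2) ^+ 6) ^+ k * cabs P.[w] ^+ 2).
  move=> hw wr Gw; rewrite Vfac// sumE /=.
  have g0 : 0 < cabs (G w) by rewrite cabs_gt0.
  have w0 := rw w wr.
  have p0 j : 0 < 1 + cabs (h w - a j) by have := cabs_ge0 (h w - a j); lra.
  have pr0 : 0 < \prod_j (1 + cabs (h w - a j)) ^+ k by apply: prodr_gt0 => j _;
    rewrite exprn_gt0.
  rewrite lnM ?posrE ?mulr_gt0 ?exprn_gt0// lnM ?posrE ?exprn_gt0//.
  rewrite -!exprM lnXn// !sqmE lnXn// -addrA; congr (_ + (_ + _)).
  - by rewrite -(mulr_natr (ln _)); field.
  - by rewrite -(mulr_natr (ln _)) natrM mulrC.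
  - rewrite ln_prod => [|j]; last by rewrite exprn_gt0.
    by apply: eq_bigr => j _; rewrite lnXn// mulr_natl.
have Vpos w : (forall j, h w != a j) -> cabs w < r -> G w != 0 ->
    0 < (density a h w * (r ^+ 2 - cabs w ^+ 2) ^+ 6) ^+ k * cabs P.[w] ^+ 2.
  move=> hw wr Gw; rewrite Vfac// !mulr_gt0 ?cabs_gt0 ?exprn_gt0 ?rw//.
  by apply: prodr_gt0 => j _; rewrite exprn_gt0//; have := cabs_ge0 (h w - a j); lra.
have hmaxU : \forall w \near z, \sum_(i <- s) Phi i (sqm (K i w)) <=
  \sum_(i <- s) Phi i (sqm (K i z)).
  near=> w; have hw : forall j, h w != a j by near: w.
  have wr : cabs w < r by near: w.
  have Gw : G w != 0 by near: w.
  rewrite !logV// ler_ln ?posrE ?Vpos//.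
  by near: w.
have hK i : holo (K i) z.
  case: i => [[j|]|] /=; last by [].
    by apply: filterS hh => w dw; exact: cdiffB dw (cdiff_cst _ _).
  by apply: near_all => w; exact: cdiff_id.
have hPhi i : C2at (Phi i) (sqm (K i z)) (D1 i) (D2' i).
  case: i => [[j|]|] /=.
  - by apply: C2at_ln_sqrt; rewrite sqmE exprn_gt0// cabs_gt0 subr_eq0.
  - by apply: C2at_ln_sub; rewrite sqmE -subr_gt0 rw.
  - by apply: C2at_ln; rewrite sqmE exprn_gt0// cabs_gt0.
have := max_laplacian hK hPhi hmaxU; rewrite sumE /=.
have X0 := rw z zr; set X := r ^+ 2 - cabs z ^+ 2 in X0 *.
have -> : 2^-1 / sqm (G z) + sqm (G z) * (- 2^-1 / sqm (G z) ^+ 2) = 0.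
  have g0 : sqm (G z) != 0 by rewrite sqmE expf_neq0// cabs_eq0.
  by field.
have -> : cD (fun w : C => w) z = 1 by exact: cDE (cder_id z).
have -> : - (6 * k%:R) / (r ^+ 2 - sqm z) + sqm z * (- (6 * k%:R) / (r ^+ 2 - sqm z) ^+ 2) =
    - (6 * k%:R * r ^+ 2 / X ^+ 2).
  have X1 : r ^+ 2 - sqm z != 0 by rewrite sqmE gt_eqF.
  by rewrite /X -sqmE; field.
pose q j := cabs (h z - a j).
pose Sg := \sum_j (q j * (1 + q j) ^+ 2)^-1.
have -> : \sum_j sqm (cD (fun w => h w - a j) z) *
    (k%:R / (2 * (cabs (h z - a j) * (1 + cabs (h z - a j)))) + sqm (h z - a j) *
    (- k%:R * (1 + 2 * cabs (h z - a j)) / (4 * cabs (h z - a j) ^+ 3 * (1 + cabs (h z - a j))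
      ^+ 2))) =
    k%:R * (cabs (cD h z) ^+ 2 * Sg / 4).
  rewrite /Sg mulr_sumr mulr_suml mulr_sumr; apply: eq_bigr => j _.
  have -> : cD (fun w => h w - a j) z = cD h z.
    by apply: cDE; have := cderB (cDP (nbhs_singleton hh)) (cder_cst (a j) z); rewrite subr0.
  rewrite !sqmE -/(q j); have q0 : 0 < q j by rewrite cabs_gt0 subr_eq0.
  have q1 : 0 < 1 + q j by lra.
  by field; rewrite !gt_eqF.
rewrite mulr0 add0r !sqmE cabs1 expr1n mul1r => hle.
have hle2 : cabs (cD h z) ^+ 2 * Sg <= 24 * r ^+ 2 / X ^+ 2.
  have : k%:R * (cabs (cD h z) ^+ 2 * Sg / 4) <= k%:R * (6 * r ^+ 2 / X ^+ 2).
    by rewrite -subr_le0; apply: le_trans hle; rewrite le_eqVlt; apply/orP; left; apply/eqP;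
      ring.
  rewrite ler_pM2l// -!mulrA; lra.
have S0 : 0 <= Sg.
  by apply: sumr_ge0 => j _; rewrite invr_ge0 mulr_ge0 ?sqr_ge0// cabs_ge0.
have hle3 : cabs (cD h z) ^+ 2 * Sg * X ^+ 2 <= 24 * r ^+ 2 by rewrite -ler_pdivlMr ?exprn_gt0.
(* Cubing matches [Sg ^+ 3] with the right-hand side of [curv]. *)
have -> : 24 ^+ 3 * r ^+ 6 = (24 * r ^+ 2) ^+ 3 by ring.
have A0 : 0 <= cabs (cD h z) ^+ 2 * Sg * X ^+ 2 by rewrite mulr_ge0 ?sqr_ge0// mulr_ge0
  ?sqr_ge0.
apply: le_trans (lerXn2r 3 A0 (le_trans A0 hle3) hle3).
have -> : (cabs (cD h z) ^+ 2 * Sg * X ^+ 2) ^+ 3 =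
  cabs (cD h z) ^+ 6 * X ^+ 6 * Sg ^+ 3 by ring.
rewrite /density; set Pr := \prod_j _.
have -> : c * (cabs (cD h z) ^+ 6 * Pr * X ^+ 6) =
  cabs (cD h z) ^+ 6 * X ^+ 6 * (c * Pr) by ring.
by apply: ler_wpM2l; [rewrite mulr_ge0 ?exprn_ge0 ?cabs_ge0// ltW|exact: curv].
Unshelve. all: by end_near.
Qed.
End Ahlfors.

(** * The Ahlfors-Schwarz argument with exceptional points *)

Section AhlforsTheorem.
Context {R : realType}.
Local Notation C := (Cplx R).
Implicit Types (z w x : C) (h : C -> C) (a : 'I_6 -> C) (B : C -> Prop).

Lemma poly_cabs_cont (P : {poly C}) z : {for z, continuous (fun w => cabs P.[w] ^+ 2)}.
Proof.
have cP : {for z, continuous (horner P)} by exact: cder_cont (cder_horner P z).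
exact (@rcontX R (fun w => cabs P.[w]) z 2 (cont_cabs_comp cP)).
Qed.

Arguments poly_cabs_cont P z : clear implicits.

(* Maximise [(density * (r^2 - |z|^2)^6)^k * |P|^2] over the disc of radius [r], where
   the polynomial [P] vanishes at the exceptional points; [k] and then [r] go to infinity. *)
Lemma ahlfors a h B : injective a ->
  (forall z, \forall w \near z^', ~ B w) ->
  (forall z, ~ B z -> holo h z) -> (forall z j, ~ B z -> h z != a j) ->
  (forall z, B z -> exists M : R, \forall w \near z^', density a h w <= M) ->
  forall z, ~ B z -> cD h z = 0.
Proof.
move=> ainj hB hh ha hbd z0 Bz0; apply/eqP; apply: contrapT => /negP h'0.
have [c c0 curv] := curvature_bound ainj.
pose S0 := density a h z0.
have S00 : 0 < S0 by rewrite density_gt0// => j; exact: ha.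
(* Since [2 |z0| <= r], the weight at [z0] is at least [r^12 / 64]; the last summand then makes [z0]
   violate the bound [24^3 r^6] of [ahlfors_max_point]. *)
pose r := 2 * cabs z0 + 1 + 64 * 24 ^+ 3 / (c * S0).
have cS : 0 < c * S0 by exact: mulr_gt0.
have t0 : 0 < 64 * 24 ^+ 3 / (c * S0) by rewrite divr_gt0.
have z00 := cabs_ge0 z0.
have r1 : 1 <= r by rewrite /r; lra.
have r0 : 0 < r by lra.
have rz : 2 * cabs z0 <= r by rewrite /r; lra.
have z0r : cabs z0 < r by rewrite /r; lra.
pose X w : R := (r ^+ 2 - cabs w ^+ 2) ^+ 6.
have big : 24 ^+ 3 * r ^+ 6 < c * (S0 * X z0).
  have X1 : r ^+ 2 / 2 <= r ^+ 2 - cabs z0 ^+ 2 by nra.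
  have r20 : 0 <= r ^+ 2 / 2 by have := sqr_ge0 r; lra.
  have X2 : r ^+ 12 / 64 <= X z0.
    have -> : r ^+ 12 / 64 = (r ^+ 2 / 2) ^+ 6 by field.
    exact: lerXn2r (le_trans r20 X1) X1.
  have r6 : 0 < r ^+ 6 by rewrite exprn_gt0.
  have rr : r <= r ^+ 6 by rewrite -{1}[r]expr1 ler_weXn2l.
  have : 64 * 24 ^+ 3 < c * S0 * r ^+ 6.
    rewrite -ltr_pdivrMl// mulrC; apply: lt_le_trans rr; rewrite /r; lra.
  move: X2; rewrite [c * (_ * _)]mulrA; set y := r ^+ 6 in r6 *; set m := 24 ^+ 3.
  have -> : r ^+ 12 = y * y by rewrite /y -exprD.
  move=> X2 h1; apply: lt_le_trans (_ : c * S0 * (y * y / 64) <= _); last by rewrite ler_pM2l.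
  have -> : c * S0 * (y * y / 64) = (c * S0 * y) / 64 * y by ring.
  rewrite ltr_pM2r//; lra.
have [ps psB Bps] := finite_in_disc r hB.
pose P := \prod_(p <- ps) ('X - p%:P).
have P0 w : (P.[w] != 0) = (w \notin ps) by rewrite -[_ == 0]/(root P w) root_prod_XsubC.
have nB w : cabs w <= r -> ~ B w -> P.[w] != 0.
  by move=> _ Bw; rewrite P0; apply/negP => /psB.
have [Mp hMp] : exists Mp : R, forall w, cabs w <= r -> cabs P.[w] ^+ 2 <= Mp.
  have [w _|w wr hw] := @disc_EVT R (fun w => cabs P.[w] ^+ 2) r (ltW r0).
    exact: poly_cabs_cont.
  by exists (cabs P.[w] ^+ 2).
have cX w : {for w, continuous X}.
  have c1 : {for w, continuous (fun w : C => - 1 * cabs w ^+ 2)}.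
    exact (rcontM (rcont_cst (-1) w) (@rcontX R (@cabs R) w 2 (@cont_cabs R w))).
  apply: rcont_eq (@rcontX R _ w 6 (rcontD (rcont_cst (r ^+ 2) w) c1)) => y.
  by rewrite /X mulN1r.
have X0 w : 0 <= X w by rewrite /X exprn_even_ge0.
pose E k w := (density a h w * X w) ^+ k * cabs P.[w] ^+ 2.
(* The value [0] on [B] makes [V] continuous on the disc: the density is bounded near such a point
   and [P] vanishes there. *)
pose V k w := if `[< B w >] then 0 else E k w.
have cE k w : ~ B w -> {for w, continuous (E k)}.
  move=> Bw; have cd := density_cont (hh w Bw) (fun j => ha w j Bw).
  exact (rcontM (rcontX (rcontM cd (cX w))) (poly_cabs_cont P w)).
have nearB w : ~ B w -> \forall v \near w, ~ B v.
  move=> Bw; have /dnear_cabs[d d0 hd] := hB w; apply/near_cabs; exists d => // v vd.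
  by have [->//|vw] := eqVneq v w; exact: hd.
have cV k w : cabs w <= r -> {for w, continuous (V k)}.
  move=> wr; have [Bw|Bw] := pselect (B w).
    have [M /dnear_cabs[d d0 hd]] := hbd w Bw.
    have Vw : V k w = 0 by rewrite /V asboolT.
    apply/rcontP => e e0; rewrite Vw.
    have /rcontP /(_ 1 ltr01)[d1 d10 hd1] := cX w.
    pose M' := (`|M| * (X w + 1)) ^+ k + 1.
    have M'0 : 0 < M' by rewrite ltr_wpDl// exprn_ge0// mulr_ge0// addr_ge0.
    have /rcontP := poly_cabs_cont P w => /(_ (e / M')).
    have Pw : P.[w] = 0 by apply/eqP; rewrite -[_ == 0]negbK P0 (Bps w wr Bw).
    rewrite Pw cabs0 expr0n /=; case=> [|d2 d20 hd2]; first by rewrite divr_gt0.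
    exists (Order.min d (Order.min d1 d2)) => [|v]; first by rewrite !lt_min d0 d10.
    rewrite !lt_min => /and3P[vd vd1 vd2]; rewrite subr0 /V; case: asboolP => Bv;
      first by rewrite normr0.
    have vw : v != w by apply/eqP => vw; apply: Bv; rewrite vw.
    have h1 := hd v vw vd; have h2 := hd1 v vd1; have h3 := hd2 v vd2; rewrite subr0 in h3.
    have s0 := sqr_ge0 (cabs P.[v]); rewrite ger0_norm// in h3.
    have D0 := density_ge0 a h v; have Xv := X0 v.
    have k1 : (density a h v * X v) ^+ k <= M'.
      apply: le_trans (_ : (`|M| * (X w + 1)) ^+ k <= _); last by rewrite lerDl.
      have Xw := X0 w; have y1 : 0 <= `|M| * (X w + 1) by rewrite mulr_ge0// addr_ge0.
      apply: (lerXn2r k (mulr_ge0 D0 Xv) y1).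
      apply: ler_pM => //; first by apply: le_trans h1 (ler_norm _).
      by move: h2; rewrite ltr_norml; lra.
    have k0 : 0 <= (density a h v * X v) ^+ k by rewrite exprn_ge0// mulr_ge0.
    rewrite /E ger0_norm; last exact: (mulr_ge0 k0 s0).
    by move: h3; rewrite ltr_pdivlMr// => h3; nra.
  have /rcontP hc := cE k w Bw; have /near_cabs[d d0 hd] := nearB w Bw.
  apply/rcontP => e /hc[d' d'0 hd']; exists (Order.min d d') => [|v];
    first by rewrite lt_min d0.
  by rewrite lt_min => /andP[vd vd']; rewrite /V !asboolF//; [exact: hd'|exact: hd].
(* The ratio exceeds 1 by [big], so these bounds cannot hold for all [k]. The case [k = 0] is apart
   because the inequality at a maximum needs [k > 0]. *)
have key k : cabs P.[z0] ^+ 2 * (c * (S0 * X z0) / (24 ^+ 3 * r ^+ 6)) ^+ k <= Mp.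
  case: k => [|k']; first by rewrite expr0 mulr1; apply: hMp; exact: ltW.
  set k := k'.+1.
  have [z1 z1r hz1] := @disc_EVT R (V k) r (ltW r0) (cV k).
  have Vz0 : V k z0 = (S0 * X z0) ^+ k * cabs P.[z0] ^+ 2 by rewrite /V asboolF.
  have r6 : 0 < 24 ^+ 3 * r ^+ 6 by rewrite mulr_gt0 ?exprn_gt0.
  have Xz0 : 0 < X z0.
    have := lt_trans r6 big; rewrite pmulr_rgt0// pmulr_rgt0//.
  have Vz0p : 0 < V k z0.
    have p20 : 0 < cabs P.[z0] ^+ 2 by rewrite exprn_gt0// cabs_gt0 nB// ltW.
    by rewrite Vz0 mulr_gt0// exprn_gt0// mulr_gt0.
  have Vz1 := hz1 z0 (ltW z0r).
  have Bz1 : ~ B z1 by move=> Bz1; move: Vz1; rewrite {2}/V asboolT//; lra.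
  have Ez1 : V k z1 = E k z1 by rewrite /V asboolF.
  have Ep : 0 < E k z1 by rewrite -Ez1; lra.
  have nz : density a h z1 != 0 /\ X z1 != 0.
    by split; apply: contraTneq Ep => e; rewrite /E e ?mul0r ?mulr0 expr0n mul0r ltxx.
  have z1lt : cabs z1 < r.
    rewrite lt_neqAle z1r andbT; apply/eqP => e; case: nz => _.
    by rewrite /X e subrr expr0n eqxx.
  have d1 : cD h z1 != 0.
    rewrite -(density_gt0 (a := a)); last by move=> j; exact: ha.
    by rewrite lt_def density_ge0 nz.1.
  have mx : \forall w \near z1, E k w <= E k z1.
    have /near_cabs[d d0 hd] := nearB z1 Bz1.
    apply/near_cabs; exists (Order.min d (r - cabs z1)); first by rewrite lt_min d0 subr_gt0.
    move=> w; rewrite lt_min => /andP[wd wr]; have Bw := hd w wd.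
    have := hz1 w; rewrite Ez1 /V asboolF//; apply.
    by have := ler_cabsB w z1; lra.
  have := @ahlfors_max_point R a h z1 c r k P isT curv r0 z1lt (hh z1 Bz1) (fun j =>
    ha z1 j Bz1) d1 (nB z1 z1r Bz1) mx.
  rewrite -/(X z1) => fin.
  have y0 : 0 <= density a h z1 * X z1 by rewrite mulr_ge0 ?density_ge0.
  have e1 : (c * (density a h z1 * X z1)) ^+ k <= (24 ^+ 3 * r ^+ 6) ^+ k.
    exact: (lerXn2r k (mulr_ge0 (ltW c0) y0) (ltW r6) fin).
  have e2 := hMp z1 z1r.
  move: Vz1; rewrite Vz0 Ez1 /E => Vz1.
  have ck u : (c * u) ^+ k = c ^+ k * u ^+ k by exact: exprMn.
  have g1 : (c * (S0 * X z0)) ^+ k * cabs P.[z0] ^+ 2 <=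
      (c * (density a h z1 * X z1)) ^+ k * cabs P.[z1] ^+ 2.
    by rewrite (ck (S0 * X z0)) (ck (density a h z1 * X z1)) -!(mulrA (c ^+ k)) ler_pM2l//
      exprn_gt0.
  have Mp0 : 0 <= cabs P.[z1] ^+ 2 by exact: sqr_ge0.
  have g2 := ler_pM (exprn_ge0 k (mulr_ge0 (ltW c0) y0)) Mp0 e1 e2.
  have := le_trans g1 g2.
  move: (c * (S0 * X z0)) (24 ^+ 3 * r ^+ 6) r6 => U W W0 g3.
  by rewrite expr_div_n mulrA ler_pdivrMr ?exprn_gt0// mulrC [Mp * _]mulrC.
apply: (pow_unbounded _ _ key).
  by rewrite exprn_gt0// cabs_gt0 nB// ltW.
by rewrite ltr_pdivlMr ?mul1r// mulr_gt0 ?exprn_gt0.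
Qed.
End AhlforsTheorem.

(** * Simple roots of the discriminant *)

Section SimpleRoots.
Context {F : numClosedFieldType}.
Implicit Types (A a b w x : F) (m : nat).

(* With [n = m + 3] and [h = f / g], the discriminant of the equation
   [(h^n - A) g^2 + a (h^(n-1) - A) g + b (h^(n-2) - A) = 0], as a polynomial in [h]. *)
Definition discr m a b A : {poly F} :=
  a ^+ 2 *: ('X^(m.+2) - A%:P) ^+ 2 - (4 * b) *: (('X^(m.+3) - A%:P) * ('X^(m.+1) - A%:P)).

(** The discriminant made monic: with [N = m + 2], the hypothesis on [a^2 / b] gives it the leading
    coefficient [a^2 - 4 b = - 4 b / N^2]. *)
Definition rdiscr m A : {poly F} :=
  'X^(m.+2 + m.+2) + (A ^+ 2)%:P - (A * m.+2%:R ^+ 2) *: ('X^(m.+3) + 'X^(m.+1))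
  + (2 * A * (m.+2%:R ^+ 2 - 1)) *: 'X^(m.+2).

Lemma discrE m a b A : a ^+ 2 = 4 * (1 - 1 / m.+2%:R ^+ 2) * b ->
  discr m a b A = (- (4 * b / m.+2%:R ^+ 2)) *: rdiscr m A.
Proof.
move=> ab; have N0 : (m.+2%:R : F) != 0 by rewrite pnatr_eq0.
have e1 : (A ^+ 2)%:P = A%:P * A%:P :> {poly F} by rewrite expr2 polyCM.
rewrite /discr /rdiscr ab -!mul_polyC exprD e1 ![(_ * 'X^_)%R]mulrC.
have -> : 'X^(m.+3) = 'X^(m.+1) * 'X * 'X :> {poly F} by rewrite -!exprSr.
have -> : 'X^(m.+2) = 'X^(m.+1) * 'X :> {poly F} by rewrite -exprSr.
set u := 'X^(m.+1); set N := m.+2%:R in N0 *.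
have e2 : (4 * (1 - 1 / N ^+ 2) * b)%:P = (4 * b)%:P - (4 * b / N ^+ 2)%:P.
  by rewrite -polyCB; congr (_%:P); field.
have e3 : (A * N ^+ 2)%:P * (4 * b / N ^+ 2)%:P = A%:P * (4 * b)%:P.
  by rewrite -!polyCM; congr (_%:P); field.
have e4 : (2 * A * (N ^+ 2 - 1))%:P * (4 * b / N ^+ 2)%:P =
  2 * A%:P * ((4 * b)%:P - (4 * b / N ^+ 2)%:P).
  rewrite -!polyCM -polyCB (_ : 2 = (2 : F)%:P); last by rewrite polyC_natr.
  by rewrite -!polyCM; congr (_%:P); field.
rewrite e2 polyCN; apply/eqP; rewrite -subr_eq0; apply/eqP.
set c := (4 * b)%:P in e3 e4 *; set d := (4 * b / N ^+ 2)%:P in e3 e4 *.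
set p := (A * N ^+ 2)%:P in e3 *; set q := (2 * A * (N ^+ 2 - 1))%:P in e4 *.
transitivity ((q * d - 2 * A%:P * (c - d)) * (u * 'X) - (p * d - A%:P * c) * (u * 'X * 'X +
  u)); first by ring.
by rewrite e3 e4 !subrr !mul0r subr0.
Qed.

Lemma rdiscr_eval m A w : (rdiscr m A).[w] =
  (w ^+ m.+1) ^+ 2 * w ^+ 2 + A ^+ 2 - A * m.+2%:R ^+ 2 * (w ^+ m.+1 * w ^+ 2 + w ^+ m.+1)
  + 2 * A * (m.+2%:R ^+ 2 - 1) * (w ^+ m.+1 * w).
Proof.
rewrite /rdiscr !(hornerD, hornerN, hornerZ, hornerC, hornerXn) exprD.
rewrite [w ^+ m.+3]exprSr ![w ^+ m.+2]exprSr; by move: (w ^+ m.+1) => u; ring.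
Qed.

(** The factor [w] lets every term be written through [w] and [w ^+ m.+1], as in [rdiscr_eval]. *)
Lemma rdiscr_deriv m A w : w * (rdiscr m A)^`().[w] =
  2 * m.+2%:R * ((w ^+ m.+1) ^+ 2 * w ^+ 2) - A * m.+2%:R ^+ 2 *
   ((m.+2%:R + 1) * (w ^+ m.+1 * w ^+ 2) + (m.+2%:R - 1) * w ^+ m.+1)
  + 2 * A * (m.+2%:R ^+ 2 - 1) * (m.+2%:R * (w ^+ m.+1 * w)).
Proof.
rewrite /rdiscr !(derivD, derivN, derivZ, derivC, derivXn) !(hornerMn, hornerXn, hornerZ,
  hornerC, hornerN, hornerD).
have -> : ((m.+2 + m.+2).-1 = m.+1 + m.+2)%N by [].
rewrite -!(mulr_natl (w ^+ _)) natrD !PeanoNat.Nat.pred_succ.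
have E1 : (m.+3%:R : F) = m.+2%:R + 1 by rewrite natr1.
have E2 : (m.+1%:R : F) = m.+2%:R - 1 by rewrite -[m.+2%:R]natr1 addrK.
have -> : w ^+ (m.+1 + m.+2) = (w ^+ m.+1) ^+ 2 * w by rewrite exprD [w ^+ m.+2]exprSr mulrA
  -expr2.
have -> : w ^+ m.+2 = w ^+ m.+1 * w by rewrite exprSr.
rewrite E1 E2 [w ^+ m.+1]exprS; move: (w ^+ m) (m.+2%:R) => u N.
by ring.
Qed.

(** With [u = w^(m+1)], the two equations express [u^2 w^2 + A^2] and [u^2 w^2 - A^2] as multiples
    of [A u]. The difference of their squares is [4 A^2 u^2 w^2], which eliminates the powers of [u]
    and leaves a non-zero multiple of [(w - 1)^4]: this is what the special ratio [a^2 / b]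
    achieves. *)
Lemma rdiscr_double_root m A w : A != 0 ->
  (rdiscr m A).[w] = 0 -> (rdiscr m A)^`().[w] = 0 -> w = 1.
Proof.
move=> A0 h1 h2; have w0 : w != 0.
  apply/eqP => w0; move: h1; rewrite rdiscr_eval w0 !expr0n /= !mul0r addr0 !mulr0 addr0 subr0
    add0r.
  by move/eqP; rewrite expf_eq0 (negbTE A0).
have := rdiscr_deriv m A w; rewrite h2 mulr0 => /esym h3.
move: h1; rewrite rdiscr_eval => h1.
have u0 : w ^+ m.+1 != 0 by rewrite expf_neq0.
have N0 : (m.+2%:R : F) != 0 by rewrite pnatr_eq0.
have N1 : (m.+2%:R : F) ^+ 2 - 1 != 0.
  have -> : (m.+2%:R : F) ^+ 2 - 1 = m.+3%:R * m.+1%:R by rewrite -[m.+3%:R]natr1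
    -[m.+2%:R]natr1; ring.
  by rewrite mulf_neq0 ?pnatr_eq0.
move: u0 N0 N1 h1 h3; set u := w ^+ m.+1; set N := m.+2%:R => u0 N0 N1 h1 h3.
have hE : u ^+ 2 * w ^+ 2 - A ^+ 2 = A * N * u * (w ^+ 2 - 1).
  apply: (mulfI N0); apply/eqP; rewrite -subr_eq0; apply/eqP.
  transitivity (0 - N * 0 : F); last by rewrite mulr0 subr0.
  rewrite -{1}h3 -h1; ring.
have hS : u ^+ 2 * w ^+ 2 + A ^+ 2 = A * u * (N ^+ 2 * (w ^+ 2 + 1) - 2 * (N ^+ 2 - 1) * w).
  by apply/eqP; rewrite -subr_eq0; apply/eqP; rewrite -[RHS]h1; ring.
have key : (A * u) ^+ 2 * (N ^+ 2 * (N ^+ 2 - 1)) * (w - 1) ^+ 4 = 0.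
  transitivity ((A * u * (N ^+ 2 * (w ^+ 2 + 1) - 2 * (N ^+ 2 - 1) * w)) ^+ 2
     - (A * N * u * (w ^+ 2 - 1)) ^+ 2 - 4 * (A ^+ 2 * u ^+ 2 * w ^+ 2)); first by ring.
  by rewrite -hS -hE; ring.
have nz : (A * u) ^+ 2 * (N ^+ 2 * (N ^+ 2 - 1)) != 0.
  exact: mulf_neq0 (expf_neq0 2 (mulf_neq0 A0 u0)) (mulf_neq0 (expf_neq0 2 N0) N1).
by move/eqP: key; rewrite mulf_eq0 (negbTE nz) expf_eq0 /= subr_eq0 => /eqP.
Qed.

Lemma dvdp_exp_deriv (p : {poly F}) x k : ('X - x%:P) ^+ k.+1 %| p -> ('X - x%:P) ^+ k %| p^`().
Proof.
move=> /dvdpP[s ->]; rewrite derivM deriv_exp derivXsubC mul1r /= dvdp_add//.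
  by rewrite exprS mulrA dvdp_mull.
by rewrite -mulr_natr mulrCA dvdp_mulIl.
Qed.

(* The fourth derivative at [1] is [2 N^2 (N^2 - 1)], with [N = m + 2]. *)
Lemma rdiscr_root1 m A : (3 <= m)%N -> A != 0 -> ~~ (('X - 1%:P) ^+ 5 %| rdiscr m A).
Proof.
move=> m3 A0; apply/negP => d5.
(* The value of [rdiscr m A] at [1] is [(1 - A)^2]. *)
have A1 : A = 1.
  have : root (rdiscr m A) 1.
    by rewrite -dvdp_XsubCl; apply: dvdp_trans d5; rewrite exprS dvdp_mulIl.
  rewrite /root rdiscr_eval !expr1n => /eqP h; apply/esym/eqP; rewrite -subr_eq0 -sqrf_eq0.
  by rewrite -[X in _ == X]h; apply/eqP; ring.
have r1 : root (rdiscr m A)^`(4) 1.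
  by rewrite -dvdp_XsubCl -[_ - _]expr1 /derivn /= !dvdp_exp_deriv.
move: m m3 d5 r1 => [|[|[|l]]] // _ _.
rewrite /rdiscr A1 /root !(derivnD, derivnN, derivnB, derivnZ) derivnC derivnXn !derivnXn.
rewrite !(hornerMn, hornerXn, hornerZ, hornerC, hornerN, hornerD) !expr1n.
have -> : (l.+3.+2 + l.+3.+2 = (l + l + 6).+4)%N by lia.
rewrite !ffactSS !ffactn0 !muln1 !natrM.
have e i : (l + l + 6 + i)%:R = 2 * l%:R + 6 + i%:R :> F by rewrite !natrD; ring.
have e' i : (l + i)%:R = l%:R + i%:R :> F by rewrite natrD.
have := (e 1%N, e 2%N, e 3%N, e 4%N); rewrite !addn1 !addn2 !addn3 !addn4 => -[[[-> ->] ->] ->].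
have := (e' 1%N, e' 2%N, e' 3%N, e' 4%N); rewrite !addn1 !addn2 !addn3 !addn4 =>
  -[[[E1 E2] E3] E4].
have E5 : l.+4.+1%:R = l%:R + 5 :> F by rewrite -[l.+4.+1]addn4 -addSnnS !addnS addn0 -(e' 5%N)
  !addnS addn0.
have E6 : l.+4.+2%:R = l%:R + 6 :> F by rewrite -natr1 E5; ring.
rewrite E1 E2 E3 E4 E5 E6 /=; set L : F := l%:R => /eqP h.
have : 2 * (L + 5) ^+ 2 * ((L + 4) * (L + 6)) = 0 :> F by rewrite -[RHS]h; ring.
have n0 i : (0 < i)%N -> L + i%:R != 0 by move=> i0; rewrite /L -natrD pnatr_eq0; lia.
by apply/eqP; rewrite !mulf_neq0 ?expf_neq0 ?n0// pnatr_eq0.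
Qed.

Lemma count_dvdp (rs : seq F) x : ('X - x%:P) ^+ (count_mem x rs) %| \prod_(y <- rs) ('X -
  y%:P).
Proof.
elim: rs => [|y rs IH]; first by rewrite big_nil expr0 dvdpp.
rewrite big_cons /=; have [->|yx] := eqVneq y x; first by rewrite add1n exprS dvdp_mul.
by rewrite add0n dvdp_mull.
Qed.

Lemma discr_six_simple_roots m a b A : (3 <= m)%N -> A != 0 -> b != 0 ->
  a ^+ 2 = 4 * (1 - 1 / m.+2%:R ^+ 2) * b ->
  exists2 al : 'I_6 -> F, injective al &
    forall j, (discr m a b A).[al j] = 0 /\ (discr m a b A)^`().[al j] != 0.
Proof.
move=> m3 A0 b0 ab.
have N0 : (m.+2%:R : F) != 0 by rewrite pnatr_eq0.
set q := rdiscr m A; set k := - (4 * b / m.+2%:R ^+ 2).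
have k0 : k != 0 by rewrite oppr_eq0 mulf_neq0 ?invr_neq0 ?expf_neq0// mulf_neq0// pnatr_eq0.
have [rs qE] := closed_field_poly_normal q.
have szq : size q = (m.+2 + m.+2).+1.
  rewrite /q /rdiscr -!addrA size_polyDl size_polyXn// ltnS.
  apply: (leq_trans (size_polyD _ _)); rewrite geq_max (leq_trans (size_polyC_leq1 _))//=.
  apply: (leq_trans (size_polyD _ _)); rewrite geq_max size_polyN.
  rewrite !(leq_trans (size_scale_leq _ _))//; first by rewrite size_polyXn; lia.
  by apply: (leq_trans (size_polyD _ _)); rewrite geq_max !size_polyXn; lia.
have q0 : q != 0 by rewrite -size_poly_gt0 szq.
have l0 : lead_coef q != 0 by rewrite lead_coef_eq0.
have szr : size rs = (m.+2 + m.+2)%N.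
  by move: szq; rewrite qE size_scale// size_prod_XsubC => -[].
have dv x : ('X - x%:P) ^+ (count_mem x rs) %| q by rewrite qE dvdpZr// count_dvdp.
have c1 : (count_mem 1%R rs <= 4)%N.
  rewrite leqNgt; apply/negP => c5; have := rdiscr_root1 m3 A0; rewrite -/q => /negP; apply.
  by apply: dvdp_trans (dv 1); rewrite dvdp_exp2l.
have rr x : x \in rs -> q.[x] = 0.
  by move=> xr; apply/eqP; rewrite -[_ == 0]/(root q x) qE rootZ// root_prod_XsubC.
have cx x : x \in rs -> x != 1 -> q^`().[x] != 0.
  by move=> xr; apply: contraNneq => dx; apply/eqP; exact: (rdiscr_double_root A0 (rr x xr) dx).
(* A root other than [1] listed twice would be a root of the derivative. *)
have ux : uniq [seq x <- rs | x != 1].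
  apply: count_mem_uniq => x; rewrite mem_filter count_filter.
  have [->|x1] /= := eqVneq x 1.
    rewrite (@eq_count _ _ pred0) ?count_pred0// => y /=.
    by case: eqP => //= ->; rewrite eqxx.
  have -> : count (predI (pred1 x) (fun y => y != 1)) rs = count_mem x rs.
    by apply: eq_count => y /=; case: eqP => //= ->; rewrite x1.
  have [xr|xr] := boolP (x \in rs); last by apply/count_memPn.
  apply/eqP; rewrite eqn_leq -has_count has_pred1 xr andbT leqNgt; apply/negP => c2.
  have : root q^`() x.
    rewrite -dvdp_XsubCl -[_ - _]expr1; apply: dvdp_exp_deriv.
    by apply: dvdp_trans (dv x); rewrite dvdp_exp2l.
  by rewrite /root (negbTE (cx x xr x1)).
have sz6 : (6 <= size [seq x <- rs | (x != 1)%R])%N.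
  have := count_predC (pred1 (1 : F)) rs; rewrite szr size_filter.
  have -> : count (predC (pred1 (1 : F))) rs = count (fun x : F =>
    x != 1) rs by apply: eq_count.
  move: (count _ rs) (count_mem (1 : F) rs) c1 => u v v4 uv.
  by move: m3; lia.
pose al (j : 'I_6) := nth 0 [seq x <- rs | x != 1] j.
have aj j : al j \in [seq x <- rs | x != 1] by rewrite mem_nth// (leq_trans _ sz6).
exists al.
  move=> i j /eqP; rewrite nth_uniq// ?(leq_trans _ sz6)// => /eqP e; exact: val_inj.
move=> j; have := aj j; rewrite mem_filter => /andP[j1 jr].
rewrite (discrE _ ab) -/k -/q derivZ !hornerZ rr// mulr0; split => //.
by rewrite mulf_neq0// cx.
Qed.
End SimpleRoots.

(** * Local structure of meromorphic functions and the identity theorem *)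

Section Meromorphic.
Context {R : realType}.
Local Notation C := (Cplx R).
Implicit Types (z w x c : C) (f g : C -> sphere R) (p q h : C -> C).

Lemma dnear_and z (P Q : C -> Prop) : (\forall w \near z^', P w) ->
  (\forall w \near z^', Q w) ->
  \forall w \near z^', P w /\ Q w.
Proof.
move=> /dnear_cabs[d d0 hP] /dnear_cabs[e e0 hQ]; apply/dnear_cabs.
exists (Order.min d e) => [|w wz]; first by rewrite lt_min d0.
by rewrite lt_min => /andP[wd we]; split; [exact: hP|exact: hQ].
Qed.

Lemma dnear_imp z (P Q : C -> Prop) : (forall w, P w -> Q w) ->
  (\forall w \near z^', P w) -> \forall w \near z^', Q w.
Proof. by move=> PQ /dnear_cabs[d d0 hP]; apply/dnear_cabs; exists d => // w /hP h /h /PQ. Qed.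

Lemma dnearW z (P : C -> Prop) : (\forall w \near z, P w) -> \forall w \near z^', P w.
Proof. by move=> /near_cabs[d d0 hP]; apply/dnear_cabs; exists d => // w _ /hP. Qed.

Lemma dnear_ex z (P : C -> Prop) : (\forall w \near z^', P w) -> exists2 w, w != z & P w.
Proof.
move=> /dnear_cabs[d d0 hP]; exists (z + rc (d / 2)); last apply: hP.
- by rewrite -subr_eq0 addrC addKr -rc0 (inj_eq rc_inj) gt_eqF//; lra.
- by rewrite -subr_eq0 addrC addKr -rc0 (inj_eq rc_inj) gt_eqF//; lra.
- by rewrite addrC addKr cabs_rc ger0_norm; lra.
Qed.

Lemma dnear_near z (P : C -> Prop) : (\forall w \near z^', P w) ->
  \forall w \near z^', \forall v \near w, P v.
Proof.
move=> /dnear_cabs[d d0 hP]; apply/dnear_cabs; exists d => // w wz wd.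
have wz0 : 0 < cabs (w - z) by rewrite cabs_gt0 subr_eq0.
apply/near_cabs; exists (Order.min (cabs (w - z)) (d - cabs (w - z))).
  by rewrite lt_min wz0 subr_gt0.
move=> v; rewrite lt_min => /andP[v1 v2]; apply: hP.
  by apply: contraTneq v1 => ->; rewrite cabsB ltxx.
by have := cabs_dist v w z; lra.
Qed.

Lemma dnear_all6 z (P : 'I_6 -> C -> Prop) : (forall j, \forall w \near z^', P j w) ->
  \forall w \near z^', forall j, P j w.
Proof.
move=> h.
have /choice[d hd] : forall j, exists d : R, 0 < d /\ forall w, w != z -> cabs (w - z) < d ->
  P j w.
  by move=> j; have /dnear_cabs[d d0 hd] := h j; exists d.
have [j0 _ hj0] := @seq_argmax R _ (fun j => - d j) (enum 'I_6) ord0 ltac:(by rewrite mem_enum).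
apply/dnear_cabs; exists (d j0); first by have [] := hd j0.
move=> w wz wd j; apply: (hd j).2 => //; apply: lt_le_trans wd _.
by have := hj0 j; rewrite mem_enum lerN2; apply.
Qed.

Lemma rcont_bounded (F : C -> R) z : {for z, continuous F} ->
  \forall w \near z, F w <= F z + 1.
Proof.
move=> /rcontP /(_ 1 ltr01)[d d0 hd]; apply/near_cabs; exists d => // w /hd.
by rewrite ltr_norml; lra.
Qed.

Lemma finite_partE f z : f z <> None -> f z = Some (finite_part f z).
Proof. by rewrite /finite_part; case: (f z). Qed.

Lemma merom_regular f : meromorphic f -> forall z,
  \forall w \near z^', f w <> None /\ cdiff (finite_part f) w.
Proof.
by move=> mf z; have [h _] := mf z; apply: dnear_imp h => w [? /derivable_cdiff].
Qed.

Lemma merom_holo f z : meromorphic f -> f z <> None -> holo (finite_part f) z.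
Proof.
move=> mf fz; have [_] := mf z; case E : (f z) => [u|] // /derivable_cdiff dz.
have /dnear_cabs[d d0 hd] := merom_regular mf z.
apply/near_cabs; exists d => // w wd; have [->//|wz] := eqVneq w z.
by have [] := hd w wz wd.
Qed.

Lemma merom_pole f z (M : R) : meromorphic f -> f z = None -> 0 < M ->
  \forall w \near z^', M < cabs (finite_part f w).
Proof.
move=> mf fz M0; have [_] := mf z; rewrite fz => /(_ (rc M)).
rewrite -rc0 ltrc => /(_ M0); apply: dnear_imp => w.
by rewrite normE ltrc.
Qed.

(** At a pole [1 / f] is bounded by 1 and extends holomorphically. The point [z] itself is left out
    because [finite_part] has the default [0] at a pole. *)
Lemma merom_local f z : meromorphic f -> exists p q, [/\ holo p z, holo q z &
  \forall w \near z^', q w != 0 /\ finite_part f w = p w / q w].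
Proof.
move=> mf; have reg := merom_regular mf z.
have holo1 : holo (fun _ : C => 1 : C) z by apply: near_all => w; exact: cdiff_cst.
case E : (f z) => [u|].
  exists (finite_part f), (fun _ => 1); split => //.
    by apply: merom_holo => //; rewrite E.
  by apply/dnear_cabs; exists 1 => // w _ _; rewrite oner_neq0 divr1.
have big := merom_pole mf E ltr01.
have big0 w : 1 < cabs (finite_part f w) -> finite_part f w != 0.
  by move=> h; rewrite -cabs_gt0; lra.
have [||q hq qE] := @removable_bounded R (fun w => (finite_part f w)^-1) z 1.
- apply: dnear_imp (dnear_and reg big) => w [[_ dw] bw]; apply: cdiffV dw; exact: big0.
- by apply: dnear_imp big => w bw; rewrite cabsV invf_le1; lra.
exists (fun _ => 1), q; split => //.
apply: dnear_imp (dnear_and qE big) => w [-> bw].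
by rewrite invr_eq0 big0// div1r invrK.
Qed.

(** Written with local fractions, [f - c g] has a holomorphic numerator [D], whose zeros are
    isolated unless it vanishes identically near [z]. *)
Lemma merom_dichotomy f g c z : meromorphic f -> meromorphic g ->
  (\forall w \near z^', finite_part f w = c * finite_part g w) \/
  (\forall w \near z^', finite_part f w != c * finite_part g w).
Proof.
move=> mf mg; have [p1 [q1 [hp1 hq1 E1]]] := merom_local z mf.
have [p2 [q2 [hp2 hq2 E2]]] := merom_local z mg.
pose D w := p1 w * q2 w - c * p2 w * q1 w.
have hD : holo D z.
  suff : \forall w \near z, cdiff D w by [].
  near=> w; have d1 : cdiff p1 w by near: w. have d2 : cdiff p2 w by near: w.
  have d3 : cdiff q1 w by near: w. have d4 : cdiff q2 w by near: w.
  exact: cdiffB (cdiffM d1 d4) (cdiffM (cdiffM (cdiff_cst c w) d2) d3).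
have key w : q1 w != 0 -> q2 w != 0 -> (p1 w / q1 w == c * (p2 w / q2 w)) = (D w == 0).
  move=> n1 n2; rewrite -subr_eq0.
  have -> : p1 w / q1 w - c * (p2 w / q2 w) = D w / (q1 w * q2 w).
    by rewrite /D; field; rewrite n1 n2.
  by rewrite mulf_eq0 invr_eq0 mulf_eq0 (negbTE n1) (negbTE n2) !orbF.
have [/dnearW Z|Z] := isolated_zeros hD; [left|right];
  apply: dnear_imp (dnear_and Z (dnear_and E1 E2)) => w [Dw [[n1 ->] [n2 ->]]].
  by apply/eqP; rewrite key// Dw.
by rewrite key.
Unshelve. all: by end_near.
Qed.

Lemma finite_eq f g z : meromorphic f -> meromorphic g ->
  (\forall w \near z^', finite_part f w = finite_part g w) ->
  \forall w \near z^', f w = g w.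
Proof.
move=> mf mg E; have := dnear_and E (dnear_and (merom_regular mf z) (merom_regular mg z)).
apply: dnear_imp => w [e [[fw _] [gw _]]].
by rewrite (finite_partE fw) (finite_partE gw) e.
Qed.

(** A finite value is the limit at [z], and a pole is incompatible with being bounded near [z]. *)
Lemma merom_eq_at f g z : meromorphic f -> meromorphic g ->
  (\forall w \near z^', f w = g w) -> f z = g z.
Proof.
have half f1 g1 v : meromorphic f1 -> meromorphic g1 ->
    (\forall w \near z^', f1 w = g1 w) -> f1 z = None -> g1 z = Some v -> False.
  move=> mf mg E fz gz; have M0 : 0 < cabs v + 1 by have := cabs_ge0 v; lra.
  have cg : {for z, continuous (finite_part g1)}.
    by apply: cdiff_cont; apply: nbhs_singleton; apply: (merom_holo mg); rewrite gz.
  have /near_cabs/near_cabs/dnearW bg := rcont_bounded (cont_cabs_comp cg).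
  have [w _ [[e b1] b2]] := dnear_ex (dnear_and (dnear_and E (merom_pole mf fz M0)) bg).
  move: b1 b2; rewrite /finite_part e gz /=; lra.
move=> mf mg E; case fz : (f z) => [u|]; case gz : (g z) => [v|] //.
- have cf : {for z, continuous (finite_part f)}.
    by apply: cdiff_cont; apply: nbhs_singleton; apply: (merom_holo mf); rewrite fz.
  have cg : {for z, continuous (finite_part g)}.
    by apply: cdiff_cont; apply: nbhs_singleton; apply: (merom_holo mg); rewrite gz.
  congr Some; apply/eqP; rewrite -subr_eq0; apply/eqP; apply: cabs_small => e e0.
  have e2 : 0 < e / 2 by lra.
  move: cf cg => /ccontP /(_ _ e2) /near_cabs /dnearW n1 /ccontP /(_ _ e2) /near_cabs /dnearW
    n2.
  have [w _ [[E1 b1] b2]] := dnear_ex (dnear_and (dnear_and E n1) n2).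
  move: b1 b2; rewrite /finite_part E1 fz gz /=; set y := odflt 0 _ => b1 b2.
  by have := cabs_dist u y v; rewrite [cabs (u - y)]cabsB; lra.
- by exfalso; apply: (half g f u mg mf) => //; apply: dnear_imp E.
- by exfalso; exact: (half f g v mf mg).
Qed.

(* The set of points near which [f = g] is open and closed; its indicator along a segment
   is then continuous, and the intermediate value theorem forbids a jump. *)
Lemma identity_theorem f g z0 : meromorphic f -> meromorphic g ->
  (\forall w \near z0^', f w = g w) -> forall z, f z = g z.
Proof.
move=> mf mg E0 z1; pose S z := \forall w \near z^', f w = g w.
suff : S z1 by exact: merom_eq_at.
have dich z : S z \/ \forall w \near z^', f w <> g w.
  have [h|h] := merom_dichotomy 1 z mf mg; [left|right].
    by apply: finite_eq => //; apply: dnear_imp h => w ->; rewrite mul1r.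
  apply: dnear_imp h => w; rewrite mul1r => /eqP h e; apply: h.
  by rewrite /finite_part e.
have openS z : S z -> \forall w \near z, S w.
  move=> Sz; have /dnear_cabs[d d0 hd] := dnear_near Sz.
  apply/near_cabs; exists d; first exact: d0.
  move=> w wd; have [->|wz] := eqVneq w z; first exact: Sz.
  exact: (dnearW (hd w wz wd)).
have openN z : ~ S z -> \forall w \near z, ~ S w.
  move=> Sz; have [//|/dnear_near /dnear_cabs[d d0 hd]] := dich z.
  apply/near_cabs; exists d; first exact: d0.
  move=> w wd; have [->|wz] := eqVneq w z; first exact: Sz.
  move=> Sw; by have [v _ [e ne]] := dnear_ex (dnear_and Sw (dnearW (hd w wz wd))).
apply: contrapT => NS1; have S0 : S z0 by exact: E0.
clear dich E0; clearbody S.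
pose phi t : R := if `[< S (z0 + rc t * (z1 - z0)) >] then 1 else 0.
have loc t : exists2 d, 0 < d & forall s, `|s - t| < d -> phi s = phi t.
  have [d d0 hd] : exists2 d, 0 < d & forall w, cabs (w - (z0 + rc t * (z1 - z0))) < d ->
      `[< S w >] = `[< S (z0 + rc t * (z1 - z0)) >].
    have [St|St] := pselect (S (z0 + rc t * (z1 - z0))).
      have /near_cabs[d d0 hd] := openS _ St; exists d; first exact: d0.
      by move=> w /hd Sw; rewrite (asboolT Sw) (asboolT St).
    have /near_cabs[d d0 hd] := openN _ St; exists d; first exact: d0.
    by move=> w /hd Sw; rewrite (asboolF Sw) (asboolF St).
  have v1 : 0 < cabs (z1 - z0) + 1 by have := cabs_ge0 (z1 - z0); lra.
  exists (d / (cabs (z1 - z0) + 1)) => [|s]; first by rewrite divr_gt0.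
  rewrite ltr_pdivlMr// => st; rewrite /phi (hd (z0 + rc s * (z1 - z0))); first by [].
  have -> : z0 + rc s * (z1 - z0) - (z0 + rc t * (z1 - z0)) = rc (s - t) * (z1 - z0).
    by rewrite rcB; ring.
  by rewrite cabsM cabs_rc; have := normr_ge0 (s - t); nra.
have cphi : {within `[0, 1], continuous phi}.
  apply: continuous_subspaceT => t; apply/cvgrPdist_lt => e e0; have [d d0 hd] := loc t.
  apply/nbhs_ballP; exists d => // s; rewrite /ball /= distrC => /hd ->.
  by rewrite subrr normr0.
have p0 : phi 0 = 1 by rewrite /phi rc0 mul0r addr0 (asboolT S0).
have p1 : phi 1 = 0.
  by rewrite /phi rc1 mul1r [z0 + _]addrC subrK (asboolF NS1).
have [|t _] := @IVT R phi 0 1 (2^-1) ler01 cphi.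
  by rewrite p0 p1 minEle maxEle ler10 /=; apply/andP; split; lra.
rewrite /phi; case: asboolP => _; lra.
Qed.

Lemma merom_cst c : meromorphic (fun _ : C => Some c).
Proof.
move=> z; split; last exact: derivable_cst.
by apply/dnear_cabs; exists 1 => // w _ _; split => //; exact: derivable_cst.
Qed.

Lemma near_notin (rs : seq C) x : (forall y, y \in rs -> y != x) ->
  \forall w \near x, w \notin rs.
Proof.
elim: rs => [|y rs IH] h; first exact: near_all.
have h1 : \forall w \near x, w != y by apply: near_neq; rewrite eq_sym h ?mem_head.
have h2 : \forall w \near x, w \notin rs by apply: IH => v vr; apply: h; rewrite inE vr orbT.
near=> w; rewrite inE negb_or; apply/andP; split; by near: w.
Unshelve. all: by end_near.
Qed.

Lemma poly_root_isolated (P : {poly C}) x : P != 0 -> \forall w \near x, root P w -> w = x.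
Proof.
move=> P0; have [rs PE] := closed_field_poly_normal P.
have l0 : lead_coef P != 0 by rewrite lead_coef_eq0.
have h : \forall w \near x, w \notin [seq y <- rs | y != x].
  by apply: near_notin => y; rewrite mem_filter => /andP[].
apply: filterS h => w; rewrite mem_filter negb_and negbK => /orP[/eqP //|wr].
by rewrite PE rootZ// root_prod_XsubC (negbTE wr).
Qed.
End Meromorphic.

(** * Boundedness of the pulled-back metric at every kind of point *)

Section BoundedDensity.
Context {R : realType}.
Local Notation C := (Cplx R).
Implicit Types (z w x c : C) (h H Y : C -> C) (al : 'I_6 -> C).

Lemma cD_ext h H w : cdiff H w -> (\forall v \near w, H v = h v) -> cD h w = cD H w.
Proof. by move=> dH e; apply: cDE; apply: cder_ext e _; exact: cDP. Qed.

Lemma density_ext al h H z : holo H z -> (\forall w \near z^', h w = H w) ->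
  \forall w \near z^', density al h w = density al H w.
Proof.
move=> hH e; have := dnear_and (dnear_near e) (dnearW hH); apply: dnear_imp => w [ew dw].
rewrite /density (nbhs_singleton ew) (@cD_ext h H)//.
by apply: filterS ew => v ->.
Qed.

(** Comparing the orders [k] and [l] of the two zeros decides whether the quotient or its inverse
    extends; in the second case the order [l - k] is positive, so the extension vanishes at [z]. *)
Lemma holo_quotient (N D : C -> C) z : holo N z -> holo D z ->
  (\forall w \near z^', N w != 0) -> (\forall w \near z^', D w != 0) ->
  exists2 H, holo H z & (\forall w \near z^', N w / D w = H w) \/
    (H z = 0 /\ \forall w \near z^', H w != 0 /\ N w / D w = (H w)^-1).
Proof.
move=> hN hD N0 D0.
have [Z|[k [u [hu u0 NE]]]] := zero_order hN.
  by have [w _ [n0 /eqP]] := dnear_ex (dnear_and N0 (dnearW Z)); rewrite (negbTE n0).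
have [Z|[l [v [hv v0 DE]]]] := zero_order hD.
  by have [w _ [n0 /eqP]] := dnear_ex (dnear_and D0 (dnearW Z)); rewrite (negbTE n0).
have nu := cont_neq0 u0 (cdiff_cont (nbhs_singleton hu)).
have nv := cont_neq0 v0 (cdiff_cont (nbhs_singleton hv)).
have hq i (p q : C -> C) : holo p z -> holo q z -> (\forall w \near z, q w != 0) ->
    holo (fun w => (w - z) ^+ i * (p w / q w)) z.
  move=> hp hq nq; suff : \forall w \near z, cdiff (fun w =>
    (w - z) ^+ i * (p w / q w)) w by [].
  near=> w; have d1 : cdiff p w by near: w. have d2 : cdiff q w by near: w.
  have n1 : q w != 0 by near: w.
  exact: cdiffM (cdiffX i (cdiff_subr z w)) (cdiffM d1 (cdiffV n1 d2)).
have nz : \forall w \near z^', w != z by apply/dnear_cabs; exists 1.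
have [lk|kl] := leqP l k.
  exists (fun w => (w - z) ^+ (k - l) * (u w / v w)); first exact: hq.
  left; apply: dnear_imp (dnear_and nz (dnearW nv)) => w [wz n1].
  have wz0 : (w - z) ^+ l != 0 by rewrite expf_neq0// subr_eq0.
  by rewrite NE DE -{1}(subnK lk) exprD; field; rewrite n1 wz0.
exists (fun w => (w - z) ^+ (l - k) * (v w / u w)); first exact: hq.
right; split; first by rewrite subrr expr0n subn_eq0 leqNgt kl mul0r.
apply: dnear_imp (dnear_and nz (dnear_and (dnearW nu) (dnearW nv))) => w [wz [n1 n2]].
have wz0 : (w - z) ^+ k != 0 by rewrite expf_neq0// subr_eq0.
have wz1 : (w - z) ^+ (l - k) != 0 by rewrite expf_neq0// subr_eq0.
split; first by rewrite !mulf_neq0// invr_neq0.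
by rewrite NE DE -{1}(subnK (ltnW kl)) exprD; field; rewrite n1 n2 wz0 wz1.
Unshelve. all: by end_near.
Qed.

Lemma density_bounded_regular al H z : holo H z -> (forall j, H z != al j) ->
  exists M : R, \forall w \near z^', density al H w <= M.
Proof.
move=> hH ha; exists (density al H z + 1); apply: dnearW.
exact: rcont_bounded (density_cont hH ha).
Qed.

(** The inverse has derivative [- H' / H^2], whose sixth power brings [|H|^(-12)]. Each of the six
    factors absorbs exactly [|H|^(-2)], and what remains is continuous at [z]. *)
Lemma density_bounded_pole al H z : holo H z -> H z = 0 -> (\forall w \near z^', H w != 0) ->
  exists M : R, \forall w \near z^', density al (fun w => (H w)^-1) w <= M.
Proof.
move=> hH Hz H0.
pose Bd w := cabs (cD H w) ^+ 6 *
  \prod_j ((cabs (H w) + cabs (1 - al j * H w)) / cabs (1 - al j * H w) ^+ 3).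
have cH := cdiff_cont (nbhs_singleton hH).
have cl j : {for z, continuous (fun w => 1 - al j * H w)}.
  exact (contD (cont_cst 1 z) (contN (contM (cont_cst (al j) z) cH))).
have cB : {for z, continuous Bd}.
  have c1 := cont_cabs_comp (cdiff_cont (holo_cdiff_cD hH)).
  have cp j : {for z, continuous (fun w => (cabs (H w) + cabs (1 - al j * H w)) / cabs (1 - al
    j * H w) ^+ 3)}.
    have n0 : cabs (1 - al j * H z) ^+ 3 != 0 by rewrite Hz mulr0 subr0 cabs1 expr1n oner_neq0.
    have c2 := cont_cabs_comp (cl j).
    have c3 := @rcontV R (fun w => cabs (1 - al j * H w) ^+ 3) z n0 (rcontX c2).
    exact (rcontM (rcontD (cont_cabs_comp cH) c2) c3).
  exact (rcontM (rcontX c1) (@rcont_prod R _ (index_enum 'I_6) _ z cp)).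
have nl : \forall w \near z^', forall j, 1 - al j * H w != 0.
  apply: dnear_all6 => j; apply: dnearW; apply: (@cont_neq0 R (fun w =>
    1 - al j * H w) z _ (cl j)).
  by rewrite Hz mulr0 subr0 oner_neq0.
exists (Bd z + 1).
apply: dnear_imp (dnear_and (dnear_and H0 nl) (dnear_and (dnearW hH) (dnearW (rcont_bounded
  cB)))).
move=> w [[n0 nj] [dw]]; suff -> : density al (fun w => (H w)^-1) w = Bd w by [].
rewrite /density /Bd (cDE (cderV n0 (cDP dw))) cabsM cabsN cabsV cabsX.
have h0 : cabs (H w) != 0 by rewrite cabs_eq0.
have -> : (cabs (cD H w) / cabs (H w) ^+ 2) ^+ 6 =
  cabs (cD H w) ^+ 6 * \prod_(j < 6) (cabs (H w) ^+ 2)^-1.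
  by rewrite prodr_const card_ord expr_div_n exprVn.
rewrite -mulrA -big_split /=; congr (_ * _); apply: eq_bigr => j _.
have -> : (H w)^-1 - al j = (1 - al j * H w) / H w by field.
rewrite cabsM cabsV; have := nj j; rewrite -cabs_eq0.
move: (cabs (H w)) (cabs (1 - al j * H w)) h0 => x y x0 y0.
by field; rewrite x0 y0.
Qed.

(* Differentiating [Y^2 = Q(H)] gives [H' = 2 Y Y' / Q'(H)], so [|H'|^2 / |H - al j|] stays
   bounded where [H = al j]. *)
Lemma density_bounded_branch al H Y (Q : {poly C}) z j0 : injective al ->
  holo H z -> holo Y z -> (\forall w \near z^', Y w ^+ 2 = Q.[H w]) ->
  (\forall w \near z^', H w != al j0) ->
  H z = al j0 -> Q.[al j0] = 0 -> Q^`().[al j0] != 0 ->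
  exists M : R, \forall w \near z^', density al H w <= M.
Proof.
move=> ainj hH hY YQ nH Hz Q0 Q'0.
have /factor_theorem[Q1 QE] : root Q (al j0) by apply/eqP.
(* The denominator at [j0] is dropped: it cancels against [|Y|^6 = |Q1(H)|^3 |H - al j0|^3], and the
   constant 64 below is [2^6] from [H' = 2 Y Y' / Q'(H)]. *)
pose fac j w := if j == j0 then 1 + cabs (H w - al j)
  else (1 + cabs (H w - al j)) / cabs (H w - al j) ^+ 3.
pose Bd w := 64 * cabs (cD Y w) ^+ 6 * cabs Q1.[H w] ^+ 3 / cabs Q^`().[H w] ^+ 6 *
  \prod_j fac j w.
have cH := cdiff_cont (nbhs_singleton hH).
have cPoly (P : {poly C}) : {for z, continuous (fun w => P.[H w])}.
  by have [l hl] := nbhs_singleton hH; exact: cder_cont (cder_comp hl (cder_horner P (H z))).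
have cr j : {for z, continuous (fun w => cabs (H w - al j))}.
  exact (cont_cabs_comp (contD cH (cont_cst (- al j) z))).
have cfac j : {for z, continuous (fac j)}.
  rewrite /fac; case: eqP => [_|/eqP jj]; first exact (rcontD (rcont_cst 1 z) (cr j)).
  have n0 : cabs (H z - al j) ^+ 3 != 0.
    by rewrite expf_neq0// cabs_eq0 subr_eq0 Hz (inj_eq ainj) eq_sym.
  have c3 := @rcontV R (fun w => cabs (H w - al j) ^+ 3) z n0 (rcontX (cr j)).
  exact (rcontM (rcontD (rcont_cst 1 z) (cr j)) c3).
have cB : {for z, continuous Bd}.
  have c1 := cont_cabs_comp (cdiff_cont (holo_cdiff_cD hY)).
  have n6 : cabs Q^`().[H z] ^+ 6 != 0 by rewrite expf_neq0// cabs_eq0 Hz.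
  have c3 := @rcontV R (fun w => cabs Q^`().[H w] ^+ 6) z n6 (rcontX (cont_cabs_comp (cPoly
    _))).
  have c2 : {for z, continuous (fun w => cabs Q1.[H w] ^+ 3)} by exact: (rcontX (cont_cabs_comp
    (cPoly Q1))).
  have c4 : {for z, continuous (fun w => cabs (cD Y w) ^+ 6)} by exact: rcontX c1.
  exact (rcontM (rcontM (rcontM (rcontM (rcont_cst 64 z) c4) c2) c3)
    (@rcont_prod R _ (index_enum 'I_6) fac z cfac)).
have nQ' : \forall w \near z, Q^`().[H w] != 0.
  by apply: (@cont_neq0 R (fun w => Q^`().[H w]) z _ (cPoly _)); rewrite Hz.
exists (Bd z + 1).
have H1 := dnear_and (dnear_near YQ) (dnear_and nH (dnearW nQ')).
have H2 := dnear_and (dnearW hH) (dnear_and (dnearW hY) (dnearW (rcont_bounded cB))).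
apply: dnear_imp (dnear_and H1 H2) => w [[YQw [Hj n']] [dH [dY]]].
suff -> : density al H w = Bd w by [].
have YQ1 := nbhs_singleton YQw.
have der : 2 * Y w * cD Y w = Q^`().[H w] * cD H w.
  have e1 := cderX 2 (cDP dY); have e2 := cder_comp (cDP dH) (cder_horner Q (H w)).
  by rewrite -(cder_uniq (cder_ext YQw e1) e2) expr1.
have yE : cabs (Y w) ^+ 2 = cabs Q1.[H w] * cabs (H w - al j0).
  by rewrite -cabsX YQ1 QE hornerM cabsM hornerXsubC.
have tE : cabs (cD H w) = 2 * cabs (Y w) * cabs (cD Y w) / cabs Q^`().[H w].
  apply: (mulIf (_ : cabs Q^`().[H w] != 0)); first by rewrite cabs_eq0.
  rewrite divfK ?cabs_eq0// -cabsM mulrC -der !cabsM.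
  by rewrite cabs2.
rewrite /density /Bd (bigD1 j0)//= [in RHS](bigD1 j0)//= {1}/fac eqxx.
have -> : \prod_(j | j != j0) fac j w = \prod_(j | j != j0) ((1 + cabs (H w - al j)) / cabs (H
  w - al j) ^+ 3).
  by apply: eq_bigr => j jj; rewrite /fac (negbTE jj).
rewrite tE.
have r0 : cabs (H w - al j0) != 0 by rewrite cabs_eq0 subr_eq0.
have k0 : cabs Q^`().[H w] != 0 by rewrite cabs_eq0.
move: yE r0 k0; move: (cabs (Y w)) (cabs (cD Y w)) (cabs Q1.[H w]) (cabs Q^`().[H w]) (cabs (H
  w - al j0)) (\prod_(j | _) _).
move=> y y' s k r P yE r0 k0.
have -> : (2 * y * y' / k) ^+ 6 = 64 * (y ^+ 2) ^+ 3 * y' ^+ 6 / k ^+ 6 by field.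
by rewrite yE; field; rewrite r0 k0.
Qed.
End BoundedDensity.

(** * The uniqueness theorem *)

Section StrongUniqueness.
Context {R : realType}.
Local Notation C := (Cplx R).
Implicit Types (z w c a b A : C) (f g : C -> sphere R) (m : nat).

(** Indexed by [m = n - 3], which keeps truncated subtraction out of the exponents. *)
Definition trinomial m a b : {poly C} := 'X^(m.+3) + a *: 'X^(m.+2) + b *: 'X^(m.+1).

Lemma trinomialE m a b w : (trinomial m a b).[w] = w ^+ m.+3 + a * w ^+ m.+2 + b * w ^+ m.+1.
Proof. by rewrite /trinomial !(hornerXn, hornerZ, hornerD). Qed.

Lemma finite_horner_eq (P : {poly C}) f g A w : f w <> None -> g w <> None ->
  sphere_horner P (f w) = omap (fun u => A * u) (sphere_horner P (g w)) ->
  P.[finite_part f w] = A * P.[finite_part g w].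
Proof.
by move=> /finite_partE fw /finite_partE gw; rewrite {1}fw {1}gw /= => -[].
Qed.

Lemma nonconstant_locally g c z : meromorphic g -> nonconstant g ->
  ~ (\forall w \near z^', g w = Some c).
Proof.
move=> mg ng h; apply: ng; exists (Some c).
exact: (@identity_theorem R g (fun _ => Some c) z mg (merom_cst c) h).
Qed.

(** Substituting [f = c g] makes the values of [g] roots of a fixed polynomial [Q]. If [Q] is
    non-zero, its roots are isolated and [g] is locally constant; if [Q = 0], two of its
    coefficients give [c^n = A = c^(n-1)], so [c = 1]. *)
Lemma constant_ratio m a b A f g c z0 : a != 0 -> A != 0 ->
  meromorphic f -> meromorphic g -> nonconstant g ->
  (forall z, sphere_horner (trinomial m a b) (f z) =
             omap (fun u => A * u) (sphere_horner (trinomial m a b) (g z))) ->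
  (\forall w \near z0^', finite_part f w = c * finite_part g w) ->
  forall z, f z = g z.
Proof.
move=> a0 A0 mf mg ng PE fcg.
pose Q : {poly C} := (c ^+ m.+3 - A) *: 'X^(m.+3) + (a * (c ^+ m.+2 - A)) *: 'X^(m.+2)
  + (b * (c ^+ m.+1 - A)) *: 'X^(m.+1).
have regf := merom_regular mf z0; have regg := merom_regular mg z0.
have [Q0|Q0] := eqVneq Q 0.
  have c3 : c ^+ m.+3 = A.
    move/(congr1 (fun p : {poly C} => p`_(m.+3))): Q0; rewrite !coefD !coefZ !coefXn coef0 eqxx.
    rewrite !eqSS (gtn_eqF (ltnSn m)) (gtn_eqF (ltnW (ltnSn m.+1))) !mulr0 !addr0 mulr1.
    by move/eqP; rewrite subr_eq0 => /eqP.
  have c2 : c ^+ m.+2 = A.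
    move/(congr1 (fun p : {poly C} => p`_(m.+2))): Q0; rewrite !coefD !coefZ !coefXn coef0 eqxx.
    rewrite !eqSS (ltn_eqF (ltnSn m)) (gtn_eqF (ltnSn m)) !mulr0 add0r addr0 mulr1.
    by move/eqP; rewrite mulf_eq0 (negbTE a0) subr_eq0 => /eqP.
  have c1 : c = 1.
    have cc : c * A = A by rewrite -{1}c2 -exprS.
    by apply: (mulIf A0); rewrite cc mul1r.
  apply: (@identity_theorem R f g z0 mf mg); apply: finite_eq => //.
  by apply: dnear_imp fcg => w ->; rewrite c1 mul1r.
(* Move to a point with a full neighbourhood on which both functions are finite. *)
have [z1 _ h1] := dnear_ex (dnear_near (dnear_and fcg (dnear_and regf regg))).
have [_ [_ [_ dg1]]] := nbhs_singleton h1.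
have rootQ : \forall w \near z1, root Q (finite_part g w).
  apply: filterS h1 => w [e [[fw _] [gw _]]].
  have := finite_horner_eq fw gw (PE w); rewrite e !trinomialE => H.
  apply/eqP; rewrite /Q !(hornerXn, hornerZ, hornerD) -[RHS](subrr (A * (finite_part g w ^+
    m.+3 +
    a * finite_part g w ^+ m.+2 + b * finite_part g w ^+ m.+1))) -{1}H !exprMn; ring.
have cg : {for z1, continuous (finite_part g)} by exact: cdiff_cont.
have iso : \forall w \near z1, root Q (finite_part g w) -> finite_part g w = finite_part g z1.
  exact: (cg _ (poly_root_isolated (finite_part g z1) Q0)).
exfalso; apply: (@nonconstant_locally g (finite_part g z1) z1 mg ng); apply: dnearW.
have gN : \forall w \near z1, g w <> None by apply: filterS h1 => w [_ [_ []]].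
near=> w; have gw : g w <> None by near: w.
rewrite (finite_partE gw); congr Some.
have rw : root Q (finite_part g w) by near: w.
have iw : root Q (finite_part g w) -> finite_part g w = finite_part g z1 by near: w.
exact: iw.
Unshelve. all: by end_near.
Qed.

Lemma derivative_zero_locally_constant (h : C -> C) z :
  (\forall w \near z, cdiff h w /\ cD h w = 0) -> \forall w \near z, h w = h z.
Proof.
move=> /near_cabs[d d0 hd]; apply/near_cabs; exists d => // w wd.
apply/eqP; rewrite -subr_eq0 -cabs_eq0 eq_le cabs_ge0 andbT.
have hP t : 0 <= t <= 1 -> curve_der (fun s => h (z + rc s * (w - z))) t (0 * (w - z)).
  move=> t01; have zt : cabs (z + rc t * (w - z) - z) < d.
    by apply: le_lt_trans wd; exact: (@seg_near R z w t _ t01 (lexx _)).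
  by apply: curve_der_comp; have [dh <-] := hd _ zt; exact: cDP.
have := @curve_bound R (fun s => h (z + rc s * (w - z))) (fun _ => 0 * (w - z)) 0 hP.
rewrite rc1 rc0 mul1r !mul0r addr0 [z + _]addrC subrK mulr0; apply.
by move=> t _; rewrite cabs0.
Qed.

(** Completing the square: division by [y^(m+1)] leaves [alpha y^2 + beta y + gamma = 0], and
    [(2 alpha y + beta)^2] differs from the discriminant by [4 alpha] times the left-hand side. *)
Lemma discr_square m a b A (x y : C) : y != 0 ->
  (trinomial m a b).[x] = A * (trinomial m a b).[y] ->
  (2 * y * ((x / y) ^+ m.+3 - A) + a * ((x / y) ^+ m.+2 - A)) ^+ 2 = (discr m a b A).[x / y].
Proof.
move=> y0 E.
rewrite /discr hornerD hornerN !hornerZ horner_exp hornerM !(hornerXn, hornerC, hornerN,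
  hornerD).
set h := x / y; have xE : x = h * y by rewrite /h divfK.
have key : y ^+ 2 * (h ^+ m.+3 - A) + a * y * (h ^+ m.+2 - A) + b * (h ^+ m.+1 - A) = 0.
  have yn : y ^+ m.+1 != 0 by rewrite expf_neq0.
  apply: (mulIf yn); rewrite mul0r; move/eqP: E; rewrite -subr_eq0 => /eqP <-.
  rewrite !trinomialE xE !exprMn [y ^+ m.+3]exprSr [y ^+ m.+2]exprSr; ring.
transitivity (a ^+ 2 * (h ^+ m.+2 - A) ^+ 2 - 4 * b * ((h ^+ m.+3 - A) * (h ^+ m.+1 - A))
  + 4 * (h ^+ m.+3 - A) * 0); last by rewrite mulr0 addr0.
by rewrite -key; ring.
Qed.

Lemma strong_uniqueness_trinomial m a b : (3 <= m)%N -> a != 0 -> b != 0 ->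
  a ^+ 2 = 4 * (1 - 1 / m.+2%:R ^+ 2) * b -> strong_uniqueness_poly (trinomial m a b).
Proof.
move=> m3 a0 b0 ab f g A mf mg nf ng A0 PE.
have [[c [z0 fcg]]|nocst] := pselect (exists c z, \forall w \near z^', finite_part f w =
  c * finite_part g w).
  exact: (constant_ratio a0 A0 mf mg ng PE fcg).
exfalso.
have fne c z : \forall w \near z^', finite_part f w != c * finite_part g w.
  by have [h|//] := merom_dichotomy c z mf mg; exfalso; apply: nocst; exists c, z.
have gne z : \forall w \near z^', finite_part g w != 0.
  have [h|h] := merom_dichotomy 0 z mg mg; last by apply: dnear_imp h => w; rewrite mul0r.
  exfalso; apply: (@nonconstant_locally g 0 z mg ng).
  apply: (@finite_eq R g (fun _ => Some 0) z mg (merom_cst 0)).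
  by apply: dnear_imp h => w ->; rewrite mul0r.
have [al ainj hal] := discr_six_simple_roots m3 A0 b0 ab.
pose F := finite_part f; pose G := finite_part g; pose h w := F w / G w.
(* The complement of [good] is the exceptional set given to [ahlfors]; the default values entering
   [h] occur only there. *)
pose good w := [/\ f w <> None, g w <> None, G w != 0 & forall j, F w != al j * G w].
have near_good z : \forall w \near z^', good w.
  have := dnear_and (dnear_and (merom_regular mf z) (merom_regular mg z))
    (dnear_and (gne z) (dnear_all6 (fun j => fne (al j) z))).
  by apply: dnear_imp => w [[[? _] [? _]] [? ?]]; split.
have good_open z : good z -> \forall w \near z, good w.
  move=> gz; have /dnear_cabs[d d0 hd] := near_good z; apply/near_cabs; exists d => // w wd.
  by have [->//|wz] := eqVneq w z; exact: hd.
have hholo z : good z -> holo h z.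
  move=> gz; suff : \forall w \near z, cdiff h w by [].
  apply: filterS (good_open z gz) => w [fw gw Gw _].
  exact: cdiffM (nbhs_singleton (merom_holo mf fw)) (cdiffV Gw (nbhs_singleton (merom_holo mg
    gw))).
have hal' z j : good z -> h z != al j.
  by move=> [_ _ Gz /(_ j)]; apply: contra => /eqP <-; rewrite /h divfK.
pose y w := 2 * G w * (h w ^+ m.+3 - A) + a * (h w ^+ m.+2 - A).
have yQ w : good w -> y w ^+ 2 = (discr m a b A).[h w].
  by move=> [fw gw Gw _]; apply: discr_square => //; exact: finite_horner_eq.
have ydiff w : good w -> cdiff y w.
  move=> gw; have dh := nbhs_singleton (hholo w gw); case: gw => fw gw Gw _.
  have dG := nbhs_singleton (merom_holo mg gw).
  have e1 := cdiffM (cdiffM (cdiff_cst 2 w) dG) (cdiffB (cdiffX m.+3 dh) (cdiff_cst A w)).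
  exact: cdiffD e1 (cdiffM (cdiff_cst a w) (cdiffB (cdiffX m.+2 dh) (cdiff_cst A w))).
(* Three cases for the extension of [h] to [z]: a pole, a regular value, or one of the roots [al j],
   where the square root of the discriminant is needed. *)
have bdd z : exists M : R, \forall w \near z^', density al h w <= M.
  have [p1 [q1 [hp1 hq1 E1]]] := merom_local z mf.
  have [p2 [q2 [hp2 hq2 E2]]] := merom_local z mg.
  have hM (p q : C -> C) : holo p z -> holo q z -> holo (fun w => p w * q w) z.
    move=> hp hq; suff : \forall w \near z, cdiff (fun w => p w * q w) w by [].
    near=> w; have d1 : cdiff p w by near: w. have d2 : cdiff q w by near: w.
    exact: cdiffM.
  have hE : \forall w \near z^', [/\ p1 w * q2 w != 0, q1 w * p2 w != 0 & h w =
    p1 w * q2 w / (q1 w * p2 w)].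
    have := dnear_and (dnear_and E1 E2) (dnear_and (fne 0 z) (gne z)).
    apply: dnear_imp => w [[[n1 e1] [n2 e2]] [f0 g0]].
    rewrite mul0r in f0; rewrite /h /F /G e1 e2; rewrite e1 in f0; rewrite e2 in g0.
    have p10 : p1 w != 0 by apply: contraNneq f0 => ->; rewrite mul0r.
    have p20 : p2 w != 0 by apply: contraNneq g0 => ->; rewrite mul0r.
    split; [exact: mulf_neq0|exact: mulf_neq0|].
    by field; rewrite n1 n2 p20.
  have N0 : \forall w \near z^', p1 w * q2 w != 0 by apply: dnear_imp hE => w [].
  have D0 : \forall w \near z^', q1 w * p2 w != 0 by apply: dnear_imp hE => w [].
  have [H hH [HE|[Hz HE]]] := holo_quotient (hM _ _ hp1 hq2) (hM _ _ hq1 hp2) N0 D0; last first.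
    have H0 : \forall w \near z^', H w != 0 by apply: dnear_imp HE => w [].
    have [M bM] := density_bounded_pole al hH Hz H0; exists M.
    have hH' : \forall w \near z^', h w = (H w)^-1.
      by apply: dnear_imp (dnear_and hE HE) => w [[_ _ ->] [_ ->]].
    apply: dnear_imp (dnear_and (dnear_and bM H0) (dnear_and (dnear_near hH') (dnearW hH))).
    move=> w [[bw H0w] [ew dw]]; apply: le_trans bw; rewrite le_eqVlt; apply/orP; left;
      apply/eqP.
    rewrite /density (nbhs_singleton ew) (@cD_ext R h (fun w => (H w)^-1))//;
      first exact: cdiffV.
    by apply: filterS ew => v ->.
  have hH' : \forall w \near z^', h w = H w.
    by apply: dnear_imp (dnear_and hE HE) => w [[_ _ ->] ->].
  have dE := density_ext al hH hH'.
  suff [M bM] : exists M : R, \forall w \near z^', density al H w <= M.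
    by exists M; apply: dnear_imp (dnear_and dE bM) => w [-> ].
  have [[j0 Hj]|nj] := pselect (exists j, H z = al j); last first.
    apply: density_bounded_regular hH _ => j; apply/eqP => e; apply: nj; by exists j.
  have cH := cdiff_cont (nbhs_singleton hH).
  have cQ : {for z, continuous (fun w => (discr m a b A).[H w])}.
    by have [l hl] := nbhs_singleton hH; exact: cder_cont (cder_comp hl (cder_horner _ (H z))).
  pose K := cabs (discr m a b A).[H z] + 1.
  have K1 : 1 <= K by rewrite lerDr cabs_ge0.
  (* Although [y] contains [g], which may have a pole at [z], its square is the discriminant at [H],
     so it is bounded and extends. *)
  have ybd : \forall w \near z^', cabs (y w) <= K.
    have := dnear_and (near_good z) (dnear_and hH' (dnearW (rcont_bounded (cont_cabs_comp
      cQ)))).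
    apply: dnear_imp => w [gw [ew bw]].
    have : cabs (y w) ^+ 2 <= K by rewrite -cabsX yQ// ew.
    have := cabs_ge0 (y w); nra.
  have [Y hY YE] := removable_bounded (dnear_imp ydiff (near_good z)) ybd.
  have YQ : \forall w \near z^', Y w ^+ 2 = (discr m a b A).[H w].
    by apply: dnear_imp (dnear_and (near_good z) (dnear_and hH' YE)) => w [gw [ew ->]];
      rewrite yQ// ew.
  have nH : \forall w \near z^', H w != al j0.
    by apply: dnear_imp (dnear_and (near_good z) hH') => w [gw <-]; exact: hal'.
  exact: density_bounded_branch ainj hH hY YQ nH Hj (hal j0).1 (hal j0).2.
have hB z : \forall w \near z^', ~ ~ good w by apply: dnear_imp (near_good z) => w gw.
have D0 := @ahlfors R al h (fun z => ~ good z) ainj hB (fun z gz => hholo z (contrapT gz))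
  (fun z j gz => hal' z j (contrapT gz)) (fun z _ => bdd z).
have [z1 _ gz1] := dnear_ex (near_good 0).
(* A vanishing derivative makes [h] constant near [z1], so [f] is locally a constant multiple of
   [g], the case already excluded. *)
apply: nocst; exists (h z1), z1; apply: dnearW.
have hc : \forall w \near z1, h w = h z1.
  apply: derivative_zero_locally_constant; apply: filterS (good_open z1 gz1) => w gw.
  split; first exact: nbhs_singleton (hholo w gw).
  exact: (D0 w (fun ng => ng gw)).
near=> w; have gw : good w by near: w; exact: good_open.
have e : h w = h z1 by near: w.
by case: gw => _ _ Gw _; rewrite -e /h divfK.
Unshelve. all: by end_near.
Qed.
End StrongUniqueness.

Theorem theorem6p2p3 (R : realType) (n : nat) (a b : Cplx R)
  (hn : (6 <= n)%N)
  (hab : a * b != 0)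
  (hlambda : a ^+ 2 = 4%:R * (1 - 1 / (n%:R - 1) ^+ 2) * b) :
  strong_uniqueness_poly ('X^n + a *: 'X^(n - 1) + b *: 'X^(n - 2)).
Proof.
move: hab; rewrite mulf_eq0 negb_or => /andP[a0 b0].
(* With [n = m + 3], the hypothesis [6 <= m.+3] computes to [3 <= m]. *)
case: n hn hlambda => [|[|[|m]]] // m3 hlambda.
have -> : (m.+3 - 1 = m.+2)%N by rewrite subSS subn0.
have -> : (m.+3 - 2 = m.+1)%N by rewrite !subSS subn0.
apply: strong_uniqueness_trinomial => //.
by rewrite hlambda -[m.+3%:R]natr1 addrK.
Qed.
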